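(* Let $k\ge3$, $n=k^2$, and let $H_n$ be an arbitrary graph in $\mathcal H_n$. For every set $X$ of $n$ points in weakly convex position, $\mathrm{fix}_X(H_n)<3\sqrt n$.
   Context: A set of points is in weakly convex position if it lies on the boundary of a convex plane body (this includes points in convex position and collinear sets). For $k\ge3$ and $n=k^2$, $\mathcal H_n$ is the set of all 3-connected planar graphs obtainable as follows: draw $k$ triangulations (maximal plane graphs), each with $k$ vertices, so that none of them lies inside an inner face of any other, and add further edges between them so that the whole graph is 3-connected. A drawing of a planar graph $G$ is an injective map $\pi\colon V(G)\to\mathbb{R}^2$ with edges drawn as straight segments; a plane straight line drawing is one whose edge segments meet only at common endpoints and contain no other vertex images. $\mathrm{fix}(G,\pi)$ is the maximum over plane straight line drawings $\pi'$ of $|\{v:\pi'(v)=\pi(v)\}|$, and $\mathrm{fix}_X(G)=\min\{\mathrm{fix}(G,\pi):\pi(V(G))=X\}$. *)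

(* Defs.v *)
From HB Require Import structures.
From mathcomp Require Import all_boot all_order all_algebra.
From mathcomp Require Import all_classical all_reals all_analysis.
Import Order.TTheory GRing.Theory Num.Theory.
Import numFieldNormedType.Exports.

Set Implicit Arguments.
Unset Strict Implicit.
Unset Printing Implicit Defensive.

Local Open Scope classical_set_scope.
Local Open Scope ring_scope.

Record sgraph := SGraph {
  vertex :> finType;
  adj : rel vertex;
  adj_sym : symmetric adj;
  adj_irrefl : irreflexive adj }.

Lemma induced_sym (G : sgraph) (P : pred G) :
  symmetric (fun u v : {x : G | P x} => adj (val u) (val v)).
Proof. by move=> u v; apply: adj_sym. Qed.

Lemma induced_irrefl (G : sgraph) (P : pred G) :
  irreflexive (fun u v : {x : G | P x} => adj (val u) (val v)).
Proof. by move=> u; apply: adj_irrefl. Qed.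

Definition induced (G : sgraph) (P : pred G) : sgraph :=
  SGraph (@induced_sym G P) (@induced_irrefl G P).

Definition three_connected (G : sgraph) : Prop :=
  (3 < #|G|)%N /\
  forall S : {set G}, (#|S| < 3)%N ->
  forall u v : G, u \notin S -> v \notin S ->
    connect [rel x y | [&& adj x y, x \notin S & y \notin S]] u v.

Section PlaneDrawings.
Variable R : realType.

Definition plane : Type := (R^o * R^o)%type.

Definition arc (p q : plane) (A : set plane) : Prop :=
  exists g : R -> plane,
    [/\ {within `[0, 1], continuous g},
        {in `[0, 1] &, injective g},
        g 0 = p, g 1 = q & A = g @` `[0, 1]].

Definition segment (p q : plane) : set plane :=
  [set (1 - t) *: p + t *: q | t in `[0, 1]].

(* The edge uv is drawn as the point set curve u v; values of curve on
   nonadjacent pairs are irrelevant. *)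
Definition noncrossing (G : sgraph) (pos : G -> plane)
    (curve : G -> G -> set plane) : Prop :=
  [/\ injective pos,
      forall u v w : G, adj u v -> curve u v (pos w) -> w = u \/ w = v &
      forall u v x y : G, adj u v -> adj x y ->
        [set u; v]%SET != [set x; y]%SET ->
        forall z, curve u v z -> curve x y z ->
          exists2 w : G,
            w \in ([set u; v] :&: [set x; y])%SET & z = pos w].

Definition plane_drawing (G : sgraph) (pos : G -> plane)
    (curve : G -> G -> set plane) : Prop :=
  [/\ noncrossing pos curve,
      forall u v : G, adj u v -> arc (pos u) (pos v) (curve u v) &
      forall u v : G, adj u v -> curve u v = curve v u].

Definition straight_drawing (G : sgraph) (pos : G -> plane) : Prop :=
  noncrossing pos (fun u v => segment (pos u) (pos v)).

Definition drawn_set (G : sgraph) (pos : G -> plane)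
    (curve : G -> G -> set plane) : set plane :=
  range pos `|` [set z | exists u v : G, adj u v /\ curve u v z].

(* No edge joining two nonadjacent vertices can be added to the drawing. *)
Definition maximal_plane (G : sgraph) (pos : G -> plane)
    (curve : G -> G -> set plane) : Prop :=
  plane_drawing pos curve /\
  forall u v : G, u != v -> ~~ adj u v ->
    ~ exists2 A : set plane, arc (pos u) (pos v) A &
        A `&` drawn_set pos curve `<=` [set pos u; pos v].

Definition face (D F : set plane) : Prop :=
  exists2 z, (~` D) z & F = connected_component (~` D) z.

Definition inner_face (D F : set plane) : Prop := face D F /\ bounded_set F.

(* t assigns to each vertex the triangulation it belongs to.  Triangulation i
   is the subgraph induced on the class of i: an edge of G that joins two
   vertices of one class cannot be one of the edges added afterwards, as these
   run between different triangulations.  The edges added afterwards are part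
   of the drawing as well, so the whole of G is drawn without crossings. *)
Definition in_classH (k : nat) (G : sgraph) : Prop :=
  exists (t : G -> 'I_k) (pos : G -> plane) (curve : G -> G -> set plane),
    let T i := induced (fun v : G => t v == i) in
    let posT i (v : T i) := pos (val v) in
    let curveT i (u v : T i) := curve (val u) (val v) in
    let D i := drawn_set (posT i) (curveT i) in
    [/\ plane_drawing pos curve,
        forall i, #|T i| = k,
        forall i, maximal_plane (posT i) (curveT i),
        forall i j, i != j -> ~ exists2 F, inner_face (D i) F & D j `<=` F &
        three_connected G].

Definition convex_body (B : set plane) : Prop :=
  [/\ compact B, convex_set B & B° !=set0].

Definition weakly_convex (X : set plane) : Prop :=
  exists2 B, convex_body B & X `<=` closure B `\` B°.

(* A ranges over the vertex sets that a plane straight line drawing can keep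
   fixed; for a planar graph there is at least one. *)
Definition fix_num (G : sgraph) (pi : G -> plane) : nat :=
  \max_(A : {set G} | `[< exists2 pi' : G -> plane, straight_drawing pi' &
                            A = [set v | pi' v == pi v]%SET >]) #|A|.

(* All values of fix_num are at most #|G|, so this is the minimum as soon as
   some drawing of G has vertex set X, that is, as soon as #|X| = #|G|. *)
Definition fix_set (G : sgraph) (X : set plane) : nat :=
  \big[minn/#|G|]_(m < #|G|.+1 |
    `[< exists pi : G -> plane,
          [/\ injective pi, range pi = X & fix_num pi = m] >]) m.

End PlaneDrawings.

(* Main.v *)
(* Number the points of X cyclically along the boundary of the convex body, and put
   the vertices of the i-th triangulation on the points whose number is i mod k.
   For k >= 4, in any plane straight line drawing all the other triangulations lie
   in one face of a given one, and that face is bounded by a triangle.  Hence the triangulations have pairwise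
   disjoint convex hulls, except that one of them may enclose all the others in an
   inner triangular face; the vertices of the latter are then spread over three half
   planes missing that face.  So k + 2 colours suffice to give vertices of different
   triangulations colours with disjoint convex regions.  Segments joining
   interleaved pairs of points of X meet, so the colours of the fixed vertices do
   not interleave; around the cycle they pass at most 2(k + 1) times from one
   triangulation to another, and every other step advances by at least k positions
   out of k^2, which bounds the number of fixed vertices by 3k - 1.  For k = 3,
   fixing all nine vertices would make edges of two triangles cross.

   That the others lie in one such face holds because two vertices on a face
   are adjacent in a maximal plane graph (otherwise K5 could be drawn), so that a
   face has at most three vertices, while by 3-connectivity the rest of the graph is
   attached to at least three.  The topology rests on Eilenberg's criterion: x and y
   lie in the same component of the complement of a compact K if and only if
   (z - y) / (z - x) has a continuous argument on K; the impossibility of drawing K5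
   is a parity count of such arguments. *)

Require Import Defs.
From mathcomp Require Import all_boot all_order all_algebra.
From mathcomp Require Import all_classical all_reals all_analysis.
From mathcomp Require Import ring lra zify.
Import Order.TTheory GRing.Theory Num.Theory.
Import numFieldNormedType.Exports.
Import Defs.

Set Implicit Arguments.
Unset Strict Implicit.
Unset Printing Implicit Defensive.

Local Open Scope classical_set_scope.
Local Open Scope ring_scope.

(** * Metric criteria *)

(** The hypotheses speak of one drawing by curves, the conclusion of every straight drawing, and the
    two may have different faces. Only facts about the graph itself can pass from one to the other,
    and two do. One is [locally_linked], which maximality forces in the given drawing and which then
    restricts the faces of each triangulation in every drawing. The other is the set [att] of
    vertices at which the rest of the graph is attached to a triangulation: in the given drawing all
    other triangulations lie in the unbounded face and have the same three attachments. In a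
    straight drawing these span the triangle bounding the face of each other triangulation, and for
    k >= 4 a fourth vertex of the triangulation occupies one of its two sides, so that all the
    others are on the same side. The curves are arbitrary arcs, with no assumed shape near a vertex.
    Two facts make up for this: an arc hanging at a compact set by one end separates nothing
    ([arc_nosep]), and a face that touches an inner point of an edge can be entered by an arc that
    starts at an end of that edge ([access_left]). *)

Section Metric.
Variables (R : realType) (V W : normedModType R).

Lemma open_dist (A : set V) :
  open A <-> forall x, A x -> exists2 e, 0 < e & forall y, `|x - y| < e -> A y.
Proof.
rewrite openE; split=> [H x Ax|H x Ax].
  have /nbhs_ballP[e /= e0 he] := H x Ax.
  by exists e => // y xy; apply: he; rewrite -ball_normE.
have [e e0 he] := H x Ax; apply/nbhs_ballP; exists e => //= y.
by rewrite -ball_normE; apply: he.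
Qed.

Lemma closure_dist (A : set V) x :
  closure A x <-> forall e, 0 < e -> exists2 y, A y & `|x - y| < e.
Proof.
split=> [H e e0|H B /nbhs_ballP[e /= e0 he]].
  have [|y [Ay]] := H (ball x e); first exact: nbhsx_ballx.
  by rewrite -ball_normE /=; exists y.
have [y Ay xy] := H e e0; exists y; split=> //; apply: he.
by rewrite -ball_normE.
Qed.

Lemma closed_dist (A : set V) x : closed A -> ~ A x ->
  exists2 e, 0 < e & forall y, `|x - y| < e -> ~ A y.
Proof. by rewrite -openC => /open_dist/(_ x). Qed.

Lemma within_dist (A : set V) (f : V -> W) :
  {within A, continuous f} <-> forall x, A x -> forall e, 0 < e ->
    exists2 d, 0 < d & forall y, A y -> `|x - y| < d -> `|f x - f y| < e.
Proof.
split=> [/subspace_continuousP H x Ax e e0|H].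
  have /cvgrPdist_lt/(_ e e0) := H x Ax.
  rewrite near_withinE => /nbhs_ballP[d /= d0 hd].
  by exists d => // y Ay xy; apply: hd => //; rewrite -ball_normE.
apply/subspace_continuousP => x Ax; apply/cvgrPdist_lt => e e0.
rewrite near_withinE; have [d d0 hd] := H x Ax e e0.
apply/nbhs_ballP; exists d => //= y; rewrite -ball_normE /= => xy Ay.
exact: hd.
Qed.

Lemma cont_dist (f : V -> W) :
  continuous f <-> forall x e, 0 < e ->
    exists2 d, 0 < d & forall y, `|x - y| < d -> `|f x - f y| < e.
Proof.
split=> [H x e e0|H x].
  have /cvgrPdist_lt/(_ e e0)/nbhs_ballP[d /= d0 hd] := H x.
  by exists d => // y xy; apply: hd => //; rewrite -ball_normE.
apply/cvgrPdist_lt => e e0; have [d d0 hd] := H x e e0.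
apply/nbhs_ballP; exists d => //= y; rewrite -ball_normE /= => xy.
exact: hd.
Qed.

Lemma compact_unif (K : set V) (f : V -> W) : compact K -> continuous f ->
  forall e, 0 < e -> exists2 d, 0 < d &
    forall x y, K x -> `|x - y| < d -> `|f x - f y| < e.
Proof.
move=> cK cf e e0; have e20 : 0 < e / 2 by rewrite divr_gt0.
(* Compactness in filter form: a property of small radii that holds near each point of [K] holds on
   all of [K] for a common radius. *)
have H := compact_near_coveringP K; move/H: cK => {}H.
pose P (d : R) x := forall y, `|x - y| < d -> `|f x - f y| < e.
have := @H R (0^'+) P _ => /(_ _) HH.
have {}HH : \forall d \near 0^'+, K `<=` P d.
  apply: HH => x Kx.
  have [d d0 hd] := (cont_dist f).1 cf x (e / 2) e20.
  have d20 : 0 < d / 2 by rewrite divr_gt0.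
  near=> z d' => /= y zy.
  have xz : `|x - z| < d / 2.
    by near: z; apply/nbhs_ballP; exists (d / 2) => //= t; rewrite -ball_normE.
  have d'd : d' < d / 2 by near: d'; apply: nbhs_right_lt.
  have xy : `|x - y| < d.
    rewrite (_ : x - y = (x - z) + (z - y)); last by rewrite addrA subrK.
    apply: (le_lt_trans (ler_normD _ _)); rewrite (splitr d) ltrD //.
    exact: (lt_trans zy).
  rewrite (_ : f z - f y = - (f x - f z) + (f x - f y)); last first.
    by rewrite opprB addrA subrK.
  apply: (le_lt_trans (ler_normD _ _)); rewrite normrN (splitr e) ltrD //.
    by apply: hd; apply: (lt_trans xz); lra.
  exact: hd.
have [d [d0 hd]] : exists d, 0 < d /\ K `<=` P d.
  near (0:R)^'+ => d; exists d; split; last by near: d.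
  by near: d; exact: nbhs_right_gt.
by exists d => // x y Kx; apply: hd.
Unshelve. all: by end_near. Qed.

End Metric.

Section Plane.
Variable R : realType.
Implicit Types (z w : plane R).

Lemma normpE z : `|z| = Num.max `|z.1 : R| `|z.2 : R|.
Proof. by []. Qed.

Lemma normp_lt z e : (`|z| < e) = (`|z.1 : R| < e) && (`|z.2 : R| < e).
Proof. by rewrite normpE gt_max. Qed.

Lemma normp_le z e : (`|z| <= e) = (`|z.1 : R| <= e) && (`|z.2 : R| <= e).
Proof. by rewrite normpE ge_max. Qed.

Lemma plane_hausdorff : hausdorff_space (plane R).
Proof. exact: norm_hausdorff. Qed.

Lemma compact_box (M : R) : compact [set z : plane R | `|z| <= M].
Proof.
have -> : [set z : plane R | `|z| <= M] = `[- M, M] `*` `[- M, M].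
  apply/seteqP; split=> z /=; rewrite normp_le !ler_norml !in_itv /=.
    by move=> /andP[].
  by move=> [-> ->].
by apply: compact_setX; exact: segment_compact.
Qed.

Lemma compact_closedP (K : set (plane R)) :
  compact K <-> closed K /\ exists M, forall z, K z -> `|z| <= M.
Proof.
split=> [cK|[cK [M KM]]].
  split; first exact: (compact_closed plane_hausdorff).
  have [M [_ HM]] := compact_bounded cK; exists (M + 1) => z Kz.
  by apply: HM => //; rewrite ltrDl.
by apply: (subclosed_compact cK (@compact_box M)) => z /KM.
Qed.

End Plane.

(** * Continuous arguments *)

Section Argument.
Variable R : realType.
Implicit Types (z w : plane R) (a b : R).

Definition cmul z w : plane R :=
  (z.1 * w.1 - z.2 * w.2, z.1 * w.2 + z.2 * w.1).
Definition cconj z : plane R := (z.1, - z.2).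
(** A relation, since an argument is determined only up to two pi; it also entails that [z] is not
    zero. Continuous choices are made later, by lifting. *)
Definition is_arg z a := exists2 r, 0 < r & z = (r * cos a, r * sin a).

Lemma is_argM z w a b : is_arg z a -> is_arg w b -> is_arg (cmul z w) (a + b).
Proof.
move=> [r r0 ->] [s s0 ->]; exists (r * s); first exact: mulr_gt0.
by rewrite cosD sinD /cmul /=; congr pair; ring.
Qed.

Lemma is_arg_conj z a : is_arg z a -> is_arg (cconj z) (- a).
Proof.
by move=> [r r0 ->]; exists r => //; rewrite cosN sinN /cconj /= mulrN.
Qed.

Lemma is_argZ c z w a : 0 < c -> w = (c * z.1, c * z.2) ->
  is_arg z a -> is_arg w a.
Proof.
move=> c0 -> [r r0 ->]; exists (c * r); first exact: mulr_gt0.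
by rewrite /= !mulrA.
Qed.

Lemma is_arg_neq0 z a : is_arg z a -> z != 0.
Proof.
move=> [r r0 ->]; apply/eqP => -[/eqP + /eqP]; rewrite !mulf_eq0 gt_eqF //=.
move=> /eqP c0 /eqP s0; have := cos2Dsin2 a; rewrite c0 s0 expr0n addr0 => /eqP.
by rewrite eq_sym oner_eq0.
Qed.

Lemma is_argN z a : is_arg z a -> is_arg (- z) (a + pi).
Proof.
by move=> [r r0 ->]; exists r => //; rewrite cosDpi sinDpi !mulrN.
Qed.

Lemma normsq_gt0 z : z != 0 -> 0 < z.1 ^+ 2 + z.2 ^+ 2.
Proof.
move=> z0; rewrite lt_neqAle addr_ge0 ?sqr_ge0 // andbT eq_sym.
apply: contra z0; rewrite paddr_eq0 ?sqr_ge0 // !sqrf_eq0 => /andP[/eqP a /eqP b].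
by rewrite [z]surjective_pairing a b.
Qed.

(* [cmul w (cconj z)] is a positive multiple of the quotient [w / z]. *)
Lemma is_arg_quot z w a b : z != 0 -> is_arg (cmul w (cconj z)) b ->
  is_arg z a -> is_arg w (a + b).
Proof.
move=> z0 wz za; have n0 := normsq_gt0 z0.
apply: (is_argZ (c := (z.1 ^+ 2 + z.2 ^+ 2)^-1) _ _ (is_argM za wz)).
  by rewrite invr_gt0.
rewrite [LHS]surjective_pairing /cmul /cconj /=; congr pair; field; exact: lt0r_neq0.
Qed.

Lemma is_arg_atan z : 0 < z.1 -> is_arg z (atan (z.2 / z.1)).
Proof.
move=> z0; have [/andP[l u] _] := atan_def (z.2 / z.1).
have c0 : 0 < cos (atan (z.2 / z.1)) by rewrite cos_gt0_pihalf // l u.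
have := atanK (z.2 / z.1); rewrite /tan => /(congr1 (fun x => x * cos (atan (z.2/z.1)))).
rewrite divfK ?lt0r_neq0 // => sE.
exists (z.1 / cos (atan (z.2 / z.1))); first exact: divr_gt0.
rewrite divfK ?lt0r_neq0 // sE [LHS]surjective_pairing; congr pair.
by field; rewrite !lt0r_neq0.
Qed.

Lemma is_arg_exists z : z != 0 -> exists a, is_arg z a.
Proof.
have P w : 0 < w.1 -> exists a, is_arg w a by move=> /is_arg_atan; eexists; eauto.
have N w : (exists a, is_arg w a) -> exists a, is_arg (- w) a.
  by move=> [a /is_argN]; eexists; eauto.
have Q w : w.1 != 0 -> exists a, is_arg w a.
  rewrite neq_lt => /orP[w0|]; last exact: P.
  by rewrite -[w]opprK; apply/N/P; rewrite /= oppr_gt0.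
move=> z0; have [z10|] := eqVneq z.1 0; last exact: Q.
have [|a ha] := Q (z.2, 0).
  apply: contra z0 => /eqP /= z20; apply/eqP.
  by rewrite [z]surjective_pairing z10 z20.
exists (a + pi / 2).
have H : is_arg (0, 1) (pi / 2).
  by exists 1 => //; rewrite cos_pihalf sin_pihalf !mul1r.
apply: (is_argZ (c := 1) _ _ (is_argM ha H)) => //.
by rewrite [LHS]surjective_pairing z10 /cmul /=; congr pair; ring.
Qed.

Lemma cosD2pin x n : cos (x + (pi *+ 2) *+ n) = cos x :> R.
Proof. by elim: n => [|n IH]; rewrite ?addr0 // mulrSr addrA cosD2pi. Qed.

Lemma cos_eq1 x : cos x = 1 -> exists n : int, x = n%:~R * (pi *+ 2) :> R.
Proof.
move=> cx; have p0 : 0 < pi *+ 2 :> R by rewrite mulrn_wgt0 ?pi_gt0.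
pose n := Num.floor (x / (pi *+ 2)); exists n.
have /andP[l u] := floor_itv (x / (pi *+ 2)).
pose y := x - n%:~R * (pi *+ 2).
have y0 : 0 <= y by rewrite subr_ge0 -ler_pdivlMr.
have y1 : y < pi *+ 2.
  by rewrite ltrBlDl -{2}[pi *+ 2]mul1r -mulrDl -ltr_pdivrMr // -[1]/(1%:~R) -intrD.
have cy : cos y = 1.
  rewrite -cx /y; case: (n) => m; last first.
    by rewrite NegzE mulrNz mulNr opprK -[m.+1%:~R]/(m.+1%:R) mulr_natl cosD2pin.
  by rewrite -[LHS](cosD2pin _ m) -[m%:~R]/(m%:R) mulr_natl subrK.
have [ypi|piy] := leP y pi.
  have : y = 0.
    by apply: cos_inj; rewrite ?in_itv /= ?lexx ?y0 ?ypi ?pi_ge0 // cy cos0.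
  by move/eqP; rewrite subr_eq0 => /eqP.
(* Beyond pi the angle is reflected into the interval where cosine is injective. *)
have : pi *+ 2 - y = 0.
  apply: cos_inj; rewrite ?in_itv /= ?lexx ?pi_ge0 //.
    by rewrite subr_ge0 (ltW y1) lerBlDl mulr2n lerD2r ltW.
  by rewrite cos0 -cosN opprB -[RHS]cy -[LHS]cosD2pi subrK.
by move/eqP; rewrite subr_eq0 (gt_eqF y1).
Qed.

(** The product of [z] with its conjugate is a positive real number with argument [b - a], so this
    angle has sine 0 and cosine 1. *)
Lemma is_arg_uniq z a b : is_arg z a -> is_arg z b ->
  exists n : int, b = a + n%:~R * (pi *+ 2).
Proof.
move=> za zb; have := is_argM zb (is_arg_conj za).
rewrite (_ : cmul _ _ = (z.1 ^+ 2 + z.2 ^+ 2, 0)); last first.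
  by rewrite /cmul /=; congr pair; ring.
move=> [r r0 [cr /eqP]]; rewrite eq_sym mulf_eq0 gt_eqF //= => /eqP s0.
have c1 : cos (b - a) = 1.
  have c0 : 0 < cos (b - a).
    by rewrite -(pmulr_rgt0 _ r0) -cr normsq_gt0 // (is_arg_neq0 za).
  by rewrite -(ger0_norm (ltW c0)) sin0cos1.
by have [n e] := cos_eq1 c1; exists n; rewrite -e addrC subrK.
Qed.

(** Retraction onto the square [|z| <= M]; the norm of the plane is the maximum norm. *)
Definition clamp (M : R) z : plane R :=
  (Num.max (- M) (Num.min M z.1), Num.max (- M) (Num.min M z.2)).

Lemma continuous_pair (T : topologicalType) (f g : T -> R^o) x :
  {for x, continuous f} -> {for x, continuous g} ->
  {for x, continuous (fun t => (f t, g t) : plane R)}.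
Proof.
move=> /cvgrPdist_lt cf /cvgrPdist_lt cg; apply/cvgrPdist_lt => e e0.
near=> t; rewrite normp_lt /=; apply/andP; split; near: t; [exact: cf|exact: cg].
Unshelve. all: by end_near. Qed.

Lemma continuous_clamp M : continuous (clamp M).
Proof.
have H : continuous ((fun=> - M) \max ((fun=> M) \min (fun t : R^o => t)) : R^o -> R^o).
  move=> t; apply: continuous_max; first exact: cst_continuous.
  by apply: continuous_min; [exact: cst_continuous|exact: cvg_id].
move=> z; rewrite /continuous_at /clamp.
have H1 : {for z, continuous (fun z : plane R => Num.max (- M) (Num.min M z.1) : R^o)}.
  exact: (@continuous_comp (plane R) R^o R^o fst _ z (@cvg_fst _ _ _ _ _) (H z.1)).
have H2 : {for z, continuous (fun z : plane R => Num.max (- M) (Num.min M z.2) : R^o)}.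
  exact: (@continuous_comp (plane R) R^o R^o snd _ z (@cvg_snd _ _ _ _ _) (H z.2)).
exact: (continuous_pair H1 H2).
Qed.

Lemma clamp_id M z : `|z| <= M -> clamp M z = z.
Proof.
rewrite normp_le !ler_norml => /andP[/andP[a b] /andP[c d]].
rewrite /clamp [RHS]surjective_pairing.
by rewrite (min_idPr b) (min_idPr d) (max_idPr a) (max_idPr c).
Qed.

Lemma clamp_le M z : 0 <= M -> `|clamp M z| <= M.
Proof.
move=> M0; rewrite normp_le /= !ler_norml !le_max !lexx /= !ge_max.
by rewrite !ge_min lexx !orTb !andbT !ge0_cp.
Qed.

End Argument.

(** * Continuous arguments of nonvanishing maps of the plane *)

Section Lift.
Variable R : realType.
Implicit Types (z w : plane R) (a b : R).

(** The real part is the Euclidean square of [z] plus two products of a coordinate of [w - z] with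
    one of [z]; the factor 2 in the hypothesis absorbs both. A quotient in the right half plane has
    an arctangent as continuous argument, which is the source of all local choices. *)
Lemma cquot_re_gt0 z w : `|w - z| * 2 < `|z| -> 0 < (cmul w (cconj z)).1.
Proof.
move=> h; rewrite /cmul /cconj /=.
set u := `|z| in h; set e := `|w - z| in h.
have : (`|z.1| <= u) && (`|z.2| <= u) by rewrite -normp_le.
have : (`|(w - z).1| <= e) && (`|(w - z).2| <= e) by rewrite -normp_le.
rewrite /= => /andP[e1 e2] /andP[u1 u2].
have Hu : u ^+ 2 <= z.1 ^+ 2 + z.2 ^+ 2.
  rewrite -(real_normK (num_real z.1)) -(real_normK (num_real z.2)) /u normpE.
  by rewrite /Num.max; case: ifP => _; rewrite ?lerDl ?lerDr sqr_ge0.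
have P (x y : R) : `|x| <= e -> `|y| <= u -> - (e * u) <= x * y.
  move=> xe yu; have : `|x * y| <= e * u by rewrite normrM ler_pM.
  by rewrite ler_norml => /andP[].
have p1 := P _ _ e1 u1; have p2 := P _ _ e2 u2.
have u0 : 0 < u by apply: (le_lt_trans _ h); rewrite mulr_ge0 // /e normr_ge0.
have : 2 * (e * u) < u ^+ 2 by rewrite expr2 mulrA [2 * e]mulrC ltr_pM2r.

move: p1 p2 Hu; rewrite /= !expr2 => p1 p2 Hu h2. lra.
Qed.

Lemma continuous_cquot_arg (T : topologicalType) (f g : T -> plane R) t :
  {for t, continuous f} -> {for t, continuous g} ->
  0 < (cmul (f t) (cconj (g t))).1 ->
  {for t, continuous (fun t => atan ((cmul (f t) (cconj (g t))).2 /
                             (cmul (f t) (cconj (g t))).1) : R^o)}.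
Proof.
move=> cf cg q0.
have f1 : {for t, continuous (fun t => (f t).1 : R^o)}.
  exact: (@continuous_comp T (plane R) R^o f fst t cf (@cvg_fst _ _ _ _ _)).
have f2 : {for t, continuous (fun t => (f t).2 : R^o)}.
  exact: (@continuous_comp T (plane R) R^o f snd t cf (@cvg_snd _ _ _ _ _)).
have g1 : {for t, continuous (fun t => (g t).1 : R^o)}.
  exact: (@continuous_comp T (plane R) R^o g fst t cg (@cvg_fst _ _ _ _ _)).
have g2 : {for t, continuous (fun t => (g t).2 : R^o)}.
  exact: (@continuous_comp T (plane R) R^o g snd t cg (@cvg_snd _ _ _ _ _)).
have H : {for t, continuous (fun t => (cmul (f t) (cconj (g t))).2 /
    (cmul (f t) (cconj (g t))).1 : R^o)}.
  apply: cvgM.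
    by apply: cvgD; apply: cvgM => //; exact: cvgN.
  apply: cvgV; first by rewrite lt0r_neq0.
  by apply: cvgB; apply: cvgM => //; exact: cvgN.
exact: (@continuous_comp T R^o R^o _ (@atan R) t H (@continuous_atan R _)).
Qed.

(** The square is shrunk to the origin in [N] radial steps. On the constant map any argument serves;
    each step back multiplies the map by a quotient in the right half plane, and an arctangent
    corrects the argument. *)
Theorem arg_lift (G : plane R -> plane R) (M : R) : 0 < M ->
  continuous G -> (forall z, G z != 0) ->
  exists2 th : plane R -> R^o, continuous th &
    forall z, `|z| <= M -> is_arg (G z) (th z).
Proof.
move=> M0 cG G0.
have [||c cM minc] := @compact_EVT_min _ R (fun z => `|G z|) _ _ (@compact_box R M).
- by exists 0 => /=; rewrite normr0 ltW.
- apply: continuous_subspaceT => z.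
  exact: (@continuous_comp _ _ R^o G (fun w => `|w|) z (cG z) (@norm_continuous _ _ _)).
have m0 : 0 < `|G c| by rewrite normr_gt0.
have e0 : 0 < `|G c| / 2 by rewrite divr_gt0.
have [d d0 Hd] := compact_unif (@compact_box R M) cG e0.
(* Large enough that one radial step moves every point of the square by less than [d]. *)
pose N := (Num.bound (M / d)).+1.
have N0 : 0 < N%:R :> R by rewrite ltr0n.
have MN : M / N%:R < d.
  rewrite ltr_pdivrMr // mulrC -ltr_pdivrMr //.
  apply: (lt_trans (archi_boundP _)); first by rewrite divr_ge0 // ltW.
  by rewrite ltr_nat.
pose H (j : nat) z := G ((j%:R / N%:R) *: clamp M z).
have cH j : continuous (H j).
  move=> z; apply: (@continuous_comp _ _ _ (fun z => (j%:R / N%:R) *: clamp M z) G z);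
    last exact: cG.
  exact: (@continuous_comp _ _ _ (clamp M) _ z (@continuous_clamp R M z) (@scaler_continuous _ _ _ _)).
have S j : (j <= N)%N -> exists2 th : plane R -> R^o, continuous th &
    forall z, is_arg (H j z) (th z).
  elim: j => [_|j IH jN].
    have [a ha] := is_arg_exists (G0 0); exists (fun=> a); first exact: cst_continuous.
    by move=> z; rewrite /H mul0r scale0r.
  have [th cth Hth] := IH (ltnW jN).
  have q0 z : 0 < (cmul (H j.+1 z) (cconj (H j z))).1.
    have cz : `|clamp M z| <= M := clamp_le z (ltW M0).
    have j0 : 0 <= j%:R / N%:R :> R by rewrite divr_ge0.
    have j1 : j%:R / N%:R <= 1 :> R by rewrite ler_pdivrMr // mul1r ler_nat ltnW.
    have jcM : `|(j%:R / N%:R) *: clamp M z| <= M.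
      by rewrite normrZ ger0_norm // -[leRHS]mul1r ler_pM.
    apply: cquot_re_gt0; rewrite -ltr_pdivlMr //.
    apply: (@lt_le_trans _ _ (`|G c| / 2)); last first.
      by rewrite ler_pM2r //; apply: minc; rewrite inE.
    rewrite distrC; apply: Hd; first exact: jcM.
    rewrite distrC -scalerBl normrZ -mulrBl -natrB // subSnn mul1r.
    rewrite ger0_norm ?invr_ge0 //; apply: le_lt_trans MN.
    by rewrite mulrC ler_pM2r ?invr_gt0.
  exists (fun z => th z + atan ((cmul (H j.+1 z) (cconj (H j z))).2 /
                               (cmul (H j.+1 z) (cconj (H j z))).1)).
    move=> z; apply: cvgD; first exact: cth.
    exact: (continuous_cquot_arg (cH j.+1 z) (cH j z) (q0 z)).
  move=> z; apply: (is_arg_quot _ _ (Hth z)); first exact: G0.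
  exact: is_arg_atan.
have [th cth Hth] := S N (leqnn _).
exists th => // z zM; have := Hth z; rewrite /H divff ?lt0r_neq0 // scale1r.
by rewrite clamp_id.
Qed.

End Lift.

(** * Connected subsets of the plane *)

Section PlaneConnected.
Variable R : realType.
Implicit Types (p q x y z : plane R) (A K : set (plane R)).

Lemma continuous_affine p q : continuous (fun t : R^o => (1 - t) *: p + t *: q).
Proof.
move=> t; apply: cvgD.
  apply: cvgZ; last exact: cvg_cst.
  by apply: cvgB; [exact: cvg_cst|exact: cvg_id].
by apply: cvgZ; [exact: cvg_id|exact: cvg_cst].
Qed.

Lemma segmentE p q : segment p q = (fun t : R^o => (1 - t) *: p + t *: q) @` `[0, 1].
Proof. by apply/seteqP; split=> z /= [t + <-]; rewrite ?in_itv /= => t01; exists t. Qed.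

Lemma segment_l p q : segment p q p.
Proof. by exists 0; rewrite /= ?in_itv /= ?lexx ?ler01 ?subr0 ?scale1r ?scale0r ?addr0. Qed.

Lemma segment_r p q : segment p q q.
Proof. by exists 1; rewrite /= ?in_itv /= ?lexx ?ler01 ?subrr ?scale0r ?scale1r ?add0r. Qed.

Lemma segment_sym p q : segment p q = segment q p.
Proof.
have H a b : segment a b `<=` segment b a.
  move=> z [t /= t01 <-]; exists (1 - t).
    by move: t01; rewrite /= !in_itv /=; lra.
  by rewrite opprB addrC subrKC addrC.
by apply/seteqP; split; exact: H.
Qed.

Lemma plane_segment_connected p q : connected (segment p q).
Proof.
rewrite segmentE; apply: connected_continuous_connected; first exact: segment_connected.
by apply: continuous_subspaceT; exact: continuous_affine.
Qed.

Definition cvx A := forall p q, A p -> A q -> segment p q `<=` A.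

Lemma cvx_connected A : cvx A -> connected A.
Proof.
move=> cA; have [->|/set0P[x Ax]] := eqVneq A set0; first exact: connected0.
rewrite (_ : A = \bigcup_(y in A) segment x y).
  apply: bigcup_connected; last by move=> y _; exact: plane_segment_connected.
  by exists x => y _; exact: segment_l.
apply/seteqP; split=> z; first by move=> Az; exists z => //; exact: segment_r.
by move=> [y Ay]; exact: cA.
Qed.

Lemma cvx_ball x e : cvx [set y | `|x - y| < e].
Proof.
move=> p q /= px qx z [t t01 <-]; move: t01; rewrite /= in_itv /= => /andP[t0 t1].
have -> : x - ((1 - t) *: p + t *: q) = (1 - t) *: (x - p) + t *: (x - q).
  rewrite !scalerBr addrACA -opprD; congr (_ - _).
  by rewrite -scalerDl subrK scale1r.
apply: (le_lt_trans (ler_normD _ _)); rewrite !normrZ !ger0_norm ?subr_ge0 //.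
have [->|tn0] := eqVneq t 0; first by rewrite subr0 mul1r mul0r addr0.
have : t * `|x - q| < t * e by rewrite ltr_pM2l // lt_neqAle eq_sym tn0.
have : (1 - t) * `|x - p| <= (1 - t) * e by rewrite ler_wpM2l ?subr_ge0 // ltW.
by rewrite mulrBl mul1r; lra.
Qed.

(** For the maximum norm the exterior of a ball is a union of four half planes, chained by common
    points. *)
Lemma far_connected M : 0 <= M -> connected [set z : plane R | M < `|z|].
Proof.
move=> M0.
pose H1 := [set z : plane R | M < z.1]; pose H2 := [set z : plane R | M < z.2].
pose H3 := [set z : plane R | z.1 < - M]; pose H4 := [set z : plane R | z.2 < - M].
have cH (f : plane R -> R) c : (forall p q a b, f (a *: p + b *: q) = a * f p + b * f q) ->
    cvx [set z | c < f z].
  move=> fE p q /= cp cq z [t t01 <-] /=; rewrite fE.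
  move: t01; rewrite /= in_itv /= => /andP[t0 t1].
  have [->|tn0] := eqVneq t 0; first by rewrite subr0 mul1r mul0r addr0.
  have : t * c < t * f q by rewrite ltr_pM2l // lt_neqAle eq_sym tn0.
  have : (1 - t) * c <= (1 - t) * f p by rewrite ler_wpM2l ?subr_ge0 // ltW.
  by rewrite mulrBl mul1r; lra.
have c1 : connected H1 by apply/cvx_connected/cH.
have c2 : connected H2 by apply/cvx_connected/cH.
have c3 : connected H3.
  rewrite (_ : H3 = [set z | M < - z.1]); last by apply/seteqP; split=> z; rewrite /H3 /=; lra.
  by apply/cvx_connected/(cH (fun z => - z.1)) => p q a b; rewrite !mulrN -opprD.
have c4 : connected H4.
  rewrite (_ : H4 = [set z | M < - z.2]); last by apply/seteqP; split=> z; rewrite /H4 /=; lra.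
  by apply/cvx_connected/(cH (fun z => - z.2)) => p q a b; rewrite !mulrN -opprD.
rewrite (_ : [set z | _] = ((H1 `|` H2) `|` H3) `|` H4).
  apply: connectedU => //; last (apply: connectedU => //; last apply: connectedU => //).
  - by exists (- M - 1, - M - 1); split; [right|]; rewrite /H3 /H4 /=; lra.
  - by exists (- M - 1, M + 1); split; [right|]; rewrite /H3 /H2 /=; lra.
  - by exists (M + 1, M + 1); split; rewrite /H1 /H2 /=; lra.
apply/seteqP; split=> z; rewrite /H1 /H2 /H3 /H4 /= normpE lt_max !lter_normr.
  move=> /orP[/orP[h|h]|/orP[h|h]].
  - by left; left; left.
  - by left; right; lra.
  - by left; left; right.
  - by right; lra.
by move=> [[[->|->]|h]|h]; rewrite ?orbT //; apply/orP; [left|right]; apply/orP; right; lra.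
Qed.

Lemma component_open A x : open A -> open (connected_component A x).
Proof.
move=> /open_dist oA; apply/open_dist => y xy.
have [e e0 he] := oA y (connected_component_sub xy).
exists e => // z yz; apply: (connected_component_trans xy).
exists [set t | `|y - t| < e] => //; split; first by rewrite /= subrr normr0.
  exact: he.
by apply: cvx_connected; exact: cvx_ball.
Qed.

Lemma component_closure K x z : closed K -> closure (connected_component (~` K) x) z ->
  ~ K z -> connected_component (~` K) x z.
Proof.
move=> cK /closure_dist cz Kz; have [e e0 he] := closed_dist cK Kz.
have [y xy zy] := cz e e0; apply: (connected_component_trans xy).
exists [set t | `|z - t| < e] => //=; last by rewrite subrr normr0.
by split=> //; apply: cvx_connected; exact: cvx_ball.
Qed.

End PlaneConnected.

(** * Separation by compact sets and by arcs *)

Section Eilenberg.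
Variable R : realType.
Implicit Types (p q x y z : plane R) (A K : set (plane R)).

(** Up to a positive factor the product with the conjugate is the quotient of [z - y] by [z - x]; it
    has the same arguments and needs no division. *)
Definition argsim K x y := exists2 th : plane R -> R^o, {within K, continuous th} &
  forall z, K z -> is_arg (cmul (z - y) (cconj (z - x))) (th z).

Lemma argsim_sym K x y : argsim K x y -> argsim K y x.
Proof.
move=> [th cth hth]; exists (fun z => - th z).
  by move=> z; apply: cvgN; exact: cth.
move=> z Kz; apply: (is_argZ (c := 1) _ _ (is_arg_conj (hth z Kz))) => //.
by rewrite /cmul /cconj /=; congr pair; ring.
Qed.

(** The two quotients multiply to the third one up to the Euclidean square of [z - y], which is
    positive for [z] in [K] because [y] is off [K]. *)
Lemma argsim_trans K x y w : ~ K y -> argsim K x y -> argsim K y w -> argsim K x w.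
Proof.
move=> Ky [t1 c1 h1] [t2 c2 h2]; exists (fun z => t1 z + t2 z).
  by move=> z; apply: cvgD; [exact: c1|exact: c2].
move=> z Kz; have n0 : 0 < (z - y).1 ^+ 2 + (z - y).2 ^+ 2.
  by apply: normsq_gt0; rewrite subr_eq0; apply/eqP => E; apply: Ky; rewrite -E.
apply: (is_argZ (c := ((z - y).1 ^+ 2 + (z - y).2 ^+ 2)^-1) _ _
  (is_argM (h1 z Kz) (h2 z Kz))); first by rewrite invr_gt0.
have E w' : (z - w').1 = z.1 - w'.1 by [].
have E' w' : (z - w').2 = z.2 - w'.2 by [].
move: (lt0r_neq0 n0); rewrite /cmul /cconj !E !E' /=.
by move=> n1; congr pair; field.
Qed.

Lemma continuous_translate y : continuous (fun z => z - y).
Proof. by move=> z; apply: cvgB; [exact: cvg_id|exact: cvg_cst]. Qed.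

Lemma argsim_near K x : closed K -> ~ K x ->
  exists2 e, 0 < e & forall y, `|x - y| < e -> argsim K x y.
Proof.
move=> cK Kx; have [e e0 he] := closed_dist cK Kx.
exists (e / 2); first by rewrite divr_gt0.
move=> y xy.
have pos z : K z -> 0 < (cmul (z - y) (cconj (z - x))).1.
  move=> Kz; apply: cquot_re_gt0; rewrite opprB addrC addrA subrK.
  apply: (@lt_le_trans _ _ e); first by rewrite -ltr_pdivlMr.
  by rewrite leNgt distrC; apply/negP => /he.
exists (fun z => atan ((cmul (z - y) (cconj (z - x))).2 /
                       (cmul (z - y) (cconj (z - x))).1)); last first.
  by move=> z /pos; exact: is_arg_atan.
apply: continuous_in_subspaceT => z /set_mem Kz.
apply: (continuous_cquot_arg (f := fun z => z - y) (g := fun z => z - x));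
  [exact: continuous_translate|exact: continuous_translate|exact: pos].
Qed.

Lemma argsim_refl K x : closed K -> ~ K x -> argsim K x x.
Proof. by move=> cK Kx; have [e e0] := argsim_near cK Kx; apply; rewrite subrr normr0. Qed.

(** By [argsim_near] the classes of the relation are open, so a connected set off [K] stays in one
    of them. This is the easy half of Eilenberg's criterion. *)
Lemma connected_argsim K A x y : closed K -> connected A -> A `<=` ~` K ->
  A x -> A y -> argsim K x y.
Proof.
move=> cK cA AK Ax Ay.
pose S := [set z | ~ K z /\ argsim K x z]; pose N := [set z | ~ K z /\ ~ argsim K x z].
have oS : open S.
  apply/open_dist => z [Kz xz]; have [e e0 he] := argsim_near cK Kz.
  have [d d0 hd] := closed_dist cK Kz.
  exists (Num.min e d); first by rewrite lt_min e0.
  move=> w; rewrite lt_min => /andP[/he zw /hd Kw].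
  by split=> //; exact: argsim_trans zw.
have oN : open N.
  apply/open_dist => z [Kz xz]; have [e e0 he] := argsim_near cK Kz.
  have [d d0 hd] := closed_dist cK Kz.
  exists (Num.min e d); first by rewrite lt_min e0.
  move=> w; rewrite lt_min => /andP[/he zw /hd Kw].
  split=> // xw; apply: xz; exact: (argsim_trans Kw xw (argsim_sym zw)).
have : A `&` S = A.
  apply: cA.
  - by exists x; split=> //; split; [exact: AK|apply: argsim_refl => //; exact: AK].
  - by exists S.
  - exists (~` N); first exact: open_closedC.
    apply/seteqP; split=> z [Az h]; split=> //; first by case: h => _ h [].
    have Kz := AK _ Az; split=> //; apply: contrapT => h'; exact: h.
by move=> E; have [_ []] : (A `&` S) y by rewrite E.
Qed.

(** Serves with [c] equal to two pi, for the difference of two continuous arguments of one map. Two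
    different values would force the value [h s + c / 2] in between. *)
Lemma int_valued_const (T : topologicalType) (A : set T) (h : T -> R^o) (c : R) s t :
  0 < c -> connected A -> {within A, continuous h} ->
  (forall a, A a -> exists n : int, h a = n%:~R * c) -> A s -> A t -> h s = h t.
Proof.
move=> c0 cA ch hc.
wlog hst : s t / h s <= h t.
  by move=> W As At; have [|/ltW] := leP (h s) (h t) => /W H; [|symmetry]; apply: H.
move=> As At; apply/eqP; rewrite eq_le hst /= leNgt; apply/negP => lt.
have cI := connected_continuous_connected cA ch.
have [n hn] := hc _ As; have [m hm] := hc _ At.
have nm : (n + 1 <= m) by move: lt; rewrite hn hm ltr_pM2r // ltr_int lezD1.
have : (h @` A) (h s + c / 2).
  have /connected_intervalP := cI; apply; [by exists s|by exists t|].
  rewrite lerDl divr_ge0 ?(ltW c0) //= hn hm.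
  have : (n + 1)%:~R * c <= m%:~R * c by rewrite ler_pM2r // ler_int.
  by rewrite intrD mulrDl mul1r; lra.
move=> [a Aa ha]; have [k hk] := hc _ Aa.
move: ha; rewrite hk hn => E.
have : (k%:~R - n%:~R) * c = 2^-1 * c by rewrite mulrBl; lra.
move=> /(mulIf (lt0r_neq0 c0)); rewrite -intrB => E2.
have : ((k - n) * 2)%:~R = 1%:~R :> R by rewrite intrM E2 mulVf.
by move/(@intr_inj R); lia.
Qed.

End Eilenberg.

(** * Arguments along a circle *)

Section Borsuk.
Variable R : realType.
Implicit Types (p q x y z : plane R) (A K : set (plane R)).

(** Normalisation makes two maps with a common argument equal, so that they can be glued along
    [K]. *)
Definition unitp z : plane R :=
  (z.1 / Num.sqrt (z.1 ^+ 2 + z.2 ^+ 2), z.2 / Num.sqrt (z.1 ^+ 2 + z.2 ^+ 2)).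

Lemma is_arg_cos a : is_arg ((cos a, sin a) : plane R) a.
Proof. by exists 1; rewrite // !mul1r. Qed.

Lemma unitp_arg z a : is_arg z a -> unitp z = (cos a, sin a).
Proof.
move=> [r r0 ->]; rewrite /unitp /= !exprMn -mulrDr cos2Dsin2 mulr1 sqrtr_sqr.
by rewrite gtr0_norm // !(mulrC r) !mulfK ?lt0r_neq0.
Qed.

Lemma unitp_neq0 z : z != 0 -> unitp z != 0.
Proof.
by move=> /is_arg_exists[a /unitp_arg ->]; exact: (is_arg_neq0 (is_arg_cos a)).
Qed.

Lemma continuous_unitp z : z != 0 -> {for z, continuous unitp}.
Proof.
move=> z0; have n0 := normsq_gt0 z0.
have f1 : {for z, continuous (fun z : plane R => z.1 : R^o)} by exact: cvg_fst.
have f2 : {for z, continuous (fun z : plane R => z.2 : R^o)} by exact: cvg_snd.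
have S : {for z, continuous (fun z : plane R => z.1 ^+ 2 + z.2 ^+ 2 : R^o)}.
  by apply: cvgD; [exact: (cvgM f1 f1)|exact: (cvgM f2 f2)].
have Q : {for z, continuous (fun z : plane R => (Num.sqrt (z.1 ^+ 2 + z.2 ^+ 2))^-1 : R^o)}.
  apply: cvgV; first by rewrite lt0r_neq0 // sqrtr_gt0.
  exact: (@continuous_comp (plane R) R^o R^o _ (@Num.sqrt R) z S (@sqrt_continuous R _)).
by apply: continuous_pair; apply: cvgM.
Qed.

Lemma continuous_rot (th : plane R -> R^o) (f : plane R -> plane R) z :
  {for z, continuous th} -> {for z, continuous f} ->
  {for z, continuous (fun z => cmul (cos (th z), sin (th z)) (f z))}.
Proof.
move=> ct cf.
have c1 : {for z, continuous (fun t => cos (th t) : R^o)}.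
  exact: (@continuous_comp (plane R) R^o R^o th (@cos R) z ct (@continuous_cos R _)).
have c2 : {for z, continuous (fun t => sin (th t) : R^o)}.
  exact: (@continuous_comp (plane R) R^o R^o th (@sin R) z ct (@continuous_sin R _)).
have f1 : {for z, continuous (fun t => (f t).1 : R^o)}.
  exact: (@continuous_comp (plane R) (plane R) R^o f fst z cf (@cvg_fst _ _ _ _ _)).
have f2 : {for z, continuous (fun t => (f t).2 : R^o)}.
  exact: (@continuous_comp (plane R) (plane R) R^o f snd z cf (@cvg_snd _ _ _ _ _)).
apply: continuous_pair; first by apply: cvgB; apply: cvgM.
by apply: cvgD; apply: cvgM.
Qed.

(** The argument minus the angle would be a constant multiple of two pi, but it drops by two pi in
    one turn. *)
Lemma no_arg_on_circle x (rho : R) (th : plane R -> R^o) : 0 < rho -> continuous th ->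
  (forall t, let c : plane R := (x.1 + rho * cos t, x.2 + rho * sin t) in
     is_arg (c - x) (th c)) -> False.
Proof.
move=> r0 cth H; have p0 : 0 < pi *+ 2 :> R by rewrite mulrn_wgt0 ?pi_gt0.
pose c (t : R^o) : plane R := (x.1 + rho * cos t, x.2 + rho * sin t).
have cc : continuous c.
  move=> t.
  have c1 : {for t, continuous (fun t : R^o => x.1 + rho * cos t : R^o)}.
    by apply: cvgD; [exact: cvg_cst|apply: cvgM; [exact: cvg_cst|exact: continuous_cos]].
  have c2 : {for t, continuous (fun t : R^o => x.2 + rho * sin t : R^o)}.
    by apply: cvgD; [exact: cvg_cst|apply: cvgM; [exact: cvg_cst|exact: continuous_sin]].
  exact: (continuous_pair c1 c2).
pose h (t : R^o) : R^o := th (c t) - t.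
have ch : continuous h.
  move=> t; apply: cvgB; last exact: cvg_id.
  exact: (@continuous_comp R^o (plane R) R^o c th t (cc t) (cth _)).
have hint t : exists n : int, h t = n%:~R * (pi *+ 2).
  have ct : is_arg (c t - x) t.
    exists rho; first exact: r0.
    have E1 (u v : R) : u + v - u = v by rewrite addrAC subrr add0r.
    by rewrite [LHS]surjective_pairing; congr pair; exact: E1.
  have [n e] := is_arg_uniq ct (H t); exists n.
  by rewrite /h e addrAC subrr add0r.
have : h 0 = h (pi *+ 2).
  apply: (int_valued_const p0 (@segment_connected R 0 (pi *+ 2))).
  - exact: continuous_subspaceT.
  - by move=> t _; exact: hint.
  - by rewrite /= in_itv /= lexx ltW.
  - by rewrite /= in_itv /= lexx ltW.
have -> : h (pi *+ 2) = h 0 - pi *+ 2.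
  have -> : h (pi *+ 2) = th (c (pi *+ 2)) - pi *+ 2 by [].
  have -> : h 0 = th (c 0) by rewrite /h subr0.
  have C : cos (pi *+ 2) = cos 0 :> R by rewrite -[pi *+ 2]add0r cosD2pi.
  have S : sin (pi *+ 2) = sin 0 :> R by rewrite -[pi *+ 2]add0r sinD2pi.
  by rewrite /c C S.
by move=> E; move: p0; lra.
Qed.

End Borsuk.

(** * Eilenberg's criterion, the converse half *)

Section Janiszewski.
Variable R : realType.
Implicit Types (p q x y z : plane R) (A K : set (plane R)).

Lemma rot_arg a z b : is_arg z b -> is_arg (cmul (cos a, sin a) z) (a + b).
Proof. by move=> zb; apply: is_argM => //; exact: is_arg_cos. Qed.

(** If [y] were outside the bounded component [U] of [x], a nowhere zero map of the plane could be
    glued from [z - x] outside [U] and from [z - y], turned back by the argument of the quotient, on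
    [U] and [K]. On a large circle around [x] it points in the direction of [z - x], yet it has a
    continuous argument on a square containing this circle. *)
Lemma borsuk_bounded K x y M : compact K -> ~ K x -> ~ K y -> argsim K x y ->
  0 < M -> (forall z, K z -> `|z| <= M) ->
  (forall z, connected_component (~` K) x z -> `|z| <= M) ->
  connected_component (~` K) x y.
Proof.
move=> cK Kx Ky [th cth hth] M0 KM UM; apply: contrapT => nxy.
set U := connected_component (~` K) x in UM nxy.
have clK := compact_closed (@plane_hausdorff R) cK.
have oU : open U by apply: component_open; rewrite openC.
have Ux : U x by exact: connected_component_refl.
have UK z : U z -> ~ K z by move=> h; exact: (connected_component_sub h).
have clUK : closed (U `|` K).
  rewrite -openC; apply/open_dist => z nz.
  have Kz : ~ K z by move=> h; apply: nz; right.
  have : ~ closure U z by move=> /(component_closure clK)/(_ Kz) h; apply: nz; left.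
  move=> /(closed_dist (@closed_closure _ _))[e e0 he].
  have [d d0 hd] := closed_dist clK Kz.
  exists (Num.min e d); first by rewrite lt_min e0.
  move=> w; rewrite lt_min => /andP[/he Uw /hd Kw] [/subset_closure|]//.
have [B [B0 thB]] : exists B, 0 < B /\ forall z, K z -> `|th z| <= B.
  have cI := continuous_compact cth cK.
  have [B [_ HB]] := compact_bounded cI.
  exists (Num.max 1 (B + 1)); split; first by rewrite lt_max ltr01.
  move=> z Kz; apply: (HB); last by exists z.
  by rewrite lt_max ltrDl ltr01 orbT.
(* Tietze extension of the argument to the plane; it asks for a bounded function, and [th] is
   bounded on the compact set [K]. *)
have [T [Teq cT _]] := continuous_bounded_extension (@pseudometric_normal R (plane R))
  clK B0 cth thB.
pose Gin z := unitp (cmul (cos (- T z), sin (- T z)) (z - y)).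
pose Gout z := unitp (z - x).
pose G z := if `[< U z >] then Gin z else Gout z.
have rot0 z : z != y -> cmul (cos (- T z), sin (- T z)) (z - y) != 0.
  rewrite -subr_eq0 => /is_arg_exists[b hb]; exact: (is_arg_neq0 (rot_arg _ hb)).
have Gio z : K z -> Gin z = Gout z.
  move=> Kz; have zx : z - x != 0 by rewrite subr_eq0; apply/eqP => E; apply: Kx; rewrite -E.
  have [a ha] := is_arg_exists zx; rewrite /Gin /Gout (unitp_arg ha).
  apply: unitp_arg; have -> : a = - T z + (a + th z).
    by rewrite -Teq ?inE // addrCA addNr addr0.
  by apply: rot_arg; exact: (is_arg_quot zx (hth z Kz) ha).
have G0 z : G z != 0.
  rewrite /G; case: asboolP => Uz; apply: unitp_neq0.
    by apply: rot0; apply: contra_notN nxy => /eqP <-.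
  by rewrite subr_eq0; apply: contra_notN Uz => /eqP ->.
have cG : continuous G.
  apply/continuous_subspace_setT; rewrite (_ : setT = (U `|` K) `|` ~` U); last first.
    by apply/seteqP; split=> z //= _; have [h|h] := pselect (U z); [left; left|right].
  apply: withinU_continuous => //; first exact: open_closedC.
    apply: (@subspace_eq_continuous _ _ _ (Gin : subspace (U `|` K) -> plane R)).
      move=> z /set_mem UKz; rewrite /from_subspace /G.
      have [h|nUz] := pselect (U z); first by rewrite asboolT.
      by rewrite asboolF //; case: UKz => // /Gio.
    apply: continuous_in_subspaceT => z /set_mem UKz.
    have zy : z != y by apply/eqP => E; rewrite E in UKz; case: UKz.
    have ct : {for z, continuous (fun z => - T z)} by apply: cvgN; exact: cT.
    have c1 := continuous_rot ct (@continuous_translate R y z).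
    exact: (@continuous_comp (plane R) (plane R) (plane R) _ (@unitp R) z c1
      (continuous_unitp (rot0 _ zy))).
  apply: (@subspace_eq_continuous _ _ _ (Gout : subspace (~` U) -> plane R)).
    by move=> z /set_mem nUz; rewrite /from_subspace /G asboolF.
  apply: continuous_in_subspaceT => z /set_mem nUz.
  have zx : z - x != 0 by rewrite subr_eq0; apply/eqP => E; apply: nUz; rewrite E.
  exact: (@continuous_comp (plane R) (plane R) (plane R) _ (@unitp R) z
    (@continuous_translate R x z) (continuous_unitp zx)).
(* The circle is Euclidean while the norm is the maximum norm, so its points are only known to be at
   distance [rho / 2] from [x]; the factor 4 still puts them outside the ball of radius [M] around
   [U]. *)
pose rho := 4 * (M + `|x| + 1).
have x0 := normr_ge0 x.
have r0 : 0 < rho by rewrite /rho; lra.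
have [phi cphi hphi] := @arg_lift R G (`|x| + rho) ltac:(lra) cG G0.
apply: (@no_arg_on_circle R x rho phi r0 cphi) => t c.
have E1 (u v : R) : u + v - u = v by rewrite addrAC subrr add0r.
have cx : c - x = (rho * cos t, rho * sin t).
  by rewrite [LHS]surjective_pairing; congr pair; exact: E1.
have ct : is_arg (c - x) t by exists rho.
have cM : M < `|c|.
  have : rho / 2 <= `|c - x|.
    rewrite cx normpE /= le_max !(normrM rho) (gtr0_norm r0) !ler_pM2l //.
    have := cos2Dsin2 t; rewrite -(real_normK (num_real (cos t))) -(real_normK (num_real (sin t))).
    move: (normr_ge0 (cos t)) (normr_ge0 (sin t)).
    set u := `|cos t|; set v := `|sin t| => u0 v0 uv.
    apply/orP; have [h|h] := leP 2^-1 u; first by left.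
    by right; rewrite leNgt; apply/negP => h'; move: uv; nra.
  have := ler_normB c x; rewrite /rho; lra.
have cB : `|c| <= `|x| + rho.
  have : `|c - x| <= rho.
    have c1 : `|cos t| <= 1 by rewrite ler_norml cos_geN1 cos_le1.
    have s1 : `|sin t| <= 1 by rewrite ler_norml sin_geN1 sin_le1.
    by rewrite cx normp_le /= !(normrM rho) (gtr0_norm r0) !ler_piMr // ltW.
  have := ler_normD x (c - x); rewrite addrC subrK; lra.
have nUc : ~ U c by move=> /UM; rewrite leNgt cM.
have := hphi c cB; rewrite /G asboolF // /Gout (unitp_arg ct) => -[s s0 E].
by exists (rho * s); [exact: mulr_gt0|rewrite cx -!mulrA; case: E => <- <-].
Qed.

(** If neither component stays inside a ball containing [K], both reach its exterior, which is
    connected. *)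
Theorem borsuk K x y : compact K -> ~ K x -> ~ K y -> argsim K x y ->
  connected_component (~` K) x y.
Proof.
move=> cK Kx Ky xy.
have [_ [M KM]] := (compact_closedP K).1 cK.
pose M' := Num.max 1 M; have M0 : 0 < M' by rewrite lt_max ltr01.
have KM' z : K z -> `|z| <= M' by move=> /KM h; rewrite le_max h orbT.
have [H|/existsNP[a /not_implyP[xa /negP]]] :=
  pselect (forall z, connected_component (~` K) x z -> `|z| <= M').
  exact: (borsuk_bounded cK Kx Ky xy M0 KM' H).
have [H|/existsNP[b /not_implyP[yb /negP]]] :=
  pselect (forall z, connected_component (~` K) y z -> `|z| <= M').
  move=> _; apply: connected_component_sym.
  exact: (borsuk_bounded cK Ky Kx (argsim_sym xy) M0 KM' H).
rewrite -!ltNge => bM aM; apply: (connected_component_trans xa).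
apply: (@connected_component_trans _ _ b); last exact: connected_component_sym.
exists [set z | M' < `|z|] => //; split=> //; last by apply: far_connected; exact: ltW.
by move=> z /= zM /KM'; rewrite leNgt zM.
Qed.

End Janiszewski.

(** * Arcs do not separate *)

Section ArcNoSep.
Variable R : realType.
Implicit Types (p q x y z : plane R) (A K : set (plane R)) (g : R^o -> plane R).

Lemma path_compact g (u v : R) : continuous g -> compact (g @` `[u, v]).
Proof.
move=> cg; apply: continuous_compact; last exact: segment_compact.
exact: continuous_subspaceT.
Qed.

Lemma path_connected g (u v : R) : continuous g -> connected (g @` `[u, v]).
Proof.
move=> cg; apply: connected_continuous_connected; first exact: segment_connected.
exact: continuous_subspaceT.
Qed.

(** A continuous map on a compact interval carries closed sets to closed sets. *)
Lemma inj_path_inverse g (u v : R) : continuous g -> {in `[u, v] &, injective g} ->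
  exists2 h : plane R -> R^o, {within g @` `[u, v], continuous h} &
    forall s, s \in `[u, v] -> h (g s) = s.
Proof.
move=> cg ig.
pose h z : R^o := xget (0 : R) [set s : R | s \in `[u, v] /\ g s = z].
have hg s : s \in `[u, v] -> h (g s) = s.
  move=> sI; rewrite /h; case: xgetP => [t _ [tI gts]|/(_ s)[]//].
  exact: ig.
exists h => //; apply/continuous_closedP => C cC; apply/closed_subspaceP.
exists (g @` (`[u, v] `&` C)).
  apply: compact_closed; first exact: plane_hausdorff.
  apply: continuous_compact; first exact: continuous_subspaceT.
  by apply: compact_closedI => //; exact: segment_compact.
apply/seteqP; split=> z [].
  move=> [s [sI Cs] <-] zA; split=> //; have : C (h (g s)) by rewrite hg.
  by [].
move=> Chz [s sI gs]; split; last by exists s.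
exists s => //; split=> //; have : C (h z) by [].
by rewrite -gs hg.
Qed.

(** Along the path the quotient has an argument [psi], lifted through the parameter. As the path can
    meet [K] only at its first point, adding one multiple of two pi to [psi] makes it agree with
    [th] there, and the two glue. *)
Lemma argsim_arc K g (u v : R) x y : compact K -> continuous g ->
  {in `[u, v] &, injective g} -> u <= v ->
  (forall s, s \in `[u, v] -> K (g s) -> s = u) ->
  ~ (g @` `[u, v]) x -> ~ (g @` `[u, v]) y ->
  argsim K x y -> argsim (K `|` g @` `[u, v]) x y.
Proof.
move=> cK cg ig uv Ku gx gy [th cth hth].
have uI : u \in `[u, v] by rewrite in_itv /= lexx.
pose q z := cmul (z - y) (cconj (z - x)).
have cq : continuous q.
  move=> z; have c1 : {for z, continuous (fun z : plane R => z.1 : R^o)} by exact: cvg_fst.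
  have c2 : {for z, continuous (fun z : plane R => z.2 : R^o)} by exact: cvg_snd.
  have b1 c : {for z, continuous (fun z : plane R => (z - c).1 : R^o)}.
    exact: (@continuous_comp _ (plane R) R^o (fun z => z - c) fst z (@continuous_translate R c z) (@cvg_fst _ _ _ _ _)).
  have b2 c : {for z, continuous (fun z : plane R => (z - c).2 : R^o)}.
    exact: (@continuous_comp _ (plane R) R^o (fun z => z - c) snd z (@continuous_translate R c z) (@cvg_snd _ _ _ _ _)).
  have e1 : {for z, continuous (fun z => (q z).1 : R^o)}.
    apply: cvgB; first exact: (cvgM (b1 y) (b1 x)).
    by apply: cvgM; [exact: b2|apply: cvgN; exact: b2].
  have e2 : {for z, continuous (fun z => (q z).2 : R^o)}.
    apply: cvgD; last exact: (cvgM (b2 y) (b1 x)).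
    by apply: cvgM; [exact: b1|apply: cvgN; exact: b2].
  exact: (continuous_pair e1 e2).
pose M := Num.max 1 (Num.max `|u| `|v|).
have M0 : 0 < M by rewrite lt_max ltr01.
pose cl (t : R^o) : R^o := Num.max u (Num.min v t).
have ccl : continuous cl.
  move=> t; apply: (@continuous_max R R^o (fun=> u) ((fun=> v) \min (fun t : R^o => t))).
    exact: cst_continuous.
  by apply: continuous_min; [exact: cst_continuous|exact: cvg_id].
have clI t : cl t \in `[u, v].
  by rewrite in_itv /= /cl le_max lexx /= ge_max uv ge_min lexx.
have cl_id t : t \in `[u, v] -> cl t = t.
  by rewrite in_itv /= => /andP[ut tv]; rewrite /cl (min_idPr tv) (max_idPr ut).
(* [arg_lift] concerns maps of the plane, so the path is read as a map of the first coordinate, with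
   the parameter clamped to the interval. *)
pose H (z : plane R) := q (g (cl z.1)).
have cH : continuous H.
  move=> z; have c1 : {for z, continuous (fun z : plane R => z.1 : R^o)} by exact: cvg_fst.
  have k1 := @continuous_comp (plane R) R^o R^o fst cl z c1 (ccl _).
  have k2 := @continuous_comp (plane R) R^o (plane R) _ g z k1 (cg _).
  exact: (@continuous_comp (plane R) (plane R) (plane R) _ q z k2 (cq _)).
have q0 z : z <> x -> z <> y -> q z != 0.
  move=> /eqP zx /eqP zy; rewrite -subr_eq0 in zx; rewrite -subr_eq0 in zy.
  have [a ha] := is_arg_exists zx; have [b hb] := is_arg_exists zy.
  exact: (is_arg_neq0 (is_argM hb (is_arg_conj ha))).
have H0 z : H z != 0.
  apply: q0 => E; [apply: gx|apply: gy]; rewrite -E; exists (cl z.1) => //; exact: clI.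
have [phi cphi hphi] := arg_lift M0 cH H0.
pose psi (t : R^o) : R^o := phi (t, 0).
have cpsi : continuous psi.
  move=> t; have c1 : {for t, continuous (fun t : R^o => (t, 0) : plane R)}.
    by apply: (@continuous_pair R R^o (fun t => t) (fun=> 0)); [exact: cvg_id|exact: cst_continuous].
  exact: (@continuous_comp R^o (plane R) R^o _ phi t c1 (cphi _)).
have hpsi t : t \in `[u, v] -> is_arg (q (g t)) (psi t).
  move=> tI; have := hphi (t, 0); rewrite /H /= cl_id //; apply.
  rewrite normp_le /= normr0 (ltW M0) andbT /M.
  move: tI; rewrite in_itv /= => /andP[ut tv].
  rewrite !le_max; have := ler_norm v; have := ler_norm (- u); rewrite normrN => a b.
  by apply/orP; right; apply/orP; case: (ger0P t) => h; [right|left]; lra.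
have [h ch hg] := inj_path_inverse cg ig.
have [c hc] : exists c, (K (g u) -> th (g u) = psi u + c) /\
    (forall t, t \in `[u, v] -> is_arg (q (g t)) (psi t + c)).
  have [Kgu|nK] := pselect (K (g u)); last by exists 0; split=> // t tI; rewrite addr0; exact: hpsi.
  have [n e] := is_arg_uniq (hpsi u uI) (hth _ Kgu).
  exists (n%:~R * (pi *+ 2)); split=> // t tI.
  have [r r0 ->] := hpsi t tI; exists r => //.
  case: n {e} => m; rewrite ?NegzE ?mulrNz ?mulNr -?[m%:~R]/(m%:R) -?[m.+1%:~R]/(m.+1%:R) !mulr_natl.
    by rewrite cosD2pin (periodicn (@sinD2pi R)).
  rewrite -[in LHS](subrK ((pi *+ 2) *+ m.+1) (psi t)).
  by rewrite cosD2pin (periodicn (@sinD2pi R)).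
pose T z := if `[< K z >] then th z else psi (h z) + c.
have clK := compact_closed (@plane_hausdorff R) cK.
have TA s : s \in `[u, v] -> T (g s) = psi s + c.
  move=> sI; rewrite /T; have [Ks|nK] := pselect (K (g s)); last by rewrite asboolF // hg.
  by rewrite asboolT // (Ku s sI Ks); apply: hc.1; rewrite -(Ku s sI Ks).
exists T.
  apply: withinU_continuous => //.
  - by apply: compact_closed; [exact: plane_hausdorff|exact: path_compact].
  - apply: (@subspace_eq_continuous _ _ _ (th : subspace K -> R^o)) => //.
    by move=> z /set_mem Kz; rewrite /from_subspace /T asboolT.
  - apply: (@subspace_eq_continuous _ _ _ ((fun z => psi (h z) + c) : subspace (g @` `[u, v]) -> R^o)).
      by move=> z /set_mem [s sI <-]; rewrite /from_subspace TA // hg.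
    move=> z; apply: cvgD; last exact: cvg_cst.
    exact: (@continuous_comp (subspace (g @` `[u, v])) R^o R^o h psi z (ch z) (cpsi _)).
move=> z [Kz|[s sI <-]]; first by rewrite /T asboolT //; exact: hth.
by rewrite TA //; exact: hc.2.
Qed.

Theorem arc_nosep K g (u v : R) x y : compact K -> continuous g ->
  {in `[u, v] &, injective g} -> u <= v ->
  (forall s, s \in `[u, v] -> K (g s) -> s = u) ->
  ~ (g @` `[u, v]) x -> ~ (g @` `[u, v]) y ->
  connected_component (~` K) x y ->
  connected_component (~` (K `|` g @` `[u, v])) x y.
Proof.
move=> cK cg ig uv Ku gx gy xy.
have Kx : ~ K x by apply: (connected_component_sub (connected_component_sym xy)).
have Ky : ~ K y by apply: (connected_component_sub xy).
have clK := compact_closed (@plane_hausdorff R) cK.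
apply: borsuk.
- by apply: compactU => //; exact: path_compact.
- by case.
- by case.
apply: argsim_arc => //.
apply: (connected_argsim (A := connected_component (~` K) x)) => //.
- exact: component_connected.
- exact: connected_component_sub.
- exact: connected_component_refl.
Qed.

End ArcNoSep.

(** * Arcs and accessible points *)

Section Arcs.
Variable R : realType.
Implicit Types (p q r x y z : plane R) (A B C S : set (plane R)) (g h : R^o -> plane R).

(** Holding the path constant outside the unit interval makes it continuous on the whole line, which
    disposes of subspace continuity. *)
Lemma arc_path p q A : arc p q A -> exists2 g : R^o -> plane R, continuous g &
  [/\ {in `[(0:R), 1] &, injective g}, g 0 = p, g 1 = q & A = g @` `[0, 1]].
Proof.
move=> [g [cg ig g0 g1 AE]].
pose cl (t : R^o) : R^o := Num.max 0 (Num.min 1 t).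
have ccl : continuous cl.
  move=> t; apply: (@continuous_max R R^o (fun=> 0) ((fun=> 1) \min (fun t : R^o => t))).
    exact: cst_continuous.
  by apply: continuous_min; [exact: cst_continuous|exact: cvg_id].
have clI t : cl t \in `[(0:R), 1].
  by rewrite in_itv /= /cl le_max lexx /= ge_max ler01 ge_min lexx.
have cl_id t : t \in `[(0:R), 1] -> cl t = t.
  by rewrite in_itv /= => /andP[ut tv]; rewrite /cl (min_idPr tv) (max_idPr ut).
have I0 : (0:R) \in `[(0:R), 1] by rewrite in_itv /= lexx ler01.
have I1 : (1:R) \in `[(0:R), 1] by rewrite in_itv /= lexx ler01.
exists (g \o cl); last first.
  split; rewrite /= ?cl_id //.
    by move=> s t sI tI /=; rewrite !cl_id //; exact: ig.
  rewrite AE; apply/seteqP; split=> z [t tI <-]; exists t => //=; by rewrite cl_id.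
apply/cont_dist => t e e0.
have [d d0 hd] := (within_dist (`[0, 1] : set R^o) g).1 cg (cl t) (clI t) e e0.
have [d' d'0 hd'] := (cont_dist cl).1 ccl t d d0.
by exists d' => // y /hd' ty; apply: hd => //; exact: clI.
Qed.

Lemma path_arc g (u v : R) : u < v -> continuous g -> {in `[u, v] &, injective g} ->
  arc (g u) (g v) (g @` `[u, v]).
Proof.
move=> uv cg ig; pose k (t : R^o) : R^o := u + t * (v - u).
have vu : 0 < v - u by rewrite subr_gt0.
have kI t : t \in `[(0:R), 1] -> k t \in `[u, v].
  rewrite !in_itv /= => /andP[t0 t1]; rewrite lerDl mulr_ge0 ?(ltW vu) //=.
  by rewrite -lerBrDl ler_piMl // ltW.
have ck : continuous k.
  by move=> t; apply: cvgD; [exact: cvg_cst|apply: cvgM; [exact: cvg_id|exact: cvg_cst]].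
exists (g \o k); split.
- apply: continuous_subspaceT => t.
  exact: (@continuous_comp R^o R^o (plane R) k g t (ck t) (cg _)).
- move=> s t sI tI /= /(ig _ _ (kI _ sI) (kI _ tI)) /addrI.
  by move/(mulIf (lt0r_neq0 vu)).
- by rewrite /k /= mul0r addr0.
- by rewrite /k /= mul1r subrKC.
apply/seteqP; split=> z [t tI <-].
  exists ((t - u) / (v - u)).
    move: tI; rewrite /= !in_itv /= => /andP[ut tv].
    by rewrite divr_ge0 ?subr_ge0 ?(ltW uv) //= ler_pdivrMr // mul1r lerD2r.
  by rewrite /k /= divfK ?lt0r_neq0 // subrKC.
by exists (k t) => //; exact: kI.
Qed.

Lemma arc_l p q A : arc p q A -> A p.
Proof. by move=> [g [_ _ <- _ ->]]; exists 0; rewrite //= in_itv /= lexx ler01. Qed.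

Lemma arc_r p q A : arc p q A -> A q.
Proof. by move=> [g [_ _ _ <- ->]]; exists 1; rewrite //= in_itv /= lexx ler01. Qed.

Lemma arc_compact p q A : arc p q A -> compact A.
Proof. by move=> /arc_path[g cg [_ _ _ ->]]; exact: path_compact. Qed.

Lemma arc_connected p q A : arc p q A -> connected A.
Proof. by move=> /arc_path[g cg [_ _ _ ->]]; exact: path_connected. Qed.

Lemma arc_sym p q A : arc p q A -> arc q p A.
Proof.
move=> /arc_path[g cg [ig <- <- ->]]; pose h (t : R^o) := g (1 - t).
have ch : continuous h.
  move=> t; have c1 : {for t, continuous (fun t : R^o => 1 - t : R^o)}.
    by apply: cvgB; [exact: cvg_cst|exact: cvg_id].
  exact: (@continuous_comp R^o R^o (plane R) _ g t c1 (cg _)).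
have I (t : R) : t \in `[0, 1] -> 1 - t \in `[0, 1] by rewrite !in_itv /=; lra.
have E1 : g 1 = h 0 by rewrite /h subr0.
have E0 : g 0 = h 1 by rewrite /h subrr.
rewrite E1 E0 (_ : g @` _ = h @` `[0, 1]); first apply: path_arc => //.
  by move=> s t /I sI /I tI /(ig _ _ sI tI) E; lra.
apply/seteqP; split=> z [t /I tI <-]; exists (1 - t) => //.
by rewrite /h opprB subrKC.
Qed.

Lemma segment_arc p q : p != q -> arc p q (segment p q).
Proof.
move=> pq; rewrite segmentE.
have E0 : p = (fun t : R^o => (1 - t) *: p + t *: q) 0.
  by rewrite subr0 scale1r scale0r addr0.
have E1 : q = (fun t : R^o => (1 - t) *: p + t *: q) 1.
  by rewrite subrr scale1r scale0r add0r.
rewrite [X in arc X]E0 [X in arc _ X]E1; apply: path_arc; first exact: ltr01.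
  exact: continuous_affine.
move=> s t _ _ E.
have F (x : R) : (1 - x) *: p + x *: q = p + x *: (q - p).
  by rewrite scalerBl scale1r scalerBr -addrA [- _ + _]addrC.
have : (s - t) *: (q - p) = 0.
  by move: E; rewrite !F => /addrI E; rewrite scalerBl E subrr.
move/eqP; rewrite scaler_eq0 !subr_eq0 [q == p]eq_sym (negbTE pq) orbF.
by move/eqP.
Qed.

Lemma continuous_glue g h (c : R) : continuous g -> continuous h -> g c = h c ->
  continuous (fun s : R^o => if s <= c then g s else h s).
Proof.
move=> cg ch E; apply/cont_dist => s e e0.
have [d1 d10 h1] := (cont_dist g).1 cg s e e0.
have [d2 d20 h2] := (cont_dist h).1 ch s e e0.
have [lt|gt|->] := ltgtP s c.
- exists (Num.min d1 (c - s)); first by rewrite lt_min d10 subr_gt0.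
  move=> y; rewrite lt_min => /andP[/h1 sy]; rewrite ltr_norml => /andP[a b].
  by rewrite (_ : y <= c) //; lra.
- exists (Num.min d2 (s - c)); first by rewrite lt_min d20 subr_gt0.
  move=> y; rewrite lt_min => /andP[/h2 sy]; rewrite ltr_norml => /andP[a b].
  by rewrite (_ : y <= c = false) //; apply/negbTE; rewrite -ltNge; lra.
have [d1' d10' h1'] := (cont_dist g).1 cg c e e0.
have [d2' d20' h2'] := (cont_dist h).1 ch c e e0.
exists (Num.min d1' d2'); first by rewrite lt_min d10'.
by move=> y; rewrite lt_min => /andP[/h1' a /h2' b]; case: ifP => // _; rewrite E.
Qed.

Lemma path_glue g h (u c v : R) : continuous g -> continuous h -> g c = h c ->
  u <= c -> c <= v ->
  {in `[u, c] &, injective g} -> {in `[c, v] &, injective h} ->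
  (forall s t, s \in `[u, c] -> t \in `[c, v] -> g s = h t -> t = c) ->
  exists2 f, continuous f & [/\ {in `[u, v] &, injective f},
    forall s, s <= c -> f s = g s & forall s, c <= s -> f s = h s].
Proof.
move=> cg ch E uc cv ig ih gh.
exists (fun s : R^o => if s <= c then g s else h s); first exact: continuous_glue.
have P (s t : R) : s \in `[u, v] -> t \in `[u, v] -> s <= c -> ~~ (t <= c) -> g s <> h t.
  rewrite !in_itv /= -ltNge => /andP[us _] /andP[_ tv] sc ct gst.
  have := gh s t; rewrite !in_itv /= us sc tv (ltW ct) => /(_ isT isT gst) H.
  by move: ct; rewrite H ltxx.
split=> [s t sI tI||].
- case: ifPn => sc; case: ifPn => tc.
  + by apply: ig; rewrite in_itv /= ?sc ?tc andbT; [case/andP: sI|case/andP: tI].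
  + by move=> /P; case.
  + by move/esym/P; case.
  + rewrite -!ltNge in sc tc.
    by apply: ih; rewrite in_itv /= ltW //=; [case/andP: sI|case/andP: tI].
- by move=> s ->.
by move=> s; rewrite le_eqVlt => /orP[/eqP <-|cs]; rewrite ?lexx // leNgt cs.
Qed.

Lemma first_hit g C (u v : R) : continuous g -> closed C -> u <= v -> C (g v) ->
  exists2 s, s \in `[u, v] & C (g s) /\ forall t, u <= t -> t < s -> ~ C (g t).
Proof.
move=> cg cC uv Cv; pose S := (`[u, v] : set R^o) `&` g @^-1` C.
have cS : compact S.
  apply: compact_closedI; first exact: segment_compact.
  by apply: preimage_closed => // x; exact: cg.
have [||s sS smin] := @compact_EVT_min _ R (fun t : R^o => t) S _ cS.
- by exists v; split=> //; rewrite /= in_itv /= uv lexx.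
- by apply: continuous_subspaceT => t; exact: cvg_id.
have [sI Cs] := set_mem sS; exists s => //; split=> // t ut ts Ct.
have : s <= t.
  apply: smin; rewrite inE; split=> //=; rewrite in_itv /= ut /=.
  by move: sI; rewrite /= in_itv /= => /andP[_]; apply: le_trans; exact: ltW.
by rewrite leNgt ts.
Qed.

Lemma last_hit g C (u v : R) : continuous g -> closed C -> u <= v -> C (g u) ->
  exists2 s, s \in `[u, v] & C (g s) /\ forall t, s < t -> t <= v -> ~ C (g t).
Proof.
move=> cg cC uv Cv; pose S := (`[u, v] : set R^o) `&` g @^-1` C.
have cS : compact S.
  apply: compact_closedI; first exact: segment_compact.
  by apply: preimage_closed => // x; exact: cg.
have [||s sS smax] := @compact_EVT_max _ R (fun t : R^o => t) S _ cS.
- by exists u; split=> //; rewrite /= in_itv /= uv lexx.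
- by apply: continuous_subspaceT => t; exact: cvg_id.
have [sI Cs] := set_mem sS; exists s => //; split=> // t st tv Ct.
have : t <= s.
  apply: smax; rewrite inE; split=> //=; rewrite in_itv /= tv andbT.
  by move: sI; rewrite /= in_itv /= => /andP[us _]; apply: (le_trans us); exact: ltW.
by rewrite leNgt st.
Qed.

(** Follow [A] to its first point on [B], then follow [B]; the two pieces meet nowhere else. *)
Lemma arc_trans p q r A B : arc p q A -> arc q r B -> p != r ->
  exists2 C, arc p r C & C `<=` A `|` B.
Proof.
move=> pA qB pr; have cB := compact_closed (@plane_hausdorff R) (arc_compact qB).
have [g cg [ig gp gq AE]] := arc_path pA; have [h ch [ih hq hr BE]] := arc_path qB.
have Bq := arc_l qB; rewrite -gq in Bq.
have [s sI [Bs smin]] := first_hit cg cB ler01 Bq.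
have [t tI hts] : (h @` `[0, 1]) (g s) by rewrite -BE.
have [s0 s1] : 0 <= s /\ s <= 1 by move: sI; rewrite in_itv /= => /andP.
have [t0 t1] : 0 <= t /\ t <= 1 by move: tI; rewrite /= in_itv /= => /andP.
(* The junction may be [p] itself, or below [r] itself; then one piece shrinks to a point and the
   other is the arc. *)
have [z0|sp] := eqVneq s 0.
  have tl : t < 1.
    rewrite lt_neqAle t1 andbT; apply: contra pr => /eqP E.
    by rewrite -gp -z0 -hts E hr.
  exists (h @` `[t, 1]).
    rewrite -gp -z0 -hts -hr; apply: path_arc => //.
    by apply: sub_in2 ih => x; rewrite !in_itv /= => /andP[tx ->]; rewrite (le_trans t0).
  move=> _ [x xI <-]; right; rewrite BE; exists x => //.
  by move: xI; rewrite /= !in_itv /= => /andP[tx ->]; rewrite (le_trans t0).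
have {sp} sp : 0 < s by rewrite lt_neqAle eq_sym sp.
have subA : g @` `[0, s] `<=` A.
  move=> _ [x xI <-]; rewrite AE; exists x => //.
  by move: xI; rewrite /= !in_itv /= => /andP[-> xs]; rewrite (le_trans xs).
have igs : {in `[0, s] &, injective g}.
  by apply: sub_in2 ig => x; rewrite !in_itv /= => /andP[-> xs]; rewrite (le_trans xs).
have [z1|tp] := eqVneq t 1.
  exists (g @` `[0, s]); last by move=> z /subA; left.
  by rewrite -gp -hr -z1 hts; apply: path_arc.
have {tp} tp : t < 1 by rewrite lt_neqAle tp.
(* The parameter is shifted so that the rest of [B] starts at time [s]. *)
pose k (x : R^o) := h (t + (x - s)).
have ck : continuous k.
  move=> x; have c1 : {for x, continuous (fun x : R^o => t + (x - s) : R^o)}.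
    by apply: cvgD; [exact: cvg_cst|apply: cvgB; [exact: cvg_id|exact: cvg_cst]].
  exact: (@continuous_comp R^o R^o (plane R) _ h x c1 (ch _)).
have kI (x : R) : x \in `[s, s + (1 - t)] -> t + (x - s) \in `[(0 : R), 1].
  by rewrite !in_itv /=; lra.
have sv : s <= s + (1 - t) by rewrite lerDl subr_ge0.
have Es : g s = k s by rewrite /k subrr addr0 hts.
have [||f cf [if' fg fh]] := path_glue cg ck Es s0 sv igs.
- by move=> x y /kI xI /kI yI /(ih _ _ xI yI) E; lra.
- move=> x y xI yI E.
  have Bx : B (g x) by rewrite BE E; exists (t + (y - s)) => //; exact: kI.
  have xs : x = s.
    move: xI; rewrite in_itv /= => /andP[x0]; rewrite le_eqVlt => /orP[/eqP //|xs].
    by case: (smin x x0 xs).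
  move: E; rewrite xs Es => /(ih _ _ (kI _ _) (kI _ yI)) H.
  by have := H _; rewrite in_itv /= lexx sv => /(_ isT); lra.
exists (f @` `[0, s + (1 - t)]).
  have -> : p = f 0 by rewrite fg // gp.
  have -> : r = f (s + (1 - t)) by rewrite fh // /k -hr; congr h; lra.
  by apply: path_arc => //; lra.
move=> _ [x xI <-]; move: xI; rewrite /= in_itv /= => /andP[x0 x1].
have [xs|sx] := leP x s.
  by left; apply: subA; exists x; rewrite ?fg //= in_itv /= x0.
right; rewrite fh ?(ltW sx) // BE; exists (t + (x - s)) => //; apply: kI.
by rewrite in_itv /= (ltW sx).
Qed.

(** An arc has two distinct ends; admitting [p = q] makes this an equivalence relation on [S]. *)
Definition arcconn S p q := S p /\ (p = q \/ exists2 A, arc p q A & A `<=` S).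

Lemma arcconn_refl S p : S p -> arcconn S p p.
Proof. by move=> Sp; split=> //; left. Qed.

Lemma arcconn_r S p q : arcconn S p q -> S q.
Proof. by move=> [Sp [<- //|[A /arc_r Aq]]]; apply. Qed.

Lemma arcconn_sym S p q : arcconn S p q -> arcconn S q p.
Proof.
move=> H; split; first exact: arcconn_r H.
by case: H => _ [->|[A /arc_sym pA AS]]; [left|right; exists A].
Qed.

Lemma arcconn_trans S p q r : arcconn S p q -> arcconn S q r -> arcconn S p r.
Proof.
move=> [Sp pq] [Sq qr]; split=> //.
case: pq => [->//|[A pA AS]]; case: qr => [<-|[B qB BS]]; first by right; exists A.
have [->|pr] := eqVneq p r; first by left.
right; have [C pC CAB] := arc_trans pA qB pr; exists C => // z /CAB[/AS|/BS] //.
Qed.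

Lemma arcconnW S S' p q : S `<=` S' -> arcconn S p q -> arcconn S' p q.
Proof.
move=> SS' [/SS' Sp pq]; split=> //.
by case: pq => [->|[A pA AS]]; [left|right; exists A => // z /AS /SS'].
Qed.

Lemma arcconn_segment S p q : segment p q `<=` S -> arcconn S p q.
Proof.
move=> H; split; first exact/H/segment_l.
have [->|pq] := eqVneq p q; [by left|right; exists (segment p q) => //].
exact: segment_arc.
Qed.

Lemma open_arcconn S p q : open S -> connected S -> S p -> S q -> arcconn S p q.
Proof.
move=> /open_dist oS cS Sp Sq.
have loc x y e : (forall y, `|x - y| < e -> S y) -> 0 < e -> `|x - y| < e -> arcconn S x y.
  move=> he e0 xy; apply: arcconn_segment => z /(@cvx_ball R x e); move=> H.
  by apply/he/H => //=; rewrite subrr normr0.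
pose B := [set x | arcconn S p x].
suff E : B = S by have h : B q; [rewrite E|exact: h].
apply: cS; first by exists p; exact: arcconn_refl.
  exists B; last by apply/seteqP; split=> x; [move=> h; split=> //; exact: arcconn_r h|case].
  apply/open_dist => x px; have [e e0 he] := oS x (arcconn_r px).
  by exists e => // y xy; apply: (arcconn_trans px); exact: loc xy.
exists (~` [set x | S x /\ ~ arcconn S p x]).
  apply: open_closedC; apply/open_dist => x [Sx px]; have [e e0 he] := oS x Sx.
  exists e => // y xy; split; first exact: he.
  by move=> py; apply: px; apply: (arcconn_trans py); apply: arcconn_sym; exact: loc xy.
apply/seteqP; split=> x.
  by move=> h; split; [exact: arcconn_r h|case=> _].
by case=> Sx h; apply: contrapT => h'; exact: h.
Qed.

End Arcs.

(** * Faces that touch an arc *)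

Section Touch.
Variable R : realType.
Implicit Types (p q x y z a : plane R) (A B C F K S : set (plane R)) (g h : R^o -> plane R).

Lemma connected_sub_open C F x : connected C -> open F -> C x -> F x ->
  (forall z, C z -> closure F z -> F z) -> C `<=` F.
Proof.
move=> cC oF Cx Fx CF; have E : C `&` F = C.
  apply: cC; first by exists x.
    by exists F.
  exists (closure F); first exact: closed_closure.
  by apply/seteqP; split=> z [Cz h]; split=> //; [exact: subset_closure|exact: CF].
by move=> z Cz; have [] : (C `&` F) z by rewrite E.
Qed.

Lemma path_closed g (u v : R) : continuous g -> closed (g @` `[u, v]).
Proof. by move=> cg; apply: compact_closed; [exact: plane_hausdorff|exact: path_compact]. Qed.

Lemma path_image_in g (u v s : R) : u <= s -> s <= v -> (g @` `[u, v]) (g s).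
Proof. by move=> us sv; exists s; rewrite //= in_itv /= us. Qed.

Lemma ball_component K x y z e : (forall w, `|z - w| < e -> ~ K w) ->
  `|z - x| < e -> `|z - y| < e -> connected_component (~` K) x y.
Proof.
move=> h zx zy; exists [set w | `|z - w| < e] => //; split=> //.
by apply: cvx_connected; exact: cvx_ball.
Qed.

(** Let [sg] be the last parameter up to [t] at which the closure of [F] meets the path, and remove
    the piece between [sg] and [t]. A point of [F] near [g sg] can then reach a point [g r] of the
    removed piece, because the part just before [sg] is an arc hanging by one end and does not
    separate. On the way it cannot leave [F], since [F] touches nothing of the removed piece; but
    [g r] is not in [F]. *)
Lemma touch_right K' g (u v s t : R) x0 : compact K' -> continuous g ->
  {in `[u, v] &, injective g} ->
  (forall r, u < r -> r < v -> ~ K' (g r)) ->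
  let F := connected_component (~` (K' `|` g @` `[u, v])) x0 in
  u < s -> s < v -> closure F (g s) -> s <= t -> t <= v -> closure F (g t).
Proof.
move=> cK' cg ig K'g; set K := K' `|` _ => F us sv Fs.
have cK : closed K.
  apply: closedU; last exact: path_closed.
  exact: (compact_closed (@plane_hausdorff R)).
have oF : open F by apply: component_open; rewrite openC.
have main (t' : R) : s <= t' -> t' < v -> closure F (g t').
  move: t' => {}t st tv; apply: contrapT => nFt.
  have [sg sgI [Fsg sgmax]] := last_hit cg (@closed_closure _ F) st Fs.
  have [ssg sgt] : s <= sg /\ sg <= t by move: sgI; rewrite in_itv /= => /andP.
  have {}sgt : sg < t by rewrite lt_neqAle sgt andbT; apply: contra_notN nFt => /eqP <-.
  pose s' := (u + sg) / 2.
  have us' : u < s' by rewrite /s'; lra.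
  have s's : s' < sg by rewrite /s'; lra.
  (* The path strictly between [s'] and [t] is left out. Up to [sg] it is put back by [arc_nosep];
     beyond [sg] it stays open. *)
  pose K2 := K' `|` (g @` `[u, s'] `|` g @` `[t, v]).
  have cK2 : compact K2 by apply: compactU => //; apply: compactU; exact: path_compact.
  have clK2 := compact_closed (@plane_hausdorff R) cK2.
  have I (r : R) : u <= r -> r <= v -> r \in `[u, v] by move=> a b; rewrite in_itv /= a.
  have nK2 (r : R) : s' < r -> r < t -> ~ K2 (g r).
    move=> s'r rt [|[[w]|[w]]]; first by apply: K'g; lra.
      by rewrite /= in_itv /= => /andP[uw ws'] /ig E; have := E (I _ _ _) (I _ _ _); lra.
    by rewrite /= in_itv /= => /andP[uw ws'] /ig E; have := E (I _ _ _) (I _ _ _); lra.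
  have [d d0 hd] := closed_dist clK2 (nK2 sg s's sgt).
  have [x Fx sgx] := (closure_dist _ _).1 Fsg d d0.
  have [d' d'0 hd'] := (cont_dist g).1 cg sg d d0.
  pose r := Num.min (sg + d' / 2) ((sg + t) / 2).
  have rsg : sg < r by rewrite lt_min; apply/andP; split; lra.
  have rt : r < t by rewrite gt_min; apply/orP; right; lra.
  have rd : r <= sg + d' / 2 by rewrite ge_min lexx.
  have gr : `|g sg - g r| < d.
    by apply: hd'; rewrite distrC ger0_norm; lra.
  have xr := ball_component hd sgx gr.
  have nKx : ~ K x := connected_component_sub Fx.
  have xr' : connected_component (~` (K2 `|` g @` `[s', sg])) x (g r).
    apply: arc_nosep => //; last 1 first.
    - move=> [w]; rewrite /= in_itv /= => /andP[w1 w2] /ig E.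
      by have := E (I _ _ _) (I _ _ _); lra.
    - by move=> w z; rewrite !in_itv /= => /andP[? ?] /andP[? ?]; apply: ig; apply: I; lra.
    - lra.
    - move=> w; rewrite in_itv /= => /andP[w1 w2] Kw.
      by apply/eqP; rewrite eq_le w1 andbT leNgt; apply/negP => h; apply: (nK2 w) => //; lra.
    - by move=> [w]; rewrite /= in_itv /= => /andP[w1 w2] E; apply: nKx; right; rewrite -E;
        apply: path_image_in; lra.
  have sub : connected_component (~` (K2 `|` g @` `[s', sg])) x `<=` F.
    apply: (connected_sub_open (x := x)) => //.
    - exact: component_connected.
    - by apply: connected_component_refl; apply: (connected_component_sub (connected_component_sym xr')).
    move=> z xz Fz; have nz := connected_component_sub xz.
    apply: (component_closure cK Fz) => -[K'z|[w]].
      by apply: nz; left; left.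
    rewrite /= in_itv /= => /andP[uw wv] wz; apply: nz; rewrite -wz.
    have [ws'|s'w] := leP w s'; first by left; right; left; apply: path_image_in.
    have [wsg|sgw] := leP w sg; first by right; apply: path_image_in => //; lra.
    have [wt|tw] := leP w t; last by left; right; right; apply: path_image_in => //; lra.
    by case: (sgmax w sgw wt); rewrite wz.
  have := connected_component_sub (sub _ xr'); apply; right; apply: path_image_in; lra.
move=> st; rewrite le_eqVlt => /orP[/eqP ->|tv]; last exact: main.
apply/closure_dist => e e0; have e20 : 0 < e / 2 by lra.
have [d d0 hd] := (cont_dist g).1 cg v (e / 2) e20.
pose w := Num.max s (v - d / 2).
have sw : s <= w by rewrite le_max lexx.
have dw : v - d / 2 <= w by rewrite le_max lexx orbT.
have wv : w < v by rewrite gt_max; apply/andP; split; lra.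
have [y Fy wy] := (closure_dist _ _).1 (main w sw wv) _ e20.
exists y => //; have vw : `|g v - g w| < e / 2 by apply: hd; rewrite ger0_norm; lra.
rewrite -(subrK (g w) (g v)) -addrA (splitr e).
by apply: (le_lt_trans (ler_normD _ _)); exact: ltrD.
Qed.

(** Parameters before [s] are handled by reversing the path. *)
Lemma touch_all K' g (u v s t : R) x0 : compact K' -> continuous g ->
  {in `[u, v] &, injective g} ->
  (forall r, u < r -> r < v -> ~ K' (g r)) ->
  let F := connected_component (~` (K' `|` g @` `[u, v])) x0 in
  u < s -> s < v -> closure F (g s) -> u <= t -> t <= v -> closure F (g t).
Proof.
move=> cK' cg ig K'g F us sv Fs ut tv.
have [st|ts] := leP s t; first exact: (touch_right cK' cg ig K'g us sv Fs).
pose h (x : R^o) := g (- x).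
have ch : continuous h.
  move=> x; have c1 : {for x, continuous (fun x : R^o => - x : R^o)} by apply: cvgN; exact: cvg_id.
  exact: (@continuous_comp R^o R^o (plane R) _ g x c1 (cg _)).
have E : g @` `[u, v] = h @` `[- v, - u].
  apply/seteqP; split=> z [r]; rewrite /= in_itv /= => /andP[a b] <-.
    by exists (- r); rewrite /h ?opprK //= in_itv /= !lerN2 a b.
  by exists (- r); rewrite //= in_itv /=; apply/andP; split; lra.
rewrite -[t]opprK -/(h (- t)) /F E.
apply: (@touch_right K' h (- v) (- u) (- s) (- t) x0); rewrite ?ltrN2 ?lerN2 //.
- move=> x y; rewrite !in_itv /= => /andP[? ?] /andP[? ?] /ig H; apply: oppr_inj; apply: H;
    rewrite in_itv /=; apply/andP; split; lra.
- by move=> r r1 r2; apply: K'g; lra.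
- by rewrite /h opprK -E.
- exact: ltW.
Qed.

End Touch.

(** * Regions of a face near the end of an arc *)

Section Access.
Variable R : realType.
Implicit Types (p q x y z a : plane R) (A B C F K S : set (plane R)) (g h : R^o -> plane R).

Definition sphere a (e : R) : set (plane R) := [set z | `|a - z| = e].
Definition oball a (e : R) : set (plane R) := [set z | `|a - z| < e].

Lemma sphere_closed a e : closed (sphere a e).
Proof.
have -> : sphere a e = (fun z => `|a - z| : R^o) @^-1` [set e] by [].
apply: preimage_closed; last exact: closed_eq.
move=> z _; have c1 : {for z, continuous (fun z : plane R => a - z)}.
  by apply: cvgB; [exact: cvg_cst|exact: cvg_id].
exact: (@continuous_comp (plane R) (plane R) R^o _ _ z c1 (@norm_continuous _ _ _)).
Qed.

Lemma sphere_compact a e : compact (sphere a e).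
Proof.
apply/compact_closedP; split; first exact: sphere_closed.
exists (`|a| + e) => z /= <-; have := ler_normB a (a - z).
by rewrite opprB addrC subrK.
Qed.

Lemma sphere_oball a e z : sphere a e z -> ~ oball a e z.
Proof. by rewrite /sphere /oball /= => ->; rewrite ltxx. Qed.

Lemma oball_open a e : open (oball a e).
Proof.
apply/open_dist => x ax; exists (e - `|a - x|); first by rewrite subr_gt0.
move=> y xy; rewrite /oball /= -(subrK x a) -addrA.
by apply: (le_lt_trans (ler_normD _ _)); lra.
Qed.

Lemma oball_closure a e z : closure (oball a e) z -> `|a - z| <= e.
Proof.
move=> /closure_dist H; rewrite leNgt; apply/negP => lt.
have [|y ay zy] := H (`|a - z| - e); first by rewrite subr_gt0.
have := ler_normD (a - y) (y - z); rewrite addrA subrK [`|y - z|]distrC.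
by rewrite /oball /= in ay; lra.
Qed.

Lemma connected_oball C a e x : connected C -> C x -> oball a e x ->
  C `<=` ~` sphere a e -> C `<=` oball a e.
Proof.
move=> cC Cx ax CS; apply: (connected_sub_open cC (@oball_open a e) Cx ax).
move=> z Cz /oball_closure; rewrite le_eqVlt => /orP[/eqP E|//].
by case: (CS z Cz).
Qed.

(* [C] contains every connected piece of [~` K] near [a] that it meets, and its
   closure meets the arc [g] arbitrarily close to [a = g u]. *)
Definition tracks K g (u : R) (e : R) C :=
  [/\ open C, connected C, C `<=` ~` K,
    forall A, connected A -> A `<=` ~` K -> A `<=` oball (g u) e ->
      A `&` C !=set0 -> A `<=` C &
    forall s, u < s -> exists2 r, u < r < s & closure C (g r)].

(** The path up to its first exit time [t] from the smaller ball becomes the arc of a new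
    configuration, whose compact set also contains the sphere and the rest of the path. A component
    [C'] inside [C] that touches the path at one inner parameter touches it at all of them by
    [touch_all], in particular arbitrarily close to [u]. *)
Lemma tracks_shrink K' g (u v e e' : R) C : compact K' -> continuous g ->
  {in `[u, v] &, injective g} -> u < v ->
  (forall r, u < r -> r < v -> ~ K' (g r)) ->
  let K := K' `|` g @` `[u, v] in
  tracks K g u e C -> 0 < e' -> e' <= e -> e' <= `|g u - g v| ->
  exists2 C', tracks K g u e' C' & C' `<=` C `&` oball (g u) e'.
Proof.
move=> cK' cg ig uv K'g; set K := _ `|` _ => K0 [oC cC CK CA Cg] e'0 e'e e'v.
have I (r : R) : u <= r -> r <= v -> r \in `[u, v] by move=> a b; rewrite in_itv /= a.
pose far := ~` oball (g u) e'.
have cfar : closed far by apply: open_closedC; exact: oball_open.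
have farv : far (g v) by rewrite /far /oball /= => /lt_le_trans/(_ e'v); rewrite ltxx.
have [t tI [tfar tmin]] := first_hit cg cfar (ltW uv) farv.
have [ut tv] : u <= t /\ t <= v by move: tI; rewrite in_itv /= => /andP.
have {}ut : u < t.
  rewrite lt_neqAle ut andbT; apply/eqP => E; apply: tfar.
  by rewrite -E /oball /= subrr normr0.
have near s : u <= s -> s < t -> oball (g u) e' (g s).
  by move=> us st; apply: contrapT => h; exact: (tmin s us st).
pose Ke' := K' `|` (g @` `[t, v] `|` sphere (g u) e').
have cKe' : compact Ke'.
  by apply: compactU => //; apply: compactU; [exact: path_compact|exact: sphere_compact].
have clKe' := compact_closed (@plane_hausdorff R) cKe'.
have nKe' (r : R) : u < r -> r < t -> ~ Ke' (g r).
  move=> ur rt [|[[w]|]]; first by apply: K'g => //; apply: lt_le_trans tv.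
    rewrite /= in_itv /= => /andP[tw wv] /ig E.
    have := E (I _ _ _) (I _ _ _); rewrite (ltW ur) wv (le_trans (ltW ut) tw).
    rewrite (ltW (lt_le_trans rt tv)) => /(_ isT isT isT isT) wr.
    by move: rt; rewrite -wr ltNge tw.
  by rewrite /sphere /=; have := near r (ltW ur) rt; rewrite /oball /= => + E; rewrite E ltxx.
have ig' : {in `[u, t] &, injective g}.
  by apply: sub_in2 ig => x; rewrite !in_itv /= => /andP[-> xt]; rewrite (le_trans xt).
pose Ke := Ke' `|` g @` `[u, t].
have clKe : closed Ke by apply: closedU => //; exact: path_closed.
have KKe : K `<=` Ke.
  move=> z [K'z|[w wI <-]]; first by left; left.
  move: wI; rewrite /= in_itv /= => /andP[uw wv].
  have [wt|tw] := leP w t; first by right; exact: path_image_in.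
  by left; right; left; apply: path_image_in => //; exact: ltW.
have KeK z : Ke z -> oball (g u) e' z -> K z.
  move=> [[K'z|[[w wI <-]|zs]]|[w wI <-]] az; [by left| | |].
  - by right; move: wI; rewrite /= in_itv /= => /andP[a b]; apply: path_image_in => //; apply: le_trans a; exact: ltW.
  - by case: (sphere_oball zs az).
  - by right; move: wI; rewrite /= in_itv /= => /andP[a b]; apply: path_image_in => //; apply: (le_trans b).
have [r /andP[ur rt] Cr] := Cg t ut.
set p := g r in Cr.
have pball : oball (g u) e' p by apply: near => //; exact: ltW.
have pu : g u != p.
  apply/eqP => /ig E; have := E (I _ _ _) (I _ _ _).
  by rewrite lexx (ltW uv) (ltW ur) (ltW (lt_le_trans rt tv)) => /(_ isT isT isT isT) ru; move: ur; rewrite ru ltxx.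
have [d d0 hd] : exists2 d, 0 < d & forall z, `|p - z| < d ->
    [/\ ~ Ke' z, oball (g u) e' z & z != g u].
  have [d1 d10 h1] := closed_dist clKe' (nKe' r ur rt).
  have [d2 d20 h2] := (open_dist _).1 (@oball_open (g u) e') p pball.
  have n0 : 0 < `|p - g u| by rewrite normr_gt0 subr_eq0 eq_sym.
  exists (Num.min d1 (Num.min d2 `|p - g u|)); first by rewrite !lt_min d10 d20.
  move=> z; rewrite !lt_min => /and3P[/h1 a /h2 b c]; split=> //.
  by apply/eqP => E; move: c; rewrite E ltxx.
have [x Cx px] := (closure_dist _ _).1 Cr d d0.
have nKx : ~ K x := CK _ Cx.
have nKex : ~ Ke x by move=> /KeK h; apply/nKx/h; have [] := hd x px.
pose lam (s : R^o) := (1 - s) *: x + s *: p.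
have clam : continuous lam := @continuous_affine R x p.
have lamball s : 0 <= s -> s <= 1 -> `|p - lam s| < d.
  move=> s0 s1; apply: (@cvx_ball R p d x p) => //=; first by rewrite subrr normr0.
  by exists s => //; rewrite /= in_itv /= s0.
have Ke1 : Ke (lam 1).
  by rewrite /lam subrr scale0r scale1r add0r; apply: KKe; right; apply: path_image_in; apply: ltW => //; exact: lt_le_trans tv.
have [ts tsI [Kts tsmin]] := first_hit clam clKe ler01 Ke1.
have [ts0 ts1] : 0 <= ts /\ ts <= 1 by move: tsI; rewrite in_itv /= => /andP.
have lam0 : lam 0 = x by rewrite /lam subr0 scale1r scale0r addr0.
have {}ts0 : 0 < ts.
  rewrite lt_neqAle ts0 andbT; apply: contra_notN nKex => /eqP E.
  by rewrite -lam0 E.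
have [nKts _ tsu] := hd _ (lamball ts (ltW ts0) ts1).
case: (Kts) => // -[r']; rewrite /= in_itv /= => /andP[ur' r't] gr'.
have {}ur' : u < r'.
  by rewrite lt_neqAle ur' andbT; apply: contraNneq tsu => ->; rewrite gr'.
have {}r't : r' < t.
  rewrite lt_neqAle r't andbT; apply: contra_notN nKts => /eqP E; rewrite -gr' E.
  by right; left; apply: path_image_in.
pose C' := connected_component (~` Ke) x.
have C'x : C' x by exact: connected_component_refl.
have C'K : C' `<=` ~` Ke := @connected_component_sub _ _ _.
have cC' : connected C' by exact: component_connected.
have lamC' s : 0 <= s -> s < ts -> C' (lam s).
  move=> s0 sts; exists (lam @` `[0, s]); last by apply: path_image_in.
  split; first by exists 0; rewrite //= in_itv /= lexx.
    by move=> _ [w + <-]; rewrite /= in_itv /= => /andP[w0 ws]; apply: tsmin => //; exact: le_lt_trans sts.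
  exact: path_connected.
have C'r' : closure C' (g r').
  apply/closure_dist => f f0; rewrite gr'.
  have [d' d'0 hd'] := (cont_dist lam).1 clam ts f f0.
  pose s := Num.max 0 (ts - d' / 2).
  have s0 : 0 <= s by rewrite le_max lexx.
  have sd : ts - d' / 2 <= s by rewrite le_max lexx orbT.
  have sts : s < ts by rewrite gt_max ts0 /=; lra.
  exists (lam s); first exact: lamC'.
  by apply: hd'; rewrite ger0_norm; lra.
have C'all s : u <= s -> s <= t -> closure C' (g s).
  exact: (touch_all cKe' cg ig' nKe' ur' r't C'r').
have xb : oball (g u) e' x by have [] := hd x px.
have C'b : C' `<=` oball (g u) e'.
  apply: (connected_oball cC' C'x xb) => z /C'K nz zs; apply: nz; left; right; right.
  exact: zs.
have C'nK : C' `<=` ~` K by move=> z /C'K + /KKe.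
have C'C : C' `<=` C.
  apply: CA => //; last by exists x.
  by move=> z /C'b; rewrite /oball /=; move=> h; exact: lt_le_trans e'e.
exists C'; last by move=> z C'z; split; [exact: C'C|exact: C'b].
split.
- by apply: component_open; rewrite openC.
- exact: cC'.
- exact: C'nK.
- move=> A cA AK Ab [y [Ay C'y]] z Az.
  apply: (connected_component_trans C'y); exists A => //; split=> //.
  by move=> w Aw Kw; apply: (AK w Aw); apply: KeK => //; exact: Ab.
move=> s us; exists ((u + Num.min s t) / 2).
  have : u < Num.min s t by rewrite lt_min us ut.
  have : Num.min s t <= s by rewrite ge_min lexx.
  by move=> *; apply/andP; split; lra.
have : u < Num.min s t by rewrite lt_min us ut.
have : Num.min s t <= t by rewrite ge_min lexx orbT.
by move=> *; apply: C'all; lra.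
Qed.

End Access.

(** * An arc through shrinking regions *)

Section InfiniteArc.
Variables (R : realType) (a : plane R) (C : nat -> set (plane R)).
Hypothesis oC : forall n, open (C n).
Hypothesis cC : forall n, connected (C n).
Hypothesis dC : forall n, C n.+1 `<=` C n.
Hypothesis C0 : forall n, C n !=set0.
Hypothesis Ca : forall e : R, 0 < e -> exists n, C n `<=` oball a e.
Hypothesis na : ~ C 0%N a.

Let decr m n : (m <= n)%N -> C n `<=` C m.
Proof.
move=> /subnK <-; elim: (n - m)%N => [//|k IH] z; rewrite addSn => /dC; exact: IH.
Qed.

(* Stage of the construction: a path on [`[c, 1]] ending (at [c]) in [C n]; the
   part on [`[b, 1]] is final, the part on [`[c, b]] lies in [C m]. *)
Record stage := Stage {
  sg : R^o -> plane R; sc : R; sb : R; sm : nat; sn : nat }.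

Definition stage_ok (s : stage) := [/\
  [/\ continuous (sg s), 0 < sc s, sc s < sb s & sb s <= 1],
  {in `[sc s, 1] &, injective (sg s)}, C (sn s) (sg s (sc s)),
  (forall t, sb s <= t -> t <= 1 -> ~ C (sn s) (sg s t)) &
  (forall t, sc s <= t -> t <= sb s -> C (sm s) (sg s t)) /\
  (forall t, sc s <= t -> t <= 1 -> C 0%N (sg s t))].

Definition stage_next (s s' : stage) := [/\ sm s' = sn s, (sn s < sn s')%N,
  sc s <= sb s', sb s' < sb s & forall t, sb s' <= t -> sg s' t = sg s t].

Let avoid (g : R^o -> plane R) (u v : R) n : continuous g ->
  (forall t, u <= t -> t <= v -> g t <> a) ->
  exists2 n', (n < n')%N & forall t, u <= t -> t <= v -> ~ C n' (g t).
Proof.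
move=> cg ga; have cl := @path_closed R g u v cg.
have [|e e0 he] := closed_dist (x := a) cl.
  by move=> [t]; rewrite /= in_itv /= => /andP[ut tv]; exact: ga.
have [k hk] := Ca e0; exists (maxn n.+1 k); first by rewrite leq_max leqnn.
move=> t ut tv /(decr (leq_maxr _ _)) /hk h; apply: (he _ h).
exact: path_image_in.
Qed.

(** An arc from [g c] into a deeper region is joined to the old path at the last point of the old
    path on it, and the old path before that point is dropped. The junction comes before [b],
    because from [b] on the old path avoids [C n], where the new arc runs. *)
Let stage_step s : stage_ok s -> exists2 s', stage_ok s' & stage_next s s'.
Proof.
case: s => g c b m n [] /= [cg c0 cb b1] ig Cnc Cnb [Cm C0t].
have c1 : c <= 1 by lra.
have ga t : c <= t -> t <= 1 -> g t <> a by move=> ct t1 E; apply: na; rewrite -E; exact: C0t.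
have [n' nn' Cn'] := avoid n cg ga.
have [y Cy] := C0 n'.
have Cny : C n y := decr (ltnW nn') Cy.
have [_ [gy|[B gyB BC]]] := open_arcconn (@oC n) (@cC n) Cnc Cny.
  by case: (Cn' c) => //; rewrite gy.
have [be cbe [ibe be0 be1 BE]] := arc_path gyB.
have clB := compact_closed (@plane_hausdorff R) (arc_compact gyB).
have [s sI [Bs smax]] := last_hit cg clB c1 (arc_l gyB).
have [cs s1] : c <= s /\ s <= 1 by move: sI; rewrite in_itv /= => /andP.
have sb : s < b by rewrite ltNge; apply/negP => bs; apply: (Cnb s bs s1); exact: BC.
have s0 : 0 < s by lra.
have [ta taI tas] : (be @` `[0, 1]) (g s) by rewrite -BE.
have [ta0 ta1] : 0 <= ta /\ ta <= 1 by move: taI; rewrite /= in_itv /= => /andP.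
have {}ta1 : ta < 1.
  rewrite lt_neqAle ta1 andbT; apply/eqP => E.
  by apply: (Cn' s cs s1); rewrite -tas E be1.
(* Runs backwards: time [s] falls on the junction, time [s / 2] on the far end of the new arc. *)
pose f (x : R^o) : R^o := ta + (s - x) * ((1 - ta) / (s / 2)).
have k0 : 0 < (1 - ta) / (s / 2) by rewrite divr_gt0 ?subr_gt0 //; lra.
have cf : continuous f.
  move=> x; apply: cvgD; first exact: cvg_cst.
  by apply: cvgM; [apply: cvgB; [exact: cvg_cst|exact: cvg_id]|exact: cvg_cst].
have fI (x : R) : x \in `[s / 2, s] -> f x \in `[(0:R), 1].
  rewrite !in_itv /= => /andP[sx xs].
  have h0 : 0 <= (s - x) * ((1 - ta) / (s / 2)) by rewrite mulr_ge0 ?subr_ge0 // ltW.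
  have h1 : (s - x) * ((1 - ta) / (s / 2)) <= (s / 2) * ((1 - ta) / (s / 2)).
    by rewrite ler_pM2r //; lra.
  have h2 : (s / 2) * ((1 - ta) / (s / 2)) = 1 - ta by field; lra.
  by rewrite /f; apply/andP; split; lra.
have finj x y' : f x = f y' -> x = y'.
  by move=> /addrI /(mulIf (lt0r_neq0 k0)) E; lra.
have cbf : continuous (be \o f).
  by move=> x; exact: (@continuous_comp R^o R^o (plane R) f be x (cf x) (cbe _)).
have fs : f s = ta by rewrite /f subrr mul0r addr0.
have fs2 : f (s / 2) = 1.
  by rewrite /f (_ : s - s / 2 = s / 2); [field; lra|lra].
have Es : (be \o f) s = g s by rewrite /= fs.
have ss : s / 2 <= s by lra.
have [||| g' cg' [ig' g'l g'r]] := path_glue cbf cg Es ss s1.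
- by move=> x x' /fI xI /fI yI /= /(ibe _ _ xI yI); exact: finj.
- by apply: sub_in2 ig => x; rewrite !in_itv /= => /andP[sx ->]; rewrite (le_trans cs).
- move=> x t xI; rewrite in_itv /= => /andP[st t1] E.
  apply/eqP; rewrite eq_le st andbT leNgt; apply/negP => lt.
  by apply: (smax t lt t1); rewrite -E BE; exists (f x) => //; exact: fI.
have BC' x : s / 2 <= x -> x <= s -> C n (g' x).
  move=> x1 x2; rewrite g'l //; apply: BC; rewrite BE; exists (f x) => //.
  by apply: fI; rewrite in_itv /= x1.
exists (Stage g' (s / 2) s n n'); split=> //=.
- by split=> //; lra.
- by rewrite g'l //= fs2 be1.
- by move=> t st t1; rewrite g'r //; apply: Cn' => //; lra.
- split=> // t st t1; have [ts|ts] := leP t s.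
    by apply: (decr (leq0n n)); exact: BC'.
  by rewrite g'r ?(ltW ts) //; apply: C0t => //; lra.
Qed.

Let stage0 : exists s, stage_ok s /\ sb s = 1.
Proof.
have [y0 Cy0] := C0 0%N.
have ay : 0 < `|a - y0|.
  by rewrite normr_gt0 subr_eq0; apply: contra_notN na => /eqP ->.
have [n hn] := Ca ay; have [y1 Cy1] := C0 n.
have Cy1' : C 0%N y1 := decr (leq0n n) Cy1.
have nCy0 : ~ C n y0 by move=> /hn; rewrite /oball /= ltxx.
have [_ [E|[B y1B BC]]] := open_arcconn (@oC 0) (@cC 0) Cy1' Cy0.
  by case: nCy0; rewrite -E.
have [g cg [ig g0 g1 BE]] := arc_path y1B.
pose f (x : R^o) : R^o := 2 * x - 1.
have cf : continuous f.
  move=> x; apply: cvgB; last exact: cvg_cst.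
  by apply: cvgM; [exact: cvg_cst|exact: cvg_id].
have cgf : continuous (g \o f).
  by move=> x; exact: (@continuous_comp R^o R^o (plane R) f g x (cf x) (cg _)).
have fI (x : R) : x \in `[2^-1, 1] -> f x \in `[(0:R), 1].
  by rewrite !in_itv /= /f => /andP[? ?]; apply/andP; split; lra.
have C0g x : 2^-1 <= x -> x <= 1 -> C 0%N (g (f x)).
  by move=> x1 x2; apply: BC; rewrite BE; exists (f x) => //; apply: fI; rewrite in_itv /= x1.
exists (Stage (g \o f) 2^-1 1 0 n); split=> //; split=> /=.
- by split=> //; lra.
- by move=> x y /fI xI /fI yI /= /(ig _ _ xI yI); rewrite /f => E; lra.
- by rewrite (_ : f _ = 0) ?g0 // /f; lra.
- move=> t t1 t2; rewrite (_ : t = 1); last by lra.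
  by rewrite (_ : f _ = 1) ?g1 // /f; lra.
- by split=> t t1 t2; exact: C0g.
Qed.

(** The stages agree from [b j] on, so they define a path beyond the infimum [bi] of the [b j]; up
    to [bi] it is set to [a]. It is continuous at [bi] because its values lie in ever smaller
    regions, and injective because every stage is and [a] is not in [C 0]. *)
Lemma infinite_arc : exists y A, [/\ arc a y A, C 0%N y & A `<=` C 0%N `|` [set a]].
Proof.
have [s0 [ok0 b01]] := stage0.
pose T := {s | stage_ok s}.
have nx (s : T) : exists s' : T, stage_next (proj1_sig s) (proj1_sig s').
  by case: s => s /= /stage_step[s' ok' h]; exists (exist _ s' ok').
pose next (s : T) : T := proj1_sig (cid (nx s)).
pose S j : stage := proj1_sig (iter j next (exist _ s0 ok0)).
have ok j : stage_ok (S j) by rewrite /S; case: (iter _ _ _).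
have Sn j : stage_next (S j) (S j.+1).
  by rewrite /S iterS /next; case: (cid _).
pose b j := sb (S j); pose g j := sg (S j).
have bS j : b j.+1 < b j by have [] := Sn j.
have b0 : b 0%N = 1 by [].
have bmono i j : (i <= j)%N -> b j <= b i.
  move=> /subnK <-; elim: (j - i)%N => [|k IH]; first by rewrite add0n.
  by rewrite addSn; apply: le_trans IH; exact: ltW.
have bpos j : 0 < b j by have [[_ c0 cb _] _ _ _ _] := ok j; rewrite /b; lra.
have gS i j t : (i <= j)%N -> b i <= t -> g j t = g i t.
  move=> /subnK <-; elim: (j - i)%N => [|k IH]; first by rewrite add0n.
  rewrite addSn => bt; have [_ _ _ _ E] := Sn (k + i)%N; rewrite /g E.
    exact: IH.
  by apply: le_trans bt; apply: bmono; rewrite leqW // leq_addl.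
have gE i j t : b i <= t -> b j <= t -> g j t = g i t.
  by move=> bi bj; have [ij|/ltnW ij] := leqP i j; [exact: gS|symmetry; exact: gS].
have nj j : (j <= sn (S j))%N.
  by elim: j => [//|j IH]; have [_ h _ _ _] := Sn j; exact: leq_ltn_trans h.
pose bi := inf (range b).
have hbi : has_inf (range b).
  by split; [exists (b 0%N); exists 0%N|exists 0 => _ [j _ <-]; exact: ltW].
have bib j : bi < b j.
  by apply: le_lt_trans (bS j); apply: ge_inf; [case: hbi|exists j.+1].
have bilt t : bi < t -> exists j, b j < t.
  move=> bt; have [_ [j _ <-] h] := @inf_adherent R (range b) (t - bi) ltac:(lra) hbi.
  by exists j; rewrite /bi in h bt *; lra.
pose G (t : R^o) : plane R := if pselect (bi < t) is left h then g (proj1_sig (cid (bilt t h))) t else a.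
have GE j t : b j <= t -> G t = g j t.
  move=> bt; rewrite /G; case: pselect => [h|[]]; last exact: lt_le_trans (bib j) bt.
  by case: cid => i /= hi; apply: gE => //; exact: ltW.
have Ga t : t <= bi -> G t = a by move=> tb; rewrite /G; case: pselect => // h; move: tb; rewrite leNgt h.
have cj j : sc (S j) <= b j.+1 by have [_ _ h _ _] := Sn j.
have GCm j t : b j.+1 <= t -> t <= b j -> C (sm (S j)) (G t).
  move=> t1 t2; have [_ _ _ _ [H _]] := ok j; rewrite (GE j.+1) // /g.
  have [_ _ _ _ E] := Sn j; rewrite E //; apply: H => //; exact: le_trans t1.
have GC j t : bi < t -> t <= b j.+2 -> C j (G t).
  move=> /bilt[k /ltW]; elim: k => [|k IH] bk tb.
    by have := bS j.+1; have := bmono 0%N j.+1 isT; lra.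
  have [tk|kt] := leP t (b k); last by apply: IH => //; exact: ltW.
  have jk : (j < k)%N.
    rewrite ltnNge; apply/negP => kj; have := bmono k.+1 j.+1 kj; have := bS j.+1; lra.
  apply: (@decr _ (sm (S k))); last exact: GCm.
  case: k {IH bk tk} jk => // k jk; have [-> _ _ _ _] := Sn k.
  by apply: leq_trans (nj k).
have GnA t : bi < t -> t <= 1 -> C 0%N (G t).
  move=> bt t1; have [j bj] := bilt t bt; rewrite (GE j) ?(ltW bj) //.
  have [[_ _ cb _] _ _ _ [_ H]] := ok j; apply: H => //.
  by apply: ltW; apply: lt_trans bj.
have cG : continuous G.
  apply/cont_dist => t e e0; have [bt|tb] := ltP bi t.
    have [j bj] := bilt t bt.
    have [[cg _ _ _] _ _ _ _] := ok j.
    have [d d0 hd] := (cont_dist (g j)).1 cg t e e0.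
    exists (Num.min d (t - b j)); first by rewrite lt_min d0 subr_gt0.
    move=> y; rewrite lt_min => /andP[/hd ty]; rewrite ltr_norml => /andP[y1 y2].
    by rewrite !(GE j) //; lra.
  rewrite (Ga t tb); have [n hn] := Ca e0.
  have [lt|ge] := ltP t bi.
    exists (bi - t); first by rewrite subr_gt0.
    move=> y; rewrite ltr_norml => /andP[y1 y2].
    by rewrite Ga ?subrr ?normr0 //; lra.
  exists (b n.+2 - bi); first by rewrite subr_gt0.
  move=> y; rewrite ltr_norml => /andP[y1 y2].
  have [by_|yb] := ltP bi y; last by rewrite Ga // subrr normr0.
  by apply: hn; apply: GC => //; lra.
have Gne t : bi < t -> t <= 1 -> G t <> a.
  by move=> bt t1 E; apply: na; rewrite -E; exact: GnA.
have b1 : bi < 1 by have := bib 0%N; rewrite b0.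
have iG : {in `[bi, 1] &, injective G}.
  move=> s t; rewrite !in_itv /= => /andP[+ s1] /andP[+ t1].
  rewrite !le_eqVlt => /orP[/eqP <-|bs] /orP[/eqP <-|bt] //.
  - by rewrite Ga // => /esym /Gne; case.
  - by rewrite (Ga bi) // => /Gne; case.
  have [i hi] := bilt s bs; have [j hj] := bilt t bt.
  pose k := maxn i j.
  have ks : b k <= s by apply: le_trans (ltW hi); apply: bmono; exact: leq_maxl.
  have kt : b k <= t by apply: le_trans (ltW hj); apply: bmono; exact: leq_maxr.
  rewrite !(GE k) //; have [[_ _ cb _] ig _ _ _] := ok k; apply: ig;
    rewrite in_itv /= ?s1 ?t1 andbT; apply: ltW; exact: lt_le_trans cb _.
exists (G 1), (G @` `[bi, 1]); split.
- by rewrite -{1}(Ga bi (lexx _)); exact: path_arc.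
- exact: GnA.
move=> _ [t + <-]; rewrite /= in_itv /= => /andP[+ t1].
rewrite le_eqVlt => /orP[/eqP <-|bt]; first by right; rewrite Ga.
by left; exact: GnA.
Qed.

End InfiniteArc.

Section Accessible.
Variable R : realType.
Implicit Types (p q x y z a : plane R) (A B C F K S : set (plane R)) (g h : R^o -> plane R).

Definition accessible F a := exists y A, [/\ arc a y A, F y & A `<=` F `|` [set a]].

(** [F] itself is the first region; [tracks_shrink] continues it to a nested sequence with radii
    tending to 0, and [infinite_arc] runs an arc through that sequence. *)
Theorem access_left K' g (u v s : R) x0 : compact K' -> continuous g ->
  {in `[u, v] &, injective g} ->
  (forall r, u < r -> r < v -> ~ K' (g r)) ->
  let F := connected_component (~` (K' `|` g @` `[u, v])) x0 in
  u < s -> s < v -> closure F (g s) -> accessible F (g u).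
Proof.
move=> cK' cg ig K'g; set K := K' `|` _ => F us sv Fs.
have uv : u < v by exact: lt_trans sv.
have cK : closed K.
  by apply: closedU; [exact: (compact_closed (@plane_hausdorff R))|exact: path_closed].
have e0 : 0 < `|g u - g v|.
  rewrite normr_gt0 subr_eq0; apply/eqP => /ig; rewrite !in_itv /= !lexx (ltW uv).
  by move=> /(_ isT isT) E; move: uv; rewrite E ltxx.
pose e n : R := `|g u - g v| / n.+1%:R.
have en n : 0 < e n by rewrite divr_gt0.
have eS n : e n.+1 <= e n by rewrite /e ler_pM2l // lef_pV2 ?posrE ?ltr0n // ler_nat.
have e1 n : e n <= `|g u - g v| by rewrite /e ler_pdivrMr // ler_peMr ?(ltW e0) // ler1n.
have FK : F `<=` ~` K by exact: connected_component_sub.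
have tF : tracks K g u (e 0%N) F.
  split.
  - by apply: component_open; rewrite openC.
  - exact: component_connected.
  - exact: FK.
  - move=> A cA AK _ [y [Ay Fy]] z Az.
    by apply: (connected_component_trans Fy); exists A.
  move=> t ut; exists ((u + Num.min t v) / 2).
    have : u < Num.min t v by rewrite lt_min ut.
    have : Num.min t v <= t by rewrite ge_min lexx.
    by move=> *; apply/andP; split; lra.
  have m1 : u < Num.min t v by rewrite lt_min ut.
  have m2 : Num.min t v <= v by rewrite ge_min lexx orbT.
  by apply: (touch_all cK' cg ig K'g us sv Fs); lra.
pose T n := {C | tracks K g u (e n) C}.
have nx n (D : T n) : {D' : T n.+1 | proj1_sig D' `<=` proj1_sig D `&` oball (g u) (e n.+1)}.
  apply: cid; case: D => D tD /=.
  have [D' tD' DD'] := tracks_shrink cK' cg ig uv K'g tD (en n.+1) (eS n) (e1 n.+1).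
  by exists (exist _ D' tD').
pose S : forall n, T n := nat_rect T (exist _ F tF) (fun n D => proj1_sig (nx n D)).
pose C n := proj1_sig (S n).
have CT n : tracks K g u (e n) (C n) by rewrite /C; case: (S n).
have CS n : C n.+1 `<=` C n `&` oball (g u) (e n.+1).
  by rewrite /C /S /=; case: (nx _ _).
have [||||||y [A [yA Cy AC]]] := @infinite_arc R (g u) C.
- by move=> n; have [] := CT n.
- by move=> n; have [] := CT n.
- by move=> n z /CS[].
- move=> n; have [_ _ _ _ H] := CT n; have [r _] := H v uv.
  by move=> /closure_dist/(_ 1 ltr01)[y Cy _]; exists y.
- move=> f f0; pose n := Num.bound (`|g u - g v| / f); exists n.+1 => z /CS[_].
  rewrite /oball /= => h; apply: (lt_le_trans h); rewrite /e ler_pdivrMr //.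
  rewrite mulrC -ler_pdivrMr //; apply: ltW; apply: (lt_trans (archi_boundP _)).
    by rewrite divr_ge0 // ltW.
  by rewrite -/n ltr_nat ltnW.
- move=> /FK; apply; right; apply: path_image_in; [exact: lexx|exact: ltW].
by exists y, A.
Qed.

End Accessible.

(** * Five points linked by paths *)

Section WeakK5.
Variable R : realType.

(** Two continuous arguments of [f] differ by a constant, so the change of argument does not depend
    on the choice. *)
Lemma arg_variation (f : R^o -> plane R) : continuous f -> (forall t, f t != 0) ->
  exists th : R, forall phi : R^o -> R^o, continuous phi ->
    (forall t, 0 <= t -> t <= 1 -> is_arg (f t) (phi t)) -> phi 1 - phi 0 = th.
Proof.
move=> cf f0; pose G (z : plane R) := f z.1.
have cG : continuous G.
  by move=> z; exact: (@continuous_comp (plane R) R^o (plane R) fst f z (@cvg_fst _ _ _ _ _) (cf _)).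
have [psi cpsi hpsi] := arg_lift ltr01 cG (fun z => f0 z.1).
pose psi1 (t : R^o) : R^o := psi (t, 0).
have cpsi1 : continuous psi1.
  move=> t; have c1 : {for t, continuous (fun t : R^o => (t, 0) : plane R)}.
    by apply: (@continuous_pair R R^o (fun t => t) (fun=> 0)); [exact: cvg_id|exact: cst_continuous].
  exact: (@continuous_comp R^o (plane R) R^o _ psi t c1 (cpsi _)).
exists (psi1 1 - psi1 0) => phi cphi hphi.
have p0 : 0 < pi *+ 2 :> R by rewrite mulrn_wgt0 ?pi_gt0.
pose h (t : R^o) : R^o := phi t - psi1 t.
suff : h 0 = h 1 by rewrite /h => E; move: E; lra.
apply: (int_valued_const p0 (@segment_connected R 0 1)).
- by apply: continuous_subspaceT => t; apply: cvgB; [exact: cphi|exact: cpsi1].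
- move=> t; rewrite /= in_itv /= => /andP[t0 t1].
  have a1 : is_arg (f t) (psi1 t).
    by apply: (hpsi (t, 0)); rewrite normp_le /= normr0 ler01 ger0_norm // t1.
  have [n e] := is_arg_uniq a1 (hphi t t0 t1); exists n.
  by rewrite /h e addrAC subrr add0r.
- by rewrite /= in_itv /= lexx ler01.
- by rewrite /= in_itv /= lexx ler01.
Qed.

Lemma is_argN_inv (z : plane R) a : is_arg (- z) a -> is_arg z (a - pi).
Proof.
move=> [r r0 E]; exists r => //; rewrite -[z]opprK E.
have D u : cos (u - pi) = - cos u :> R by rewrite -[u in RHS](subrK pi) cosDpi opprK.
have D' u : sin (u - pi) = - sin u :> R by rewrite -[u in RHS](subrK pi) sinDpi opprK.
by rewrite D D' !mulrN.
Qed.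

Variables (P : nat -> plane R) (ga : nat -> nat -> R^o -> plane R).
Hypothesis cga : forall i j, (i < j < 5)%N -> continuous (ga i j).
Hypothesis ga0 : forall i j, (i < j < 5)%N -> forall t, t <= 0 -> ga i j t = P i.
Hypothesis ga1 : forall i j, (i < j < 5)%N -> forall t, 1 <= t -> ga i j t = P j.
Hypothesis ga_disj : forall i j k l, (i < j < 5)%N -> (k < l < 5)%N ->
  i != k -> i != l -> j != k -> j != l -> forall s t, ga i j s <> ga k l t.

(** With a fourth vertex [d], the point [P c] lies on the path between [c] and [d], which is
    disjoint from the one between [a] and [b]. *)
Let vtx_edge c a b t : (a < b < 5)%N -> (c < 5)%N -> c != a -> c != b -> ga a b t != P c.
Proof.
move=> ab c5 ca cb.
have [d [d5 da db dc]] : exists d, [/\ (d < 5)%N, d != a, d != b & d != c].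
  have : has (fun d => [&& d != a, d != b & d != c]) (iota 0 5).
    case/andP: ab => ab b5; have a5 := ltn_trans ab b5; clear -a5 b5 c5.
    by move: a b c a5 b5 c5; do 3 (case=> [|[|[|[|[|?]]]]] //).
  by move=> /hasP[d]; rewrite mem_iota /= => h /and3P[? ? ?]; exists d.
have [cd|dc'] := ltnP c d.
  rewrite -(@ga0 c d _ 0) ?cd //; apply/eqP; apply: ga_disj; rewrite ?cd ?d5 // eq_sym //.
have dc2 : (d < c)%N by rewrite ltn_neqAle dc dc'.
rewrite -(@ga1 d c _ 1) ?dc2 //; apply/eqP; apply: ga_disj; rewrite ?dc2 ?c5 // eq_sym //.
Qed.

(** For disjoint edges the difference of two points moving on them never vanishes on the square of
    parameters, so its argument returns to its value along the boundary of the square. Each side is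
    the change of argument along one edge seen from an end of the other. This gives one integer
    relation for each pair of disjoint edges. *)
Theorem weak_K5 : False.
Proof.
pose V c a b (th : R) := forall phi : R^o -> R^o, continuous phi ->
  (forall t, 0 <= t -> t <= 1 -> is_arg (ga a b t - P c) (phi t)) -> phi 1 - phi 0 = th.
pose Th c a b := xget 0 (V c a b).
have ThP c a b : (a < b < 5)%N -> (c < 5)%N -> c != a -> c != b -> V c a b (Th c a b).
  move=> ab c5 ca cb; rewrite /Th; case: xgetP => [th _ //|no].
  have [|t|th hth] := @arg_variation (fun t => ga a b t - P c); last by case: (no th).
  - by move=> t; apply: cvgB; [exact: cga|exact: cvg_cst].
  - by rewrite subr_eq0; exact: vtx_edge.
have Pneq i j : (i < 5)%N -> (j < 5)%N -> i != j -> P j - P i != 0.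
  move=> i5 j5 ij; rewrite subr_eq0.
  have [d [d5 di dj]] : exists d, [/\ (d < 5)%N, d != i & d != j].
    have : has (fun d => (d != i) && (d != j)) (iota 0 5).
      by clear -i5 j5; move: i j i5 j5; do 2 (case=> [|[|[|[|[|?]]]]] //).
    by move=> /hasP[d]; rewrite mem_iota /= => h /andP[? ?]; exists d.
  rewrite eq_sym; have [idd|] := ltnP i d.
    by rewrite -(@ga0 i d _ 0) ?idd // vtx_edge ?idd // eq_sym.
  rewrite leq_eqVlt (negbTE di) /= => idd.
  by rewrite -(@ga1 d i _ 1) ?idd // vtx_edge ?idd // eq_sym.
pose A0 i j := xget 0 [set th | is_arg (P j - P i) th].
have A0P i j : (i < 5)%N -> (j < 5)%N -> i != j -> is_arg (P j - P i) (A0 i j).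
  move=> i5 j5 ij; rewrite /A0; case: xgetP => [th _ //|no].
  by have [th h] := is_arg_exists (Pneq _ _ i5 j5 ij); case: (no th).
(* Directions are chosen so that opposite ones differ by exactly pi; [sg] below records the sign. *)
pose A i j := if (i < j)%N then A0 i j else A0 j i + pi.
have AP i j : (i < 5)%N -> (j < 5)%N -> i != j -> is_arg (P j - P i) (A i j).
  move=> i5 j5 ij; rewrite /A; case: ifP => _; first exact: A0P.
  by rewrite -opprB; apply: is_argN; apply: A0P; rewrite // eq_sym.
pose sg i j : int := if (i < j)%N then 1 else -1.
have AS i j : i != j -> A j i - A i j = (sg i j)%:~R * pi.
  rewrite /A /sg neq_ltn => /orP[] h; rewrite h [in (_ < _)%N]ltnNge (ltnW h) /=; lra.
have p0 : pi != 0 :> R by rewrite lt0r_neq0 // pi_gt0.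
have NP c a b : exists n : int, (a < b < 5)%N -> (c < 5)%N -> c != a -> c != b ->
    Th c a b = A c b - A c a + n%:~R * (pi *+ 2).
  have [/and4P[ab c5 ca cb]|] := boolP [&& (a < b < 5)%N, (c < 5)%N, c != a & c != b]; last first.
    by move=> no; exists 0 => *; case/negP: no; apply/and4P; split.
  have [|t|th hth] := @arg_variation (fun t => ga a b t - P c).
  - by move=> t; apply: cvgB; [exact: cga|exact: cvg_cst].
  - by rewrite subr_eq0; exact: vtx_edge.
  have cf : continuous (fun z : plane R => ga a b z.1 - P c).
    move=> z; have h : {for z, continuous (fun z : plane R => ga a b z.1)}.
      by exact: (@continuous_comp (plane R) R^o (plane R) fst (ga a b) z (@cvg_fst _ _ _ _ _) (@cga a b ab _)).
    by apply: cvgB; [exact: h|exact: cvg_cst].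
  have [|psi cpsi hpsi] := arg_lift (@ltr01 R) cf.
    by move=> z; rewrite subr_eq0; exact: vtx_edge.
  pose phi (t : R^o) : R^o := psi (t, 0).
  have cphi : continuous phi.
    move=> t; have c1 : {for t, continuous (fun t : R^o => (t, 0) : plane R)}.
      by apply: (@continuous_pair R R^o (fun t => t) (fun=> 0)); [exact: cvg_id|exact: cst_continuous].
    exact: (@continuous_comp R^o (plane R) R^o _ psi t c1 (cpsi _)).
  have hphi t : 0 <= t -> t <= 1 -> is_arg (ga a b t - P c) (phi t).
    by move=> t0 t1; apply: (hpsi (t, 0)); rewrite normp_le /= normr0 ler01 ger0_norm // t1.
  have E := ThP c a b ab c5 ca cb phi cphi hphi.
  have a5 : (a < 5)%N by case/andP: ab; exact: ltn_trans.
  have b5 : (b < 5)%N by case/andP: ab.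
  have := hphi 0 (lexx _) ler01; rewrite (ga0 ab) // => /(is_arg_uniq (AP c a c5 a5 ca))[n0 e0].
  have := hphi 1 ler01 (lexx _); rewrite (ga1 ab) // => /(is_arg_uniq (AP c b c5 b5 cb))[n1 e1].
  exists (n1 - n0) => *; rewrite -E e0 e1 intrB; ring.
pose N c a b := proj1_sig (cid (NP c a b)).
have NE c a b : (a < b < 5)%N -> (c < 5)%N -> c != a -> c != b ->
    Th c a b = A c b - A c a + (N c a b)%:~R * (pi *+ 2).
  by rewrite /N; case: cid.
have rel a b c d : (a < b < 5)%N -> (c < d < 5)%N ->
    [&& a != c, a != d, b != c & b != d] ->
    (N c a b + N b c d - N d a b - N a c d) * 2 + sg b c + sg c a + sg d b + sg a d = 0.
  move=> ab cd /and4P[ac ad bc bd].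
  pose G (z : plane R) := ga c d z.2 - ga a b z.1.
  have cG : continuous G.
    move=> z; have h1 : {for z, continuous (fun z : plane R => ga a b z.1)}.
      exact: (@continuous_comp (plane R) R^o (plane R) fst (ga a b) z (@cvg_fst _ _ _ _ _) (@cga a b ab _)).
    have h2 : {for z, continuous (fun z : plane R => ga c d z.2)}.
      exact: (@continuous_comp (plane R) R^o (plane R) snd (ga c d) z (@cvg_snd _ _ _ _ _) (@cga c d cd _)).
    by apply: cvgB; [exact: h2|exact: h1].
  have G0 z : G z != 0.
    by rewrite subr_eq0; apply/eqP; apply: ga_disj => //; rewrite eq_sym.
  have [psi cpsi hpsi] := arg_lift (@ltr01 R) cG G0.
  have cx (y : R) : continuous (fun t : R^o => psi (t, y) : R^o).
    move=> t; have c1 : {for t, continuous (fun t : R^o => (t, y) : plane R)}.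
      by apply: (@continuous_pair R R^o (fun t => t) (fun=> y)); [exact: cvg_id|exact: cst_continuous].
    exact: (@continuous_comp R^o (plane R) R^o _ psi t c1 (cpsi _)).
  have cy (x : R) : continuous (fun t : R^o => psi (x, t) : R^o).
    move=> t; have c1 : {for t, continuous (fun t : R^o => (x, t) : plane R)}.
      by apply: (@continuous_pair R R^o (fun=> x) (fun t => t)); [exact: cst_continuous|exact: cvg_id].
    exact: (@continuous_comp R^o (plane R) R^o _ psi t c1 (cpsi _)).
  have cx' (y : R) : continuous (fun t : R^o => psi (t, y) - pi : R^o).
    by move=> t; apply: cvgB; [exact: cx|exact: cvg_cst].
  have hp x y : 0 <= x -> x <= 1 -> 0 <= y -> y <= 1 -> is_arg (ga c d y - ga a b x) (psi (x, y)).
    by move=> x0 x1 y0 y1; apply: (hpsi (x, y)); rewrite normp_le /= !ger0_norm // x1.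
  have a5 : (a < 5)%N by case/andP: ab; exact: ltn_trans.
  have b5 : (b < 5)%N by case/andP: ab.
  have c5 : (c < 5)%N by case/andP: cd; exact: ltn_trans.
  have d5 : (d < 5)%N by case/andP: cd.
  have ca : c != a by rewrite eq_sym.
  have cb : c != b by rewrite eq_sym.
  have da : d != a by rewrite eq_sym.
  have db : d != b by rewrite eq_sym.
  have e1 : psi (1, 0) - psi (0, 0) = Th c a b.
    have := ThP c a b ab c5 ca cb _ (cx' 0); move=> /(_ _) <-; first by lra.
    move=> t t0 t1; apply: is_argN_inv; rewrite opprB -(ga0 cd (lexx 0)).
    exact: hp.
  have e2 : psi (1, 1) - psi (0, 1) = Th d a b.
    have := ThP d a b ab d5 da db _ (cx' 1); move=> /(_ _) <-; first by lra.
    move=> t t0 t1; apply: is_argN_inv; rewrite opprB -(ga1 cd (lexx 1)).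
    exact: hp.
  have e3 : psi (1, 1) - psi (1, 0) = Th b c d.
    apply: (ThP b c d cd b5 bc bd _ (cy 1)).
    by move=> t t0 t1; rewrite -(ga1 ab (lexx 1)); exact: hp.
  have e4 : psi (0, 1) - psi (0, 0) = Th a c d.
    apply: (ThP a c d cd a5 ac ad _ (cy 0)).
    by move=> t t0 t1; rewrite -(ga0 ab (lexx 0)); exact: hp.
  have := NE c a b ab c5 ca cb; have := NE d a b ab d5 da db.
  have := NE b c d cd b5 bc bd; have := NE a c d cd a5 ac ad.
  have := AS _ _ bc; have := AS _ _ ca; have := AS _ _ db; have := AS _ _ ad.
  rewrite -e1 -e2 -e3 -e4 => s1 s2 s3 s4 n1 n2 n3 n4.
  apply: (@intr_inj R); apply: (mulIf p0).
  rewrite mul0r !intrD !intrM !intrB !intrD.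
  move: s1 s2 s3 s4 n1 n2 n3 n4; rewrite !mulr2n => s1 s2 s3 s4 n1 n2 n3 n4.
  lra.
(* Each [N c a b] occurs in exactly two of the fifteen relations, once for each of the two remaining
   vertices. Among the three pairings of four vertices only the interleaved one has a sum of signs
   that is odd after halving. Halved and added modulo 2, the relations would make 5 even. *)
have := rel 0%N 1%N 2%N 3%N isT isT isT.
have := rel 0%N 2%N 1%N 3%N isT isT isT.
have := rel 0%N 3%N 1%N 2%N isT isT isT.
have := rel 0%N 1%N 2%N 4%N isT isT isT.
have := rel 0%N 2%N 1%N 4%N isT isT isT.
have := rel 0%N 4%N 1%N 2%N isT isT isT.
have := rel 0%N 1%N 3%N 4%N isT isT isT.
have := rel 0%N 3%N 1%N 4%N isT isT isT.
have := rel 0%N 4%N 1%N 3%N isT isT isT.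
have := rel 0%N 2%N 3%N 4%N isT isT isT.
have := rel 0%N 3%N 2%N 4%N isT isT isT.
have := rel 0%N 4%N 2%N 3%N isT isT isT.
have := rel 1%N 2%N 3%N 4%N isT isT isT.
have := rel 1%N 3%N 2%N 4%N isT isT isT.
have := rel 1%N 4%N 2%N 3%N isT isT isT.
rewrite /sg /=; clear; move: N => N; lia.
Qed.

End WeakK5.

Section K5Sets.
Variable R : realType.
Implicit Types (p q : plane R) (A B S : set (plane R)).

Definition disj A B := forall z, A z -> B z -> False.

Lemma arcconn_clamped S p q : arcconn S p q -> exists f : R^o -> plane R,
  [/\ continuous f, forall t, t <= 0 -> f t = p, forall t, 1 <= t -> f t = q &
      forall t, S (f t)].
Proof.
move=> [Sp [<-|[A pA AS]]].
  by exists (fun=> p); split=> //; exact: cst_continuous.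
have [g cg [_ g0 g1 AE]] := arc_path pA.
pose cl (t : R^o) : R^o := Num.max 0 (Num.min 1 t).
have ccl : continuous cl.
  move=> t; apply: (@continuous_max R R^o (fun=> 0) ((fun=> 1) \min (fun t : R^o => t))).
    exact: cst_continuous.
  by apply: continuous_min; [exact: cst_continuous|exact: cvg_id].
exists (g \o cl); split.
- by move=> t; exact: (@continuous_comp R^o R^o (plane R) cl g t (ccl t) (cg _)).
- move=> t t0; rewrite /= /cl (min_idPr _) ?(max_idPl t0) //.
  by apply: (le_trans t0); exact: ler01.
- by move=> t t1; rewrite /= /cl (min_idPl t1) (max_idPr ler01).
move=> t; apply: AS; rewrite AE; exists (cl t) => //.
by rewrite /= in_itv /= /cl le_max lexx /= ge_max ler01 ge_min lexx.
Qed.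

(** Regions take the place of paths, so that a face or a connected subgraph can serve as an edge. *)
Lemma weak_K5_sets (p : nat -> plane R) (S : nat -> nat -> set (plane R)) :
  (forall i j, (i < j < 5)%N -> arcconn (S i j) (p i) (p j)) ->
  (forall i j k l, (i < j < 5)%N -> (k < l < 5)%N ->
    i != k -> i != l -> j != k -> j != l -> disj (S i j) (S k l)) -> False.
Proof.
move=> Sc Sd.
pose Q i j (f : R^o -> plane R) := [/\ continuous f, forall t, t <= 0 -> f t = p i,
  forall t, 1 <= t -> f t = p j & forall t, S i j (f t)].
pose ga i j := xget (fun=> 0) (Q i j).
have gaP i j : (i < j < 5)%N -> Q i j (ga i j).
  move=> ij; rewrite /ga; case: xgetP => [f _ //|no].
  by have [f hf] := arcconn_clamped (Sc i j ij); case: (no f).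
apply: (@weak_K5 R p ga).
- by move=> i j /gaP[].
- by move=> i j /gaP[].
- by move=> i j /gaP[].
move=> i j k l ij kl ik il jk jl s t E.
have [_ _ _ h1] := gaP i j ij; have [_ _ _ h2] := gaP k l kl.
apply: (Sd i j k l ij kl ik il jk jl (ga i j s)) => //; by rewrite E.
Qed.

(** The fifteen conditions are the three pairings of each of the five quadruples of vertices. *)
Lemma K5_sets (pa pb pc pd pe : plane R) (Sab Sac Sad Sae Sbc Sbd Sbe Scd Sce Sde : set (plane R)) :
  arcconn Sab pa pb ->
  arcconn Sac pa pc ->
  arcconn Sad pa pd ->
  arcconn Sae pa pe ->
  arcconn Sbc pb pc ->
  arcconn Sbd pb pd ->
  arcconn Sbe pb pe ->
  arcconn Scd pc pd ->
  arcconn Sce pc pe ->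
  arcconn Sde pd pe ->
  disj Sab Scd ->
  disj Sac Sbd ->
  disj Sad Sbc ->
  disj Sab Sce ->
  disj Sac Sbe ->
  disj Sae Sbc ->
  disj Sab Sde ->
  disj Sad Sbe ->
  disj Sae Sbd ->
  disj Sac Sde ->
  disj Sad Sce ->
  disj Sae Scd ->
  disj Sbc Sde ->
  disj Sbd Sce ->
  disj Sbe Scd ->
  False.
Proof.
move=> h0 h1 h2 h3 h4 h5 h6 h7 h8 h9.
move=> d0 d1 d2 d3 d4 d5 d6 d7 d8 d9 d10 d11 d12 d13 d14.
pose l : seq (seq (set (plane R))) := [:: [:: set0; Sab; Sac; Sad; Sae];
  [:: Sab; set0; Sbc; Sbd; Sbe]; [:: Sac; Sbc; set0; Scd; Sce];
  [:: Sad; Sbd; Scd; set0; Sde]].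
apply: (@weak_K5_sets (nth pa [:: pa; pb; pc; pd; pe])
  (fun i j => nth set0 (nth [::] l i) j)).
  by move=> [|[|[|[|i]]]] [|[|[|[|[|j]]]]] //= h; first [assumption | exfalso; move: h; clear; lia].
have dsym A B : disj A B -> disj B A by move=> H z Bz Az; exact: H Az Bz.
have dset i j : (i < j < 5)%N -> forall k m, (k < m < 5)%N ->
    i != k -> i != m -> j != k -> j != m -> (i < k)%N ->
    disj (nth set0 (nth [::] l i) j) (nth set0 (nth [::] l k) m).
  by move: i j => [|[|[|[|i]]]] [|[|[|[|[|j]]]]] //= h;
    try (exfalso; move: h; clear; lia);
    move=> [|[|[|[|k]]]] [|[|[|[|[|m]]]]] //= h'; try (exfalso; move: h'; clear; lia);
    move=> *; assumption.
move=> i j k m ij km ik im jk jm; have [lt|] := ltnP i k; first exact: dset.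
rewrite leq_eqVlt eq_sym (negbTE ik) /= => lt; apply: dsym; apply: dset => //; by rewrite eq_sym.
Qed.

End K5Sets.

(** * Drawings and their faces *)

Section Drawing.
Variable R : realType.
Implicit Types (p q z : plane R) (A B C F K S : set (plane R)).

Lemma compact_seq_union (I : eqType) (s : seq I) (F : I -> set (plane R)) :
  (forall i, i \in s -> compact (F i)) -> compact [set z | exists2 i, i \in s & F i z].
Proof.
elim: s => [_|i s IH H].
  by rewrite (_ : [set z | _] = set0); [exact: compact0|apply/seteqP; split=> z // []].
rewrite (_ : [set z | _] = F i `|` [set z | exists2 j, j \in s & F j z]).
  apply: compactU; first by apply: H; rewrite mem_head.
  by apply: IH => j js; apply: H; rewrite inE js orbT.
apply/seteqP; split=> z; first by move=> [j]; rewrite inE => /orP[/eqP ->|js] Fz; [left|right; exists j].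
move=> [Fz|[j js Fz]]; first by exists i => //; rewrite mem_head.
by exists j => //; rewrite inE js orbT.
Qed.

Lemma hit_segment K x q : closed K -> ~ K x -> K q ->
  exists p, [/\ K p, segment x q p, closure (connected_component (~` K) x) p &
    forall z, segment x p z -> z = p \/ connected_component (~` K) x z].
Proof.
move=> cK nKx Kq.
pose lam (s : R^o) := (1 - s) *: x + s *: q.
have clam : continuous lam := @continuous_affine R x q.
have lam0 : lam 0 = x by rewrite /lam subr0 scale1r scale0r addr0.
have lam1 : lam 1 = q by rewrite /lam subrr scale0r scale1r add0r.
have K1 : K (lam 1) by rewrite lam1.
have [ts tsI [Kts tsmin]] := first_hit clam cK ler01 K1.
have [ts0 ts1] : 0 <= ts /\ ts <= 1 by move: tsI; rewrite in_itv /= => /andP.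
have {}ts0 : 0 < ts.
  rewrite lt_neqAle ts0 andbT; apply: contra_notN nKx => /eqP E.
  by rewrite -lam0 E.
have lamC s : 0 <= s -> s < ts -> connected_component (~` K) x (lam s).
  move=> s0 sts; exists (lam @` `[0, s]); last by apply: path_image_in.
  split; first by exists 0; rewrite //= in_itv /= lexx.
    by move=> _ [w + <-]; rewrite /= in_itv /= => /andP[w0 ws]; apply: tsmin => //; exact: le_lt_trans sts.
  exact: path_connected.
exists (lam ts); split=> //.
- by exists ts => //; rewrite /= in_itv /= (ltW ts0).
- apply/closure_dist => f f0.
  have [d' d'0 hd'] := (cont_dist lam).1 clam ts f f0.
  pose s := Num.max 0 (ts - d' / 2).
  have s0 : 0 <= s by rewrite le_max lexx.
  have sd : ts - d' / 2 <= s by rewrite le_max lexx orbT.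
  have sts : s < ts by rewrite gt_max ts0 /=; lra.
  exists (lam s); first exact: lamC.
  by apply: hd'; rewrite ger0_norm; lra.
move=> z [t]; rewrite /= in_itv /= => /andP[t0 t1] <-.
have -> : (1 - t) *: x + t *: lam ts = lam (t * ts).
  rewrite /lam scalerDr !scalerA addrA -scalerDl; congr (_ *: _ + _); ring.
have [->|tn1] := eqVneq t 1; first by left; rewrite mul1r.
right; apply: lamC; first by rewrite mulr_ge0 // ltW.
by rewrite gtr_pMl // lt_neqAle tn1.
Qed.

(** Between the last time on [C1] and the next time on [C2] the path is off [D], hence in one
    component of the complement, which touches both sets. *)
Lemma face_between (D C1 C2 : set (plane R)) (h : R^o -> plane R) :
  closed C1 -> closed C2 -> continuous h ->
  C1 (h 0) -> C2 (h 1) -> (forall t, C1 (h t) -> C2 (h t) -> False) ->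
  (forall t, 0 <= t -> t <= 1 -> D (h t) -> C1 (h t) \/ C2 (h t)) ->
  exists x s t, let F := connected_component (~` D) x in
   [/\ ~ D x, s \in `[0, 1] /\ t \in `[0, 1], C1 (h s) /\ closure F (h s) &
       C2 (h t) /\ closure F (h t)].
Proof.
move=> c1 c2 ch h0 h1 C12 DC.
have [s sI [Cs smax]] := last_hit ch c1 ler01 h0.
have [s0 s1] : 0 <= s /\ s <= 1 by move: sI; rewrite in_itv /= => /andP.
have [t tI [Ct tmin]] := first_hit ch c2 s1 h1.
have [st t1] : s <= t /\ t <= 1 by move: tI; rewrite in_itv /= => /andP.
have {}st : s < t.
  by rewrite lt_neqAle st andbT; apply/eqP => E; apply: (C12 s) => //; rewrite E.
have nD r : s < r -> r < t -> ~ D (h r).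
  move=> sr rt Dr; have r0 : 0 <= r by lra.
  have r1 : r <= 1 by lra.
  by case: (DC r r0 r1 Dr); [apply: smax|apply: tmin => //; exact: ltW].
pose m := (s + t) / 2.
have sm : s < m by rewrite /m; lra.
have mt : m < t by rewrite /m; lra.
pose F := connected_component (~` D) (h m).
have FH r : s < r -> r < t -> F (h r).
  move=> sr rt; have sub (u v : R) : s < u -> v < t -> h @` `[u, v] `<=` ~` D.
    by move=> su vt _ [w + <-]; rewrite /= in_itv /= => /andP[uw wv]; apply: nD; lra.
  have [mr|rm] := leP m r.
    exists (h @` `[m, r]); last exact: path_image_in.
    by split; [apply: path_image_in|apply: sub|apply: path_connected].
  exists (h @` `[r, m]); last by apply: path_image_in => //; exact: ltW.
  by split; [apply: path_image_in => //; exact: ltW|apply: sub|apply: path_connected].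
exists (h m), s, t => F'; split.
- exact: nD.
- by rewrite !in_itv /= s0 s1 t1 andbT; split=> //; lra.
- split=> //; apply/closure_dist => e e0.
  have [d d0 hd] := (cont_dist h).1 ch s e e0.
  pose r := Num.min (s + d / 2) m.
  have r1 : s < r by rewrite lt_min sm andbT; lra.
  have r2 : r <= m by rewrite ge_min lexx orbT.
  have r3 : r <= s + d / 2 by rewrite ge_min lexx.
  exists (h r); first by apply: FH => //; lra.
  by apply: hd; rewrite distrC ger0_norm; lra.
- split=> //; apply/closure_dist => e e0.
  have [d d0 hd] := (cont_dist h).1 ch t e e0.
  pose r := Num.max (t - d / 2) m.
  have r1 : r < t by rewrite gt_max mt andbT; lra.
  have r2 : m <= r by rewrite le_max lexx orbT.
  have r3 : t - d / 2 <= r by rewrite le_max lexx.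
  exists (h r); first by apply: FH => //; lra.
  by apply: hd; rewrite ger0_norm; lra.
Qed.

Section Graph.
Variables (G : sgraph) (pos : G -> plane R) (curve : G -> G -> set (plane R)).
Hypothesis Hd : plane_drawing pos curve.
Let D := drawn_set pos curve.


Let on_edge u v w : adj u v -> curve u v (pos w) -> w = u \/ w = v.
Proof. by case: Hd => -[_ H _] _ _; exact: H. Qed.

Let edges_meet u v x y z : adj u v -> adj x y -> [set u; v]%SET != [set x; y]%SET ->
  curve u v z -> curve x y z ->
  exists2 w : G, w \in ([set u; v] :&: [set x; y])%SET & z = pos w.
Proof. by case: Hd => -[_ _ H] _ _ uv xy n; exact: H. Qed.

Let edge_arc u v : adj u v -> arc (pos u) (pos v) (curve u v).
Proof. by case: Hd => _ H _; exact: H. Qed.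

Let edge_sym u v : adj u v -> curve u v = curve v u.
Proof. by case: Hd => _ _ H; exact: H. Qed.

(** [X] and [E] are independent: besides induced drawings, all vertices with one edge left out and
    bundles of edges without listed vertices occur. *)
Definition subdrawing (X : pred G) (E : rel G) : set (plane R) :=
  [set z | (exists2 u, X u & z = pos u) \/
           exists u v, [/\ adj u v, E u v & curve u v z]].

Lemma subdrawing_compact X E : compact (subdrawing X E).
Proof.
rewrite (_ : subdrawing X E =
  [set z | exists2 u, u \in enum X & [set pos u] z] `|`
  [set z | exists2 e : G * G, e \in [seq e <- enum {: G * G} | adj e.1 e.2 && E e.1 e.2] &
     curve e.1 e.2 z]).
  apply: compactU; first by apply: compact_seq_union => u _; exact: compact_set1.
  apply: compact_seq_union => -[u v]; rewrite mem_filter => /andP[/andP[uv _] _].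
  exact: arc_compact (edge_arc uv).
apply/seteqP; split=> z.
  move=> [[u Xu zu]|[u [v [uv Euv cz]]]]; [left|right].
    by exists u => //; rewrite mem_enum.
  by exists (u, v) => //; rewrite mem_filter /= uv Euv mem_enum.
move=> [[u]|[[u v]]].
  by rewrite mem_enum => Xu ->; left; exists u.
by rewrite mem_filter => /andP[/andP[uv Euv] _] cz; right; exists u, v.
Qed.

Lemma drawn_setE : D = subdrawing predT (fun _ _ => true).
Proof.
apply/seteqP; split=> z.
  by move=> [[u _ <-]|[u [v [uv cz]]]]; [left; exists u|right; exists u, v].
by move=> [[u _ ->]|[u [v [uv _ cz]]]]; [left; exists u|right; exists u, v].
Qed.

Lemma drawn_compact : compact D.
Proof. by rewrite drawn_setE; exact: subdrawing_compact. Qed.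

Lemma drawn_closed : closed D.
Proof. by apply: compact_closed; [exact: plane_hausdorff|exact: drawn_compact]. Qed.

(** The drawing without the edge [uv] is a compact set that meets this edge only at its ends, which
    is the situation of [access_left]. *)
Lemma edge_touch x0 u v z : adj u v -> curve u v z -> z <> pos u -> z <> pos v ->
  closure (connected_component (~` D) x0) z ->
  accessible (connected_component (~` D) x0) (pos u).
Proof.
move=> uv cz zu zv Fz.
have [g cg [ig g0 g1 CE]] := arc_path (edge_arc uv).
pose E' : rel G := fun x y => [set u; v]%SET != [set x; y]%SET.
pose K' := subdrawing predT E'.
have cK' : compact K' := @subdrawing_compact predT E'.
have K'g r : 0 < r -> r < 1 -> ~ K' (g r).
  move=> r0 r1; have cr : curve u v (g r) by rewrite CE; apply: path_image_in; exact: ltW.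
  have I0 : (0:R) \in `[(0:R), 1] by rewrite in_itv /= lexx ler01.
  have I1 : (1:R) \in `[(0:R), 1] by rewrite in_itv /= lexx ler01.
  have Ir : r \in `[(0:R), 1] by rewrite in_itv /= !ltW.
  have npos w : g r <> pos w.
    move=> E; have := cr; rewrite E => /(on_edge uv)[] Ew.
      by move: E; rewrite Ew -g0 => /(ig _ _ Ir I0) E; move: r0; rewrite E ltxx.
    by move: E; rewrite Ew -g1 => /(ig _ _ Ir I1) E; move: r1; rewrite E ltxx.
  move=> [[w _ /npos //]|[x [y [xy Exy cxy]]]].
  by have [w _ /npos] := edges_meet uv xy Exy cr cxy.
have DE : D = K' `|` g @` `[0, 1].
  rewrite -CE drawn_setE; apply/seteqP; split=> t.
    move=> [tv|[x [y [xy _ ct]]]]; first by left; left.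
    have [E|nE] := boolP (E' x y); first by left; right; exists x, y.
    right; move: nE; rewrite negbK => /eqP E.
    have : u \in [set x; y]%SET by rewrite -E !inE eqxx.
    have : v \in [set x; y]%SET by rewrite -E !inE eqxx orbT.
    have : x != y by apply: contraTneq xy => ->; rewrite adj_irrefl.
    have uv' : u != v by apply: contraTneq uv => ->; rewrite adj_irrefl.
    rewrite !inE => xy' /orP[] /eqP Ev /orP[] /eqP Eu.
    - by move: uv'; rewrite Eu Ev eqxx.
    - by rewrite Eu Ev edge_sym // adj_sym.
    - by rewrite Eu Ev.
    - by move: uv'; rewrite Eu Ev eqxx.
  by move=> [[[w _ tw]|[x [y [xy _ ct]]]]|ct];
    [left; exists w|right; exists x, y|right; exists u, v].
have [s] : (g @` `[0, 1]) z by rewrite -CE.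
rewrite /= in_itv /= => /andP[s0 s1] gs.
have {}s0 : 0 < s by rewrite lt_neqAle s0 andbT; apply/eqP => E; apply: zu; rewrite -gs -E g0.
have {}s1 : s < 1 by rewrite lt_neqAle s1 andbT; apply/eqP => E; apply: zv; rewrite -gs E g1.
rewrite -g0 DE; apply: (access_left cK' cg ig K'g s0 s1).
by rewrite gs -DE.
Qed.

End Graph.
End Drawing.

(** Connectedness of the subgraph induced on [X], stated by cuts because a face touching both sides
    of a cut supplies exactly such an edge. *)
Definition cut_linked (G : sgraph) (X : pred G) := forall (S : {set G}) u v,
  X u -> X v -> u \in S -> v \notin S ->
  exists x y, [/\ X x, X y, x \in S, y \notin S & adj x y].

(** [G] is connected, and so are the neighbours of any vertex, even after the loss of one of them,
    as if they were arranged on a cycle around it. No drawing is mentioned, so the property derived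
    from one drawing is available in all. *)
Definition locally_linked (G : sgraph) :=
  cut_linked (G := G) predT /\
  forall c w : G, cut_linked (fun u => adj c u && (u != w)).

(** * Accessible vertices and maximality *)

Section Touching.
Variable R : realType.
Implicit Types (p q z : plane R) (A B C F K S : set (plane R)).
Variables (G : sgraph) (pos : G -> plane R) (curve : G -> G -> set (plane R)).
Hypothesis Hd : plane_drawing pos curve.
Let D := drawn_set pos curve.

Let pos_inj : injective pos. Proof. by case: Hd => -[]. Qed.

Let on_edge u v w : adj u v -> curve u v (pos w) -> w = u \/ w = v.
Proof. by case: Hd => -[_ H _] _ _; exact: H. Qed.

Let edge_sym u v : adj u v -> curve u v = curve v u.
Proof. by case: Hd => _ _ H; exact: H. Qed.


Let edges_meet u v x y z : adj u v -> adj x y -> [set u; v]%SET != [set x; y]%SET ->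
  curve u v z -> curve x y z ->
  exists2 w : G, w \in ([set u; v] :&: [set x; y])%SET & z = pos w.
Proof. by case: Hd => -[_ _ H] _ _ uv xy n; exact: H. Qed.

(** This part is closed and misses [pos c], so close to [c] only edges at [c] are seen. *)
Definition away (c : G) := subdrawing pos curve (predC1 c) (fun x y => (x != c) && (y != c)).

Lemma away_notin c : ~ away c (pos c).
Proof.
move=> [[u /= /eqP uc /pos_inj E]|[u [v [uv /andP[/eqP uc /eqP vc] /(on_edge uv)]]]].
  exact: uc.
by case=> E; [apply: uc|apply: vc].
Qed.

Lemma away_closed c : closed (away c).
Proof. by apply: compact_closed; [exact: plane_hausdorff|exact: subdrawing_compact]. Qed.

Lemma drawn_near c z : D z -> ~ away c z -> z <> pos c ->
  exists2 v, adj c v & curve c v z /\ z <> pos v.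
Proof.
move=> [[w _ <-] na nz|[x [y [xy cz]]] na nz].
  case: na; left; exists w => //=; apply/eqP => E; apply: nz; by rewrite E.
have irr (u v : G) : adj u v -> v != u.
  by move=> uv; apply: contraTneq uv => ->; rewrite adj_irrefl.
have [xc|xc] := eqVneq x c.
  exists y; first by rewrite -xc.
  split; first by rewrite -xc.
  by move=> E; apply: na; left; exists y => //=; rewrite -xc; exact: irr.
have [yc|yc] := eqVneq y c; last by case: na; right; exists x, y; rewrite xc yc.
exists x; first by rewrite -yc adj_sym.
split; first by rewrite -yc -edge_sym.
by move=> E; apply: na; left; exists x.
Qed.

(** Walk straight from a nearby point of the face to the vertex. Either nothing is met before, or
    the first obstacle is an inner point of an edge at [u], and [edge_touch] applies. *)
Lemma vertex_touch x0 u : closure (connected_component (~` D) x0) (pos u) ->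
  accessible (connected_component (~` D) x0) (pos u).
Proof.
move=> Fu; have cD : closed D := drawn_closed Hd.
have [d d0 hd] := closed_dist (@away_closed u) (@away_notin u).
have [x Fx ux] := (closure_dist _ _).1 Fu d d0.
have nDx : ~ D x := connected_component_sub Fx.
have Du : D (pos u) by left; exists u.
have [p [Dp xup Fp seg]] := hit_segment cD nDx Du.
have FE := same_connected_component Fx.
rewrite -FE in Fp seg *.
have [pu|pu] := eqVneq p (pos u).
  exists x, (segment (pos u) x); split=> //.
    by apply: segment_arc; apply: contra_notN nDx => /eqP <-.
  by rewrite segment_sym -pu => z /seg[->|h]; [right|left].
have pb : `|pos u - p| < d.
  apply: (@cvx_ball R (pos u) d x (pos u)) => //=; by rewrite subrr normr0.
have [v uv [cp pv]] := drawn_near Dp (hd _ pb) (elimN eqP pu).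
exact: (edge_touch Hd uv cp (elimN eqP pu) pv Fp).
Qed.

Lemma point_touch x0 z : D z -> closure (connected_component (~` D) x0) z ->
  exists2 u, accessible (connected_component (~` D) x0) (pos u) &
    z = pos u \/ exists2 v, adj u v & curve u v z.
Proof.
move=> [[w _ <-]|[x [y [xy cz]]]] Fz; first by exists w; [exact: vertex_touch|left].
have [zx|zx] := pselect (z = pos x).
  by exists x; [apply: vertex_touch; rewrite -zx|left].
have [zy|zy] := pselect (z = pos y).
  by exists y; [apply: vertex_touch; rewrite -zy|left].
by exists x; [exact: (edge_touch Hd xy cz zx zy Fz)|right; exists y].
Qed.

Lemma accessible_arcconn (F : set (plane R)) p q : open F -> connected F -> accessible F p -> accessible F q ->
  arcconn ((F `|` [set p]) `|` [set q]) p q.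
Proof.
move=> oF cF [x [A [pA Fx AF]]] [y [B [qB Fy BF]]].
apply: (@arcconn_trans _ _ _ x).
  split; first by left; right.
  by right; exists A => // z /AF; left.
apply: (@arcconn_trans _ _ _ y).
  by apply: (@arcconnW _ F) => [z|]; [left; left|exact: open_arcconn].
apply: arcconn_sym; split; first by right.
by right; exists B => // z /BF[]; [left; left|right].
Qed.

Lemma maximal_accessible x0 u v : maximal_plane pos curve ->
  let F := connected_component (~` D) x0 in
  accessible F (pos u) -> accessible F (pos v) -> u != v -> adj u v.
Proof.
move=> [_ M] F au av uv; apply/negPn/negP => nuv.
have oF : open F by apply: component_open; rewrite openC; exact: drawn_closed Hd.
have cF : connected F by exact: component_connected.
have [_ [E|[A uA AF]]] := accessible_arcconn oF cF au av.
  by move: uv; rewrite (pos_inj E) eqxx.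
apply: (M u v uv nuv); exists A => // z [/AF[[Fz|->]|->]] Dz; [|by left|by right].
by case: (connected_component_sub Fz).
Qed.

(** Without an edge across the cut the drawing falls into two disjoint closed parts. A segment from
    one to the other crosses a face that touches both, and maximality makes its vertices on the two
    sides adjacent. *)
Lemma maximal_linked : maximal_plane pos curve -> cut_linked (G := G) predT.
Proof.
move=> M S u v _ _ uS vS; apply: contrapT => no.
have noST x y : adj x y -> x \in S -> y \in S.
  by move=> xy xS; apply: contraPT no => yS; apply; exists x, y.
pose DS (T : {set G}) := subdrawing pos curve (mem T) (fun x _ => x \in T).
have cDS T : closed (DS T).
  by apply: compact_closed; [exact: plane_hausdorff|exact: subdrawing_compact].
have noTS x y : adj x y -> x \in ~: S -> y \in ~: S.
  by rewrite !inE => xy; apply: contra; apply: noST; rewrite adj_sym.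
have dis z : DS S z -> DS (~: S) z -> False.
  have nin x : x \in S -> x \in ~: S -> False by rewrite inE => ->.
  move=> [[x xS ->]|[x [y [xy xS cxy]]]] [[x' x'S]|[x' [y' [xy' x'S cxy']]]].
  - by move/pos_inj => E; apply: (nin x) => //; rewrite E.
  - have y'S := noTS _ _ xy' x'S.
    by case: (on_edge xy' cxy') => E; apply: (nin x); rewrite // E.
  - have yS := noST _ _ xy xS.
    move=> E; rewrite E in cxy; case: (on_edge xy cxy) => E'; apply: (nin x') => //; by rewrite E'.
  have yS := noST _ _ xy xS; have y'S := noTS _ _ xy' x'S.
  have ne : [set x; y]%SET != [set x'; y']%SET.
    apply/eqP => E; have : x \in [set x'; y']%SET by rewrite -E !inE eqxx.
    by rewrite !inE => /orP[] /eqP E'; apply: (nin x); rewrite // E'.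
  have [w + _] := edges_meet xy xy' ne cxy cxy'.
  rewrite !inE => /andP[/orP[] /eqP -> /orP[] /eqP E]; subst.
  - exact: (nin x').
  - exact: (nin y').
  - exact: (nin x').
  - exact: (nin y').
have Dcov z : D z -> DS S z \/ DS (~: S) z.
  move=> [[x _ <-]|[x [y [xy cz]]]]; have [xS|xS] := boolP (x \in S).
  - by left; left; exists x.
  - by right; left; exists x; rewrite //= inE.
  - by left; right; exists x, y.
  - by right; right; exists x, y; rewrite inE xS.
have DSD T z : DS T z -> D z.
  by move=> [[x _ ->]|[x [y [xy _ cz]]]]; [left; exists x|right; exists x, y].
pose h (t : R^o) := (1 - t) *: pos u + t *: pos v.
have ch : continuous h := @continuous_affine R (pos u) (pos v).
have h0 : DS S (h 0) by left; exists u => //; rewrite /h subr0 scale1r scale0r addr0.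
have h1 : DS (~: S) (h 1).
  by left; exists v; rewrite /= ?inE // /h subrr scale1r scale0r add0r.
have [x0 [s [t [nDx _ [Ss Fs] [Tt Ft]]]]] :=
  face_between (cDS S) (cDS (~: S)) ch h0 h1 (fun t => @dis (h t)) (fun t _ _ => @Dcov (h t)).
have pick T z : DS T z -> closure (connected_component (~` D) x0) z ->
    (forall x, x \notin T -> DS (~: T) z -> False) ->
    exists2 x, x \in T & accessible (connected_component (~` D) x0) (pos x).
  move=> Tz Fz disT; have [x ax zx] := point_touch (DSD _ _ Tz) Fz.
  exists x => //; apply: contrapT => /negP xT; apply: (disT x xT).
  by case: zx => [->|[y xy cz]]; [left; exists x; rewrite //= inE|right; exists x, y; rewrite inE xT].
have [x xS ax] := pick S _ Ss Fs (fun _ _ => dis _ Ss).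
have [|y yS ay] := pick (~: S) _ Tt Ft.
  by move=> _ _; rewrite finset.setCK => /dis; apply.
rewrite inE in yS; have xy : x != y by apply: contraTneq xS => ->.
by apply: no; exists x, y; split=> //; exact: (maximal_accessible M ax ay xy).
Qed.

Lemma star_meet c a b z : adj c a -> adj c b -> a != b -> curve c a z -> curve c b z ->
  z = pos c.
Proof.
move=> ca cb ab za zb; have ne : [set c; a]%SET != [set c; b]%SET.
  apply/eqP => E; have : a \in [set c; b]%SET by rewrite -E !inE eqxx orbT.
  rewrite !inE (negbTE ab) orbF => /eqP E'; by move: ca; rewrite E' adj_irrefl.
have [w + ->] := edges_meet ca cb ne za zb.
rewrite !inE => /andP[/orP[/eqP -> //|/eqP ->]] /orP[/eqP -> //|/eqP E].
by move: ab; rewrite E eqxx.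
Qed.

End Touching.

(** * Neighbourhoods of vertices in maximal plane graphs *)

Section Punctured.
Variable R : realType.
Implicit Types (p q z a : plane R) (A B C F K S W : set (plane R)).

(** The initial piece of the arc, run backwards from the boundary of the disc to [a], hangs at the
    rest by its first point only, so it does not cut the disc. *)
Lemma arc_end_nosep a b A (e : R) : arc a b A -> 0 < e -> e <= `|a - b| ->
  exists2 r, 0 < r & forall p q, `|a - p| < r -> `|a - q| < r -> ~ A p -> ~ A q ->
    exists W, [/\ open W, connected W, W p /\ W q, W `<=` oball a e & disj W A].
Proof.
move=> abA e0 eab; have [g cg [ig g0 g1 AE]] := arc_path abA.
have I (r : R) : 0 <= r -> r <= 1 -> r \in `[(0:R), 1] by move=> r0 r1; rewrite in_itv /= r0.
pose far := ~` oball a e.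
have cfar : closed far by apply: open_closedC; exact: oball_open.
have far1 : far (g 1) by rewrite g1 /far /oball /= => /lt_le_trans/(_ eab); rewrite ltxx.
have [t tI [tfar tmin]] := first_hit cg cfar ler01 far1.
have [t0 t1] : 0 <= t /\ t <= 1 by move: tI; rewrite in_itv /= => /andP.
have {}t0 : 0 < t.
  rewrite lt_neqAle t0 andbT; apply/eqP => E; apply: tfar.
  by rewrite -E g0 /oball /= subrr normr0.
pose K2 := sphere a e `|` g @` `[t, 1].
have cK2 : compact K2 by apply: compactU; [exact: sphere_compact|exact: path_compact].
have clK2 := compact_closed (@plane_hausdorff R) cK2.
have nK2 s : 0 <= s -> s < t -> ~ K2 (g s).
  move=> s0 st [h|[w]].
    by apply: (sphere_oball h); apply: contrapT; exact: tmin.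
  rewrite /= in_itv /= => /andP[tw w1] /ig E.
  have := E (I _ (le_trans (ltW t0) tw) w1) (I _ s0 (le_trans (ltW st) t1)) => ws.
  by move: st; rewrite -ws ltNge tw.
have [d d0 hd] := closed_dist clK2 (nK2 0 (lexx _) t0).
rewrite g0 in hd.
exists (Num.min d e); first by rewrite lt_min d0.
move=> p q; rewrite !lt_min => /andP[pd pe] /andP[qd qe] nAp nAq.
have pq := ball_component hd pd qd.
pose h (x : R^o) := g (t - x).
have ch : continuous h.
  move=> x; have c1 : {for x, continuous (fun x : R^o => t - x : R^o)}.
    by apply: cvgB; [exact: cvg_cst|exact: cvg_id].
  exact: (@continuous_comp R^o R^o (plane R) _ g x c1 (cg _)).
have hA : h @` `[0, t] `<=` A.
  move=> _ [x + <-]; rewrite /= in_itv /= => /andP[x0 xt].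
  by rewrite AE; apply: path_image_in; lra.
have ih : {in `[0, t] &, injective h}.
  move=> x y; rewrite !in_itv /= => /andP[x0 xt] /andP[y0 yt] /ig E.
  have : t - x = t - y by apply: E; apply: I; lra.
  by lra.
have Kh s : s \in `[0, t] -> K2 (h s) -> s = 0.
  rewrite in_itv /= => /andP[s0 st] Ks; apply/eqP; rewrite eq_le s0 andbT leNgt.
  by apply/negP => s0'; apply: (nK2 (t - s)) => //; lra.
have npA : ~ (h @` `[0, t]) p by move=> /hA.
have nqA : ~ (h @` `[0, t]) q by move=> /hA.
have W1 := arc_nosep cK2 ch ih (ltW t0) Kh npA nqA pq.
pose W := connected_component (~` (K2 `|` h @` `[0, t])) p.
have Wsub : W `<=` ~` (K2 `|` h @` `[0, t]) by exact: connected_component_sub.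
have Wp : W p.
  by apply: connected_component_refl; exact: (connected_component_sub (connected_component_sym W1)).
exists W; split.
- apply: component_open; rewrite openC; apply: closedU => //; exact: path_closed.
- exact: component_connected.
- by split.
- apply: (@connected_oball R W a e p) => //; first exact: component_connected.
  by move=> z /Wsub nz zs; apply: nz; left; left.
move=> z /Wsub nz; rewrite AE => -[s]; rewrite /= in_itv /= => /andP[s0 s1] gs; apply: nz.
have [st|ts] := leP s t; last by left; right; rewrite -gs; apply: path_image_in => //; exact: ltW.
by right; exists (t - s); [rewrite /= in_itv /=; lra|rewrite /h -gs; congr g; lra].
Qed.

(** A point is a degenerate arc: [arc_nosep] is applied to a constant path. *)
Lemma punctured_disc a (e : R) : 0 < e ->
  forall p q, `|a - p| < e -> `|a - q| < e -> p <> a -> q <> a ->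
    exists W, [/\ open W, connected W, W p /\ W q, W `<=` oball a e & ~ W a].
Proof.
move=> e0 p q ap aq pa qa.
pose K := sphere a e.
have clK : closed K := @sphere_closed R a e.
have KI t : t \in `[(0 : R), 0] -> K a -> t = 0.
  by rewrite in_itv /= -eq_le eq_sym => /eqP.
have hd w : `|a - w| < e -> ~ K w by move=> aw /sphere_oball; apply.
have i0 : {in `[(0:R), 0] &, injective (fun _ : R => a)}.
  by move=> x y; rewrite !in_itv /= -!eq_le => /eqP <- /eqP <-.
have nim z : z <> a -> ~ ((fun _ : R^o => a) @` `[(0:R), 0]) z.
  by move=> za [t _ E]; apply: za.
have W1 := arc_nosep (@sphere_compact R a e) (@cst_continuous R^o (plane R) a) i0 (lexx 0)
  KI (nim p pa) (nim q qa) (ball_component hd ap aq).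
set W := connected_component _ p in W1.
have Wsub : W `<=` ~` (K `|` (fun _ : R^o => a) @` `[(0:R), 0]) by exact: connected_component_sub.
exists W; split=> //.
- apply: component_open; rewrite openC; apply: closedU => //.
  exact: path_closed (@cst_continuous R^o (plane R) a).
- exact: component_connected.
- split=> //; apply: connected_component_refl.
  exact: (connected_component_sub (connected_component_sym W1)).
- apply: (@connected_oball R W a e p) => //; first exact: component_connected.
    apply: connected_component_refl.
    exact: (connected_component_sub (connected_component_sym W1)).
  by move=> z /Wsub nz zs; apply: nz; left.
by move=> /Wsub; apply; right; exists 0; rewrite //= in_itv /= lexx.
Qed.

Lemma arc_near_end a b A (r : R) : arc a b A -> 0 < r ->
  exists2 p, A p & `|a - p| < r /\ p <> a.
Proof.
move=> abA r0; have [g cg [ig g0 g1 AE]] := arc_path abA.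
have [d d0 hd] := (cont_dist g).1 cg 0 r r0.
pose s := Num.min 1 (d / 2).
have s0 : 0 < s by rewrite lt_min ltr01 /=; lra.
have s1 : s <= 1 by rewrite ge_min lexx.
have sd : s <= d / 2 by rewrite ge_min lexx orbT.
exists (g s); first by rewrite AE; apply: path_image_in => //; exact: ltW.
split; first by rewrite -g0; apply: hd; rewrite sub0r normrN gtr0_norm //; lra.
have sI : s \in `[(0:R), 1] by rewrite in_itv /= (ltW s0) s1.
have I0 : (0:R) \in `[(0:R), 1] by rewrite in_itv /= lexx ler01.
by rewrite -g0 => /(ig _ _ sI I0) E; move: s0; rewrite E ltxx.
Qed.

Variables (G : sgraph) (pos : G -> plane R) (curve : G -> G -> set (plane R)).

(** A small disc around [c] shows only edges at [c]. Deprived of [c], or of the edge to [w] if there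
    is one, it still lets a walk pass from the edge to [a0] to the edge to [b0]. The walk crosses a
    face touching edges to both sides of the cut, and their far ends are adjacent by maximality. *)
Lemma maximal_locally_linked : maximal_plane pos curve -> locally_linked G.
Proof.
move=> M; have Hd := M.1; split; first exact: (maximal_linked Hd M).
have edge_sym u v : adj u v -> curve u v = curve v u by case: Hd => _ _ H; exact: H.
have edge_arc u v : adj u v -> arc (pos u) (pos v) (curve u v) by case: Hd => _ H _; exact: H.
move=> c w S a0 b0 /andP[ca0 a0w] /andP[cb0 b0w] a0S b0S.
have irr v : adj c v -> v != c.
  by move=> cv; apply: contraTneq cv => ->; rewrite adj_irrefl.
have [e e0 he] := closed_dist (away_closed Hd (c := c)) (away_notin Hd (c := c)).
have pos_far v : v != c -> e <= `|pos c - pos v|.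
  by move=> vc; rewrite leNgt; apply/negP => /he; apply; left; exists v.
have [r r0 hr] : exists2 r, 0 < r & forall p q, `|pos c - p| < r -> `|pos c - q| < r ->
    p <> pos c -> q <> pos c -> (adj c w -> ~ curve c w p /\ ~ curve c w q) ->
    exists W, [/\ open W, connected W, W p /\ W q, W `<=` oball (pos c) e &
      ~ W (pos c) /\ (adj c w -> disj W (curve c w))].
  have [cw|ncw] := boolP (adj c w).
    have [r r0 hr] := arc_end_nosep (edge_arc _ _ cw) e0 (pos_far _ (irr _ cw)).
    exists r => // p q cp cq _ _ /(_ isT)[np nq].
    have [W [oW cW Wpq We dW]] := hr p q cp cq np nq; exists W; split=> //.
    by split=> // /dW; apply; apply: arc_l (edge_arc _ _ cw).
  exists e => // p q cp cq np nq _.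
  by have [W [oW cW Wpq We dW]] := punctured_disc e0 cp cq np nq; exists W.
have [p ca0p [cp pc]] := arc_near_end (edge_arc _ _ ca0) r0.
have [q cb0q [cq qc]] := arc_near_end (edge_arc _ _ cb0) r0.
have [|W [oW cW [Wp Wq] We [nWc dW]]] := hr p q cp cq pc qc.
  move=> cw; split=> h; [apply: pc|apply: qc].
    exact: (star_meet Hd ca0 cw a0w).
  exact: (star_meet Hd cb0 cw b0w).
pose E (T : {set G}) := subdrawing pos curve pred0
  (fun x y => [&& x == c, y \in T & y != w]).
have cE T : closed (E T).
  by apply: compact_closed; [exact: plane_hausdorff|exact: subdrawing_compact].
have EP T z : E T z -> exists v, [/\ adj c v, v \in T, v != w & curve c v z].
  move=> [[]//|[x [v [cv /and3P[/eqP xc vT vw] cz]]]]; rewrite xc in cv cz.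
  by exists v.
have [f [cf f0 f1 fW]] := arcconn_clamped (open_arcconn oW cW Wp Wq).
have dis z : W z -> E S z -> E (~: S) z -> False.
  move=> Wz /EP[a [ca aS aw az]] /EP[b [cb bS bw bz]]; apply: nWc.
  rewrite -(star_meet Hd ca cb _ az bz) //; apply: contraTneq bS => <-.
  by rewrite inE aS.
have cov z : W z -> drawn_set pos curve z -> E S z \/ E (~: S) z.
  move=> Wz Dz; have zc : z <> pos c by move=> zc; apply: nWc; rewrite -zc.
  have [v cv [cz _]] := drawn_near Hd Dz (he _ (We _ Wz)) zc.
  have vw : v != w.
    by apply/eqP => vw; rewrite vw in cv cz; exact: (dW cv z).
  have [vS|vS] := boolP (v \in S); [left|right]; right; exists c, v; split=> //;
    by rewrite eqxx ?inE vS.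
have f00 : E S (f 0) by rewrite f0 //; right; exists c, a0; rewrite eqxx a0S a0w.
have f11 : E (~: S) (f 1) by rewrite f1 //; right; exists c, b0; rewrite eqxx inE b0S b0w.
have [x0 [s [t [nDx _ [Es Fs] [Et Ft]]]]] :=
  face_between (cE S) (cE (~: S)) cf f00 f11 (fun t => @dis (f t) (fW t))
    (fun t _ _ => @cov (f t) (fW t)).
have acc v z : adj c v -> curve c v z -> W z ->
    closure (connected_component (~` drawn_set pos curve) x0) z ->
    accessible (connected_component (~` drawn_set pos curve) x0) (pos v).
  move=> cv cz Wz Fz; have zc : z <> pos c by move=> zc; apply: nWc; rewrite -zc.
  apply: (edge_touch (v := c) (z := z) Hd) => //; first by rewrite adj_sym.
    by rewrite -edge_sym.
  move=> zv; have := We _ Wz; rewrite /oball /= zv ltNge => /negP; apply.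
  exact/pos_far/irr.
have [a [ca aS aw az]] := EP _ _ Es; have [b [cb bS bw bz]] := EP _ _ Et.
rewrite inE in bS; have ab : a != b by apply: contraTneq aS => ->.
exists a, b; rewrite ca cb aw bw; split=> //.
exact: (maximal_accessible Hd M (acc a _ ca az (fW s) Fs) (acc b _ cb bz (fW t) Ft)).
Qed.

End Punctured.

(** * Vertices on a common face *)

Section FaceVertices.
Variable R : realType.
Implicit Types (p q z : plane R) (A B C F S : set (plane R)).
Variables (G : sgraph) (pos : G -> plane R) (curve : G -> G -> set (plane R)).
Implicit Types (X Y : pred G).
Hypothesis Hd : plane_drawing pos curve.
Let D := drawn_set pos curve.

Let pos_inj : injective pos. Proof. by case: Hd => -[]. Qed.

Let on_edge u v w : adj u v -> curve u v (pos w) -> w = u \/ w = v.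
Proof. by case: Hd => -[_ H _] _ _; exact: H. Qed.

Let edge_arc u v : adj u v -> arc (pos u) (pos v) (curve u v).
Proof. by case: Hd => _ H _; exact: H. Qed.

Let edges_meet u v x y z : adj u v -> adj x y -> [set u; v]%SET != [set x; y]%SET ->
  curve u v z -> curve x y z ->
  exists2 w : G, w \in ([set u; v] :&: [set x; y])%SET & z = pos w.
Proof. by case: Hd => -[_ _ H] _ _ uv xy n; exact: H. Qed.

Definition indraw (X : pred G) := subdrawing pos curve X (fun x y => X x && X y).

Lemma indraw_drawn X z : indraw X z -> D z.
Proof.
by move=> [[x _ ->]|[x [y [xy _ cz]]]]; [left; exists x|right; exists x, y].
Qed.

Lemma indraw_pos X x : X x -> indraw X (pos x).
Proof. by move=> Xx; left; exists x. Qed.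

Lemma indraw_posE X x : indraw X (pos x) -> X x.
Proof.
move=> [[y Xy /pos_inj -> //]|[a [b [ab /andP[Xa Xb] /(on_edge ab)]]]].
by case=> ->.
Qed.

Lemma indraw_disj X Y : (forall x, X x -> ~~ Y x) -> disj (indraw X) (indraw Y).
Proof.
move=> XY z [[x Xx ->] /indraw_posE Yx|[x [y [xy /andP[Xx Xy] cxy]]]].
  by case/negP: (XY x Xx).
move=> [[w Yw zw]|[a [b [ab /andP[Ya Yb] cab]]]].
  move: cxy; rewrite zw => /(on_edge xy)[] wE; subst w.
    by case/negP: (XY x Xx).
  by case/negP: (XY y Xy).
have ne : [set x; y]%SET != [set a; b]%SET.
  apply/eqP => E; have : x \in [set a; b]%SET by rewrite -E !inE eqxx.
  by rewrite !inE => /orP[] /eqP xE; subst x; case/negP: (XY _ Xx).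
have [w + _] := edges_meet xy ab ne cxy cab.
rewrite !inE => /andP[w1 w2].
have Xw : X w by case/orP: w1 => /eqP ->.
by case/negP: (XY w Xw); case/orP: w2 => /eqP ->.
Qed.

Lemma indraw_edge X x y : adj x y -> X x -> X y -> arcconn (indraw X) (pos x) (pos y).
Proof.
move=> xy Xx Xy; split; first exact: indraw_pos.
right; exists (curve x y); first exact: edge_arc.
by move=> z cz; right; exists x, y; split=> //; rewrite Xx.
Qed.

Lemma indraw_cut X x y : cut_linked X -> X x -> X y -> arcconn (indraw X) (pos x) (pos y).
Proof.
move=> cX Xx Xy; pose S := [set z | `[< arcconn (indraw X) (pos x) (pos z) >]]%SET.
have [|yS] := boolP (y \in S); first by rewrite inE => /asboolP.
have xS : x \in S by rewrite inE; apply/asboolP/arcconn_refl/indraw_pos.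
have [a [b [Xa Xb aS bS ab]]] := cX S x y Xx Xy xS yS.
case/negP: bS; rewrite inE; apply/asboolP.
rewrite inE in aS; move/asboolP: aS => aS; apply: (arcconn_trans aS).
exact: indraw_edge.
Qed.

Lemma indraw_connect X (e : rel G) x y : (forall a b, e a b -> [/\ adj a b, X a & X b]) ->
  X x -> connect e x y -> arcconn (indraw X) (pos x) (pos y).
Proof.
move=> eX Xx /connectP[p]; elim: p x Xx => [x Xx _ ->|z p IH x Xx /= /andP[xz pth] yE].
  exact/arcconn_refl/indraw_pos.
have [axz _ Xz] := eX _ _ xz.
by apply: (arcconn_trans (indraw_edge axz Xx Xz)); exact: IH.
Qed.

Lemma indrawW X Y : (forall x, X x -> Y x) -> indraw X `<=` indraw Y.
Proof.
move=> XY z [[x /XY Yx ->]|[x [y [xy /andP[/XY Yx /XY Yy] cz]]]]; first by left; exists x.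
by right; exists x, y; split=> //; rewrite Yx.
Qed.

Hypothesis HQ : locally_linked G.

Section OneFace.
Variable x0 : plane R.
Let F := connected_component (~` D) x0.

Let oF : open F. Proof. by apply: component_open; rewrite openC; exact: drawn_closed Hd. Qed.
Let cF : connected F. Proof. exact: component_connected. Qed.

Lemma face_indraw_disj X (T : set (plane R)) :
  (forall z, T z -> F z \/ exists2 u, z = pos u & ~~ X u) -> disj T (indraw X).
Proof.
move=> TF z /TF[Fz|[u -> Xu] /indraw_posE]; last by move/negP: Xu.
by move=> /indraw_drawn Dz; case: (connected_component_sub Fz).
Qed.

(* If [u] and [v] were not adjacent, joining them through the face would give a
   [K5] on [u], [v] and three neighbours of [u] at which the component of [v]
   in the graph without [u] and its neighbours is attached. *)
Lemma accessible_adj u v : accessible F (pos u) -> accessible F (pos v) ->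
  u != v -> adj u v.
Proof.
move=> au av uv; apply/negPn/negP => nuv; have [Q0 Q1] := HQ.
pose Z x := (x != u) && ~~ adj u x.
pose e : rel G := fun x y => [&& adj x y, Z x & Z y].
have Zv : Z v by rewrite /Z eq_sym uv.
pose K x := connect e v x.
have KZ x : K x -> Z x.
  move=> /connectP[p + ->]; elim/last_ind: p => [//|p y _].
  by rewrite rcons_path last_rcons => /andP[_ /and3P[]].
have Kstep x y : K x -> adj x y -> Z y -> K y.
  by move=> Kx xy Zy; apply: (connect_trans Kx); apply: connect1; rewrite /e xy Zy KZ.
have Kv : K v by exact: connect0.
have nKu : ~~ K u by apply/negP => /KZ; rewrite /Z eqxx.
have nKadj r : adj u r -> ~~ K r by move=> ur; apply/negP => /KZ /andP[_]; rewrite ur.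
pose Att r := adj u r /\ exists2 x, K x & adj x r.
pose SK := [set x | K x]%SET.
have inSK x : (x \in SK) = K x by rewrite /SK inE.
have out x y : K x -> ~~ K y -> adj x y -> Att y.
  move=> Kx nKy xy; have nZy : ~~ Z y by apply: contra nKy; exact: Kstep xy.
  move: nZy; rewrite /Z negb_and negbK => /orP[/eqP yu|].
    by case/andP: (KZ _ Kx) => _; rewrite adj_sym -yu xy.
  by rewrite negbK => uy; split=> //; exists x.
have [r1 A1] : exists r1, Att r1.
  have [||x [y [_ _]]] := Q0 SK v u isT isT; rewrite ?inSK //.
  by move=> Kx nKy xy; exists y; exact: out xy.
have step s1 s2 : Att s1 -> adj u s2 -> exists r, [/\ Att r, r != s1 & r != s2].
  move=> [us1 [x Kx xs1]] us2.
  have xs2 : x != s2 by apply: contraTneq Kx => ->; exact: nKadj.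
  have us2' : u != s2 by apply: contraTneq us2 => <-; rewrite adj_irrefl.
  (* Among the neighbours of [s1] other than [s2], the set [K] separates [x] from [u]; an edge
     across this cut leads from [K] to a new attachment. *)
  have [|||| a [b [_ /andP[s1b bs2]]]] := Q1 s1 s2 SK x u.
  - by rewrite adj_sym xs1.
  - by rewrite adj_sym us1.
  - by rewrite inSK.
  - by rewrite inSK.
  rewrite !inSK => Ka nKb ab; exists b; split=> //; first exact: out ab.
  by apply: contraTneq s1b => ->; rewrite adj_irrefl.
have [r2 [A2 r21 _]] := step r1 r1 A1 A1.1.
have [r3 [A3 r31 r32]] := step r1 r2 A1 A2.1.
(* Two of the three attachments are joined among the neighbours of [u] without the third, hence away
   from the connections that end at the third. *)
pose Nb r := fun x => adj u x && (x != r).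
have CN r x y : adj u x -> adj u y -> x != r -> y != r ->
    arcconn (indraw (Nb r)) (pos x) (pos y).
  move=> ux uy xr yr; apply: indraw_cut; rewrite /Nb ?ux ?uy //; exact: Q1.
have CK r : Att r -> arcconn (indraw (fun x => K x || (x == r))) (pos v) (pos r).
  move=> [_ [x Kx xr]]; apply: (@arcconn_trans _ _ _ (pos x)); last first.
    by apply: indraw_edge; rewrite ?Kx ?eqxx ?orbT.
  have H : arcconn (indraw K) (pos v) (pos x).
    have EK a b : e a b -> K a -> K b by move=> /and3P[ab _ Zb] Ka; exact: Kstep ab Zb.
    move: Kx; rewrite {1}/K => /connectP[p]; elim/last_ind: p x {xr} => [x _ ->|p y IH x].
      exact/arcconn_refl/indraw_pos.
    rewrite rcons_path last_rcons => /andP[pth ey ->].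
    have Kl : K (last v p) by apply/connectP; exists p.
    apply: (arcconn_trans (IH _ pth erefl)).
    by apply: indraw_edge; [case/and3P: ey|exact: Kl|exact: EK ey Kl].
  by apply: arcconnW H; apply: indrawW => z ->.
have CU r : adj u r -> arcconn (indraw (pred2 u r)) (pos u) (pos r).
  by move=> ur; apply: indraw_edge; rewrite /= ?eqxx ?orbT.
have Dface r : disj ((F `|` [set pos u]) `|` [set pos v]) (indraw (Nb r)).
  apply: face_indraw_disj => z [[Fz|->]|->]; [by left|right|right].
    by exists u; rewrite // /Nb adj_irrefl.
  by exists v; rewrite // /Nb (negbTE nuv).
have DUK r r' : r != r' -> adj u r -> adj u r' ->
    disj (indraw (pred2 u r)) (indraw (fun x => K x || (x == r'))).
  move=> rr ur ur'; apply: indraw_disj => x /orP[] /eqP ->; rewrite negb_or.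
    by rewrite nKu; apply: contraTneq ur' => <-; rewrite adj_irrefl.
  by rewrite nKadj.
have DUN r : adj u r -> disj (indraw (pred2 u r)) (indraw (Nb r)).
  move=> ur; apply: indraw_disj => x /orP[] /eqP ->; rewrite /Nb ?adj_irrefl //.
  by rewrite eqxx andbF.
have DKN r : disj (indraw (fun x => K x || (x == r))) (indraw (Nb r)).
  apply: indraw_disj => x /orP[Kx|/eqP ->]; rewrite /Nb negb_and.
    by apply/orP; left; apply: contraL Kx; exact: nKadj.
  by rewrite eqxx orbT.
have [u1 u2 u3] : [/\ adj u r1, adj u r2 & adj u r3] by case: A1 A2 A3 => ? _ [? _] [? _].
have r12 : r1 != r2 by rewrite eq_sym.
have r13 : r1 != r3 by rewrite eq_sym.
have r23 : r2 != r3 by rewrite eq_sym.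
exact: (K5_sets (accessible_arcconn oF cF au av) (CU _ u1) (CU _ u2) (CU _ u3)
  (CK _ A1) (CK _ A2) (CK _ A3) (CN r3 _ _ u1 u2 r13 r23) (CN r2 _ _ u1 u3 r12 r32)
  (CN r1 _ _ u2 u3 r21 r31)
  (Dface _) (DUK _ _ r12 u1 u2) (DUK _ _ r21 u2 u1)
  (Dface _) (DUK _ _ r13 u1 u3) (DUK _ _ r31 u3 u1)
  (Dface _) (DUK _ _ r23 u2 u3) (DUK _ _ r32 u3 u2)
  (DUN _ u1) (DUN _ u2) (DUN _ u3) (DKN _) (DKN _) (DKN _)).
Qed.

(** The four vertices are pairwise adjacent, and a point of the face, joined to each of them inside
    the face, is the fifth vertex of a [K5]. *)
Lemma accessible_le3 a b c d : uniq [:: a; b; c; d] ->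
  accessible F (pos a) -> accessible F (pos b) -> accessible F (pos c) ->
  accessible F (pos d) -> False.
Proof.
rewrite /= !inE !negb_or !andbT => /and3P[/and3P[ab ac ad] /andP[bc bd] cd] Aa Ab Ac Ad.
have [z [A0 [_ Fz _]]] := Aa.
have toz u : accessible F (pos u) -> arcconn (F `|` [set pos u]) (pos u) z.
  move=> [y [A [uA Fy AF]]]; apply: (@arcconn_trans _ _ _ y).
    by split; [right|right; exists A].
  by apply: (@arcconnW _ F) => [w|]; [left|exact: open_arcconn].
have E u v : accessible F (pos u) -> accessible F (pos v) -> u != v ->
    arcconn (indraw (pred2 u v)) (pos u) (pos v).
  move=> Au Av uv; apply: indraw_edge; rewrite /= ?eqxx ?orbT //.
  exact: accessible_adj.
have DD u v x y : u != x -> u != y -> v != x -> v != y ->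
    disj (indraw (pred2 u v)) (indraw (pred2 x y)).
  move=> ux uy vx vy; apply: indraw_disj => w /orP[] /eqP ->;
    by rewrite /= negb_or ?ux ?uy ?vx ?vy.
have DF u v w : w != u -> w != v -> disj (indraw (pred2 u v)) (F `|` [set pos w]).
  move=> wu wv t /[swap]; apply: (face_indraw_disj (T := F `|` [set pos w])).
  by move=> s [Fs|->]; [left|right; exists w; rewrite //= negb_or wu].
have DF' u v w : w != u -> w != v -> disj (F `|` [set pos w]) (indraw (pred2 u v)).
  by move=> wu wv t Ft /(DF _ _ _ wu wv); apply.
have ba : b != a by rewrite eq_sym.
have ca : c != a by rewrite eq_sym.
have da : d != a by rewrite eq_sym.
have cb : c != b by rewrite eq_sym.
have db : d != b by rewrite eq_sym.
have dc : d != c by rewrite eq_sym.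
apply: (K5_sets (E _ _ Aa Ab ab) (E _ _ Aa Ac ac) (E _ _ Aa Ad ad) (toz _ Aa)
  (E _ _ Ab Ac bc) (E _ _ Ab Ad bd) (toz _ Ab) (E _ _ Ac Ad cd) (toz _ Ac) (toz _ Ad));
  by [exact: DD|exact: DF|exact: DF'].
Qed.

End OneFace.
End FaceVertices.

(** * Straight drawings *)

Section Triangles.
Variable R : realType.
Implicit Types (p q r x y z o : plane R) (A B C F K S : set (plane R)).

(** Twice the signed area of the triangle, positive in counterclockwise order. *)
Definition orient p q r : R := (q.1 - p.1) * (r.2 - p.2) - (q.2 - p.2) * (r.1 - p.1).

Lemma comb1 t x y : ((1 - t) *: x + t *: y).1 = (1 - t) * x.1 + t * y.1.
Proof. by []. Qed.

Lemma comb2 t x y : ((1 - t) *: x + t *: y).2 = (1 - t) * x.2 + t * y.2.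
Proof. by []. Qed.

Lemma plane_eq x y : x.1 = y.1 -> x.2 = y.2 -> x = y.
Proof. by case: x y => [a b] [c d] /= -> ->. Qed.

Lemma orient_comb p q t x y :
  orient p q ((1 - t) *: x + t *: y) = (1 - t) * orient p q x + t * orient p q y.
Proof. rewrite /orient comb1 comb2; ring. Qed.

Lemma orient_rot p q r : orient p q r = orient q r p.
Proof. rewrite /orient; ring. Qed.

Lemma orient_swap p q r : orient p r q = - orient p q r.
Proof. rewrite /orient; ring. Qed.

Lemma continuous_orient p q : continuous (orient p q : plane R -> R^o).
Proof.
move=> z; have c1 : {for z, continuous (fun z : plane R => z.1 : R^o)} by exact: cvg_fst.
have c2 : {for z, continuous (fun z : plane R => z.2 : R^o)} by exact: cvg_snd.
apply: cvgB; (apply: cvgM; first exact: cvg_cst); (apply: cvgB; last exact: cvg_cst).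
  exact: c2.
exact: c1.
Qed.

Lemma cvx_orient_ge p q : cvx [set z | 0 <= orient p q z].
Proof.
move=> x y /= px py _ [t + <-]; rewrite /= in_itv /= => /andP[t0 t1].
by rewrite orient_comb addr_ge0 // mulr_ge0 // subr_ge0.
Qed.

Lemma cvx_orient_gt p q : cvx [set z | 0 < orient p q z].
Proof.
move=> x y /= px py _ [t + <-]; rewrite /= in_itv /= => /andP[t0 t1].
rewrite orient_comb; have [->|tn0] := eqVneq t 0; first by rewrite subr0 mul1r mul0r addr0.
have h1 : 0 <= (1 - t) * orient p q x by apply: mulr_ge0; [rewrite subr_ge0|exact: ltW].
have h2 : 0 < t * orient p q y by apply: mulr_gt0 => //; rewrite lt_neqAle eq_sym tn0 t0.
lra.
Qed.

Lemma cvx_orient_le p q : cvx [set z | orient p q z <= 0].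
Proof.
have -> : [set z | orient p q z <= 0] = [set z | 0 <= orient q p z].
  by apply/seteqP; split=> z /=; rewrite (_ : orient q p z = - orient p q z) ?oppr_ge0 // /orient; ring.
exact: cvx_orient_ge.
Qed.

Lemma cvxI A B : cvx A -> cvx B -> cvx (A `&` B).
Proof.
by move=> cA cB x y [Ax Bx] [Ay By] z xyz; split; [exact: cA xyz|exact: cB xyz].
Qed.

(** The closed triangle for vertices in counterclockwise order; in clockwise order the set is empty,
    as the three values add up to [orient p q r]. *)
Definition tri p q r := [set z | 0 <= orient p q z] `&`
  ([set z | 0 <= orient q r z] `&` [set z | 0 <= orient r p z]).
Definition tri_int p q r := [set z | 0 < orient p q z] `&`
  ([set z | 0 < orient q r z] `&` [set z | 0 < orient r p z]).
Definition tri_edges p q r := segment p q `|` (segment q r `|` segment r p).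

Lemma cvx_tri p q r : cvx (tri p q r).
Proof. by apply: cvxI; [|apply: cvxI]; exact: cvx_orient_ge. Qed.

Lemma cvx_tri_int p q r : cvx (tri_int p q r).
Proof. by apply: cvxI; [|apply: cvxI]; exact: cvx_orient_gt. Qed.

Lemma tri_closed p q r : closed (tri p q r).
Proof.
have H a b : closed [set z | 0 <= orient a b z].
  have -> : [set z | 0 <= orient a b z] = orient a b @^-1` [set s | 0 <= s] by [].
  by apply: (@preimage_closed (plane R) R^o) => [z _|]; [exact: continuous_orient|exact: closed_ge].
by apply: closedI => //; apply: closedI.
Qed.

Lemma tri_int_open p q r : open (tri_int p q r).
Proof.
have H a b : open [set z | 0 < orient a b z].
  have -> : [set z | 0 < orient a b z] = orient a b @^-1` [set s | 0 < s] by [].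
  by apply: (@open_comp (plane R) R^o) => [z _|]; [exact: continuous_orient|exact: open_gt].
by apply: openI => //; apply: openI.
Qed.

Lemma tri_p p q r : 0 < orient p q r -> tri p q r p.
Proof.
move=> h; have E a : orient p a p = 0 by rewrite /orient; ring.
have E' a : orient a p p = 0 by rewrite /orient; ring.
by split; [|split]; rewrite /= ?E ?E' // -orient_rot ltW.
Qed.

Lemma tri_rot p q r : tri p q r = tri q r p.
Proof.
apply/seteqP; split=> z [a [b c]]; first by split=> //; split.
by split=> //; split.
Qed.

Lemma tri_vertices p q r : 0 < orient p q r ->
  [/\ tri p q r p, tri p q r q & tri p q r r].
Proof.
move=> h; split; first exact: tri_p.
  by rewrite tri_rot; apply: tri_p; rewrite -orient_rot.
by rewrite tri_rot tri_rot; apply: tri_p; rewrite -orient_rot -orient_rot.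
Qed.

Lemma tri_edges_sub p q r : 0 < orient p q r -> tri_edges p q r `<=` tri p q r.
Proof.
move=> /tri_vertices[P Q S] z [|[|]]; exact: cvx_tri.
Qed.

Lemma orient_seg p q z : segment p q z -> orient p q z = 0.
Proof. by move=> [t _ <-]; rewrite orient_comb /orient; ring. Qed.

Lemma tri_int_edges p q r z : tri_int p q r z -> tri_edges p q r z -> False.
Proof.
by move=> [a [b c]] [/orient_seg E|[/orient_seg E|/orient_seg E]];
  [move: a|move: b|move: c]; rewrite /= E ltxx.
Qed.

Lemma barycentric1 p q r z : orient p q r * z.1 =
  orient q r z * p.1 + orient r p z * q.1 + orient p q z * r.1.
Proof. rewrite /orient; ring. Qed.

Lemma barycentric2 p q r z : orient p q r * z.2 =
  orient q r z * p.2 + orient r p z * q.2 + orient p q z * r.2.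
Proof. rewrite /orient; ring. Qed.

Lemma seg_of_orient p q r z : 0 < orient p q r -> orient p q z = 0 ->
  0 <= orient q r z -> 0 <= orient r p z -> segment p q z.
Proof.
move=> h h1 h2 h3; have S : orient p q z + orient q r z + orient r p z = orient p q r.
  rewrite /orient; ring.
have h0 := lt0r_neq0 h.
exists (orient r p z / orient p q r).
  rewrite /= in_itv /= divr_ge0 ?(ltW h) //= ler_pdivrMr // mul1r; lra.
have E : 1 - orient r p z / orient p q r = orient q r z / orient p q r.
  apply: (mulIf h0); rewrite mulrBl mul1r !divfK //; lra.
have B1 := barycentric1 p q r z; have B2 := barycentric2 p q r z.
rewrite h1 mul0r addr0 in B1; rewrite h1 mul0r addr0 in B2.
apply: plane_eq; rewrite ?comb1 ?comb2 E; apply: (mulfI h0); rewrite ?B1 ?B2; field; exact: h0.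
Qed.

Lemma tri_cases p q r z : 0 < orient p q r -> tri p q r z ->
  tri_int p q r z \/ tri_edges p q r z.
Proof.
move=> h [/= a [/= b c]].
have hq : 0 < orient q r p by rewrite -orient_rot.
have hr : 0 < orient r p q by rewrite -orient_rot -orient_rot.
move: a; rewrite le_eqVlt => /orP[/eqP E|a].
  by right; left; apply: (seg_of_orient h).
move: b; rewrite le_eqVlt => /orP[/eqP E|b].
  by right; right; left; apply: (seg_of_orient hq) => //; exact: ltW.
move: c; rewrite le_eqVlt => /orP[/eqP E|c]; last by left.
by right; right; right; apply: (seg_of_orient hr) => //; exact: ltW.
Qed.

Lemma collinear_between p q r : orient p q r = 0 ->
  [\/ segment q r p, segment p r q | segment p q r].
Proof.
have [->|pq] := eqVneq p q; first by move=> _; constructor 1; exact: segment_l.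
move=> h.
have [t [e1 e2]] : exists t, r.1 = p.1 + t * (q.1 - p.1) /\ r.2 = p.2 + t * (q.2 - p.2).
  have [n1|n1] := eqVneq (q.1 - p.1) 0.
    have n2 : q.2 - p.2 != 0.
      apply: contra pq => /eqP n2; apply/eqP/plane_eq; apply/eqP; rewrite eq_sym -subr_eq0; exact/eqP.
    exists ((r.2 - p.2) / (q.2 - p.2)); rewrite divfK // n1 mulr0; split; last by rewrite subrKC.
    move: h; rewrite /orient n1 mul0r sub0r => /eqP; rewrite oppr_eq0 mulf_eq0 (negbTE n2) /=.
    by rewrite subr_eq0 => /eqP ->; rewrite addr0.
  exists ((r.1 - p.1) / (q.1 - p.1)); rewrite divfK //; split; first by rewrite subrKC.
  apply: (mulfI n1); move: h; rewrite /orient => h.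
  have -> : (q.1 - p.1) * (p.2 + (r.1 - p.1) / (q.1 - p.1) * (q.2 - p.2)) =
    (q.1 - p.1) * p.2 + (r.1 - p.1) * (q.2 - p.2) by field.
  lra.
have [t0|t0] := ltP t 0.
  constructor 1; exists (1 / (1 - t)).
    rewrite /= in_itv /= divr_ge0 ?ler_pdivrMr //=; lra.
  apply: plane_eq; rewrite ?comb1 ?comb2 ?e1 ?e2; field; lra.
have [t1|t1] := leP t 1.
  constructor 3; exists t; first by rewrite /= in_itv /= t0.
  apply: plane_eq; rewrite ?comb1 ?comb2 ?e1 ?e2; ring.
constructor 2; exists (1 / t).
  rewrite /= in_itv /= divr_ge0 ?ler_pdivrMr //=; lra.
apply: plane_eq; rewrite ?comb1 ?comb2 ?e1 ?e2; field; lra.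
Qed.

Lemma tri_bounded p q r : 0 < orient p q r ->
  forall z, tri p q r z -> `|z| <= `|p| + `|q| + `|r|.
Proof.
move=> h z [/= a [/= b c]]; have h0 := lt0r_neq0 h.
have S : orient p q z + orient q r z + orient r p z = orient p q r by rewrite /orient; ring.
have -> : z = (orient q r z / orient p q r) *: p + ((orient r p z / orient p q r) *: q +
   (orient p q z / orient p q r) *: r).
  have E1 (u v w : R) x' y' z' : (u *: x' + (v *: y' + w *: z') : plane R).1 =
    u * x'.1 + (v * y'.1 + w * z'.1) by [].
  have E2 (u v w : R) x' y' z' : (u *: x' + (v *: y' + w *: z') : plane R).2 =
    u * x'.2 + (v * y'.2 + w * z'.2) by [].
  apply: plane_eq; rewrite ?E1 ?E2; apply: (mulfI h0);
    rewrite ?(barycentric1 p q r z) ?(barycentric2 p q r z); field; exact: h0.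
have le1 u x' : 0 <= u -> u <= orient p q r -> `|(u / orient p q r) *: x'| <= `|x'|.
  move=> u0 u1; rewrite normrZ ger0_norm ?divr_ge0 ?(ltW h) //.
  by rewrite ler_piMl // ler_pdivrMr // mul1r.
apply: (le_trans (ler_normD _ _)); rewrite -addrA; apply: lerD; first by apply: le1 => //; lra.
by apply: (le_trans (ler_normD _ _)); apply: lerD; apply: le1 => //; lra.
Qed.

(** From a point off [K] the ray pointing away from [o] stays off [K] by convexity and reaches the
    far region, which is connected. *)
Lemma cvx_compl_connected K o M : cvx K -> K o -> (forall z, K z -> `|z| <= M) ->
  connected (~` K).
Proof.
move=> cK Ko KM; pose M' := Num.max M 0.
have M0 : 0 <= M' by rewrite le_max lexx orbT.
have KM' z : K z -> `|z| <= M' by move=> /KM h; rewrite le_max h.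
pose far := [set z : plane R | M' < `|z|].
have farK : far `<=` ~` K by move=> z /= h /KM'; rewrite leNgt h.
pose ray x := [set z | exists2 t, 0 <= t & z = x + t *: (x - o)].
have cray x : cvx (ray x).
  move=> _ _ [t t0 ->] [s s0 ->] _ [u + <-]; rewrite /= in_itv /= => /andP[u0 u1].
  exists ((1 - u) * t + u * s); first by rewrite addr_ge0 // mulr_ge0 // subr_ge0.
  have E1 (a b : plane R) : (a + b).1 = a.1 + b.1 by [].
  have E2 (a b : plane R) : (a + b).2 = a.2 + b.2 by [].
  have F1 (a : R) (b : plane R) : (a *: b).1 = a * b.1 by [].
  have F2 (a : R) (b : plane R) : (a *: b).2 = a * b.2 by [].
  by apply: plane_eq; rewrite ?E1 ?E2 ?F1 ?F2; rewrite ?E1 ?E2 ?F1 ?F2; ring.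
have rayK x : ~ K x -> ray x `<=` ~` K.
  move=> Kx _ [t t0 ->] Kz; apply: Kx; apply: (cK _ _ Ko Kz).
  have t1 : 1 + t != 0 by lra.
  exists (1 / (1 + t)); first by rewrite /= in_itv /= divr_ge0 ?ler_pdivrMr //=; lra.
  have E1 (a b : plane R) : (a + b).1 = a.1 + b.1 by [].
  have E2 (a b : plane R) : (a + b).2 = a.2 + b.2 by [].
  have F1 (a : R) (b : plane R) : (a *: b).1 = a * b.1 by [].
  have F2 (a : R) (b : plane R) : (a *: b).2 = a * b.2 by [].
  have G1 (a b : plane R) : (a - b).1 = a.1 - b.1 by [].
  have G2 (a b : plane R) : (a - b).2 = a.2 - b.2 by [].
  by apply: plane_eq; rewrite ?comb1 ?comb2 ?E1 ?E2 ?F1 ?F2 ?G1 ?G2; field; lra.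
have farne : far ((M' + 1, 0) : plane R).
  rewrite /far /= normpE lt_max /= ger0_norm; lra.
have -> : ~` K = \bigcup_(x in ~` K) (ray x `|` far).
  apply/seteqP; split=> z; last by move=> [x Kx [/(rayK _ Kx)|/farK]].
  by move=> Kz; exists z => //; left; exists 0; rewrite // scale0r addr0.
apply: bigcup_connected; first by exists (M' + 1, 0) => x _; right.
move=> x Kx; apply: connectedU; last exact: far_connected.
  have xo : 0 < `|x - o|.
    by rewrite normr_gt0 subr_eq0; apply: contra_notN Kx => /eqP ->.
  pose t := (M' + 1 + `|x|) / `|x - o|.
  have t0 : 0 <= t by rewrite divr_ge0 // addr_ge0 // addr_ge0.
  exists (x + t *: (x - o)); split; first by exists t.
  rewrite /far /=; have := ler_normB (x + t *: (x - o)) x.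
  rewrite addrAC subrr add0r normrZ (ger0_norm t0) /t divfK ?lt0r_neq0 //.
  lra.
exact: cvx_connected.
Qed.

Lemma cvx_segment p q : cvx (segment p q).
Proof.
move=> _ _ [s s01 <-] [t t01 <-] _ [u u01 <-].
move: s01 t01 u01; rewrite /= !in_itv /= => /andP[s0 s1] /andP[t0 t1] /andP[u0 u1].
have su : (1 - u) * s + u * t <= 1.
  have : (1 - u) * s <= (1 - u) * 1 by rewrite ler_wpM2l // subr_ge0.
  have : u * t <= u * 1 by rewrite ler_wpM2l.
  by rewrite !mulr1; lra.
exists ((1 - u) * s + u * t).
  by rewrite /= in_itv /= su andbT addr_ge0 // mulr_ge0 // subr_ge0.
by apply: plane_eq; rewrite ?comb1 ?comb2; ring.
Qed.

Lemma segment_compl_connected p q : connected (~` segment p q).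
Proof.
apply: (@cvx_compl_connected _ p (`|p| + `|q|)); [exact: cvx_segment|exact: segment_l|].
move=> _ [t + <-]; rewrite /= in_itv /= => /andP[t0 t1].
apply: (le_trans (ler_normD _ _)); apply: lerD; rewrite normrZ ger0_norm ?subr_ge0 //;
  by rewrite ler_piMl //; lra.
Qed.

End Triangles.

(** * Faces of straight drawings *)

Section Straight.
Variable R : realType.
Implicit Types (p q r z : plane R) (A B C F S : set (plane R)).

Lemma straight_plane (G : sgraph) (pos : G -> plane R) : straight_drawing pos ->
  plane_drawing pos (fun u v => segment (pos u) (pos v)).
Proof.
move=> H; split=> //.
  move=> u v uv; apply: segment_arc; case: H => inj _ _.
  by apply: contraTneq uv => /inj ->; rewrite adj_irrefl.
by move=> u v _; rewrite segment_sym.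
Qed.

Variables (G : sgraph) (pos : G -> plane R).
Hypothesis Hs : straight_drawing pos.
Let curve u v := segment (pos u) (pos v).
Let Hd : plane_drawing pos curve := straight_plane Hs.
Let D := drawn_set pos curve.

Let pos_inj : injective pos. Proof. by case: Hs. Qed.

Let on_edge u v w : adj u v -> segment (pos u) (pos v) (pos w) -> w = u \/ w = v.
Proof. by case: Hs => _ H _; exact: H. Qed.

Lemma face_in_connected (F U : set (plane R)) x0 : F = connected_component (~` D) x0 -> ~ D x0 ->
  connected U -> U x0 -> (forall z, U z -> D z -> closure F z -> False) -> U `<=` F.
Proof.
move=> -> nDx cU Ux UF; apply: (connected_sub_open cU) (Ux) _ _.
- by apply: component_open; rewrite openC; exact: drawn_closed Hd.
- exact: connected_component_refl.
move=> z Uz Fz; apply: component_closure => //; first exact: drawn_closed Hd.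
by move=> Dz; exact: (UF z).
Qed.

Lemma triangle_orient a b c : adj a b -> adj b c -> adj c a -> orient (pos a) (pos b) (pos c) != 0.
Proof.
move=> ab bc ca; apply/eqP => /collinear_between[/(on_edge bc)|h|/(on_edge ab)].
- by case=> E; [move: ab|move: ca]; rewrite E adj_irrefl.
- have ac : adj a c by rewrite adj_sym.
  by case: (on_edge ac h) => E; [move: ab|move: bc]; rewrite E adj_irrefl.
- by case=> E; [move: ca|move: bc]; rewrite E adj_irrefl.
Qed.

Hypothesis HQ : locally_linked G.
Hypothesis HG : (3 <= #|G|)%N.

Lemma face_boundary x0 z : let F := connected_component (~` D) x0 in
  D z -> closure F z -> exists u v, [/\ accessible F (pos u), accessible F (pos v),
    u = v \/ adj u v & segment (pos u) (pos v) z].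
Proof.
move=> F [[w _ <-]|[x [y [xy cz]]]] Fz.
  by exists w, w; split; [exact: (vertex_touch Hd)|exact: (vertex_touch Hd)|left|exact: segment_l].
have [zx|zx] := pselect (z = pos x).
  have ax : accessible F (pos x) by apply: (vertex_touch Hd); rewrite -zx.
  by exists x, x; split=> //; [left|rewrite zx; exact: segment_l].
have [zy|zy] := pselect (z = pos y).
  have ay : accessible F (pos y) by apply: (vertex_touch Hd); rewrite -zy.
  by exists y, y; split=> //; [left|rewrite zy; exact: segment_l].
exists x, y; split=> //; last by right.
  exact: (edge_touch Hd xy cz zx zy Fz).
apply: (edge_touch Hd (u := y) (v := x) _ _ zy zx Fz); first by rewrite adj_sym.
by rewrite /curve segment_sym.
Qed.

Lemma seg_drawn a b : a = b \/ adj a b -> segment (pos a) (pos b) `<=` D.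
Proof.
move=> [<-|ab] z.
  move=> [t _ <-]; left; exists a => //.
  by apply: plane_eq; rewrite ?comb1 ?comb2; ring.
by move=> h; right; exists a, b.
Qed.

(** With at most two accessible vertices the boundary of the face would lie on one drawn segment,
    possibly a point. Its complement is connected, hence contained in the face, and all vertices
    would lie on that segment, whose only vertices are its ends. *)
Lemma face_three x0 : ~ D x0 -> let F := connected_component (~` D) x0 in
  exists a b c, [/\ uniq [:: a; b; c], accessible F (pos a), accessible F (pos b) &
    accessible F (pos c)].
Proof.
move=> nDx F; apply: contrapT => no.
have [a [b [abE Zab]]] : exists a b, (a = b \/ adj a b) /\
    forall u, accessible F (pos u) -> u = a \/ u = b.
  have [[a aa]|na] := pselect (exists a, accessible F (pos a)); last first.
    have [a _] : exists a : G, a \in predT by apply/card_gt0P; apply: leq_trans HG.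
    by exists a, a; split=> [|u au]; [left|case: na; exists u].
  have [[b [bb ba]]|nb] := pselect (exists b, accessible F (pos b) /\ b <> a); last first.
    exists a, a; split=> [|u au]; first by left.
    by left; apply: contrapT => ua; apply: nb; exists u.
  exists a, b; split.
    right; apply: (accessible_adj Hd HQ aa bb); apply/eqP => E; exact: ba.
  move=> u au; apply: contrapT => /not_orP[ua ub]; apply: no; exists a, b, u.
  split=> //=; rewrite !inE !negb_or !andbT; apply/andP; split.
    by apply/andP; split; apply/eqP => E; [apply: ba|apply: ua]; rewrite E.
  by apply/eqP => E; apply: ub; rewrite E.
have segD := seg_drawn abE.
have sub : ~` segment (pos a) (pos b) `<=` F.
  apply: (face_in_connected (x0 := x0)) => //.
  - exact: segment_compl_connected.
  - by move=> /segD.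
  move=> z ns Dz /(face_boundary Dz)[u [v [/Zab uE /Zab vE uv zs]]]; apply: ns.
  have := @cvx_segment R (pos a) (pos b) (pos u) (pos v); apply; last exact: zs.
    by case: uE => ->; [exact: segment_l|exact: segment_r].
  by case: vE => ->; [exact: segment_l|exact: segment_r].
have all w : w = a \/ w = b.
  have Dw : D (pos w) by left; exists w.
  have sw : segment (pos a) (pos b) (pos w).
    apply: contrapT => /sub Fw; exact: (connected_component_sub Fw).
  case: abE => [ab|ab]; last exact: on_edge.
  left; apply: pos_inj; case: sw => t _ <-; rewrite -ab.
  by apply: plane_eq; rewrite ?comb1 ?comb2; ring.
have : (#|G| <= 2)%N.
  apply: (@leq_trans #|[set a; b]%SET|); last by rewrite cards2; case: (a != b).
  by apply: subset_leq_card; apply/fintype.subsetP => w _; rewrite !inE; case: (all w) => ->; rewrite eqxx ?orbT.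
by rewrite leqNgt HG.
Qed.

(** The boundary of the face lies on the sides of the triangle of its accessible vertices, and these
    sides are drawn. So the face is a whole component of their complement. *)
Theorem face_triangle x0 : ~ D x0 -> let F := connected_component (~` D) x0 in
  exists a b c, [/\ [/\ adj a b, adj b c & adj c a], 0 < orient (pos a) (pos b) (pos c),
    forall u, accessible F (pos u) <-> u \in [set a; b; c]%SET &
    F = tri_int (pos a) (pos b) (pos c) \/ F = ~` tri (pos a) (pos b) (pos c)].
Proof.
move=> nDx F.
have [a [b [c [abc aa bb cc]]]] := face_three nDx.
have adjF u v : accessible F (pos u) -> accessible F (pos v) -> u != v -> adj u v.
  exact: (accessible_adj Hd HQ).
wlog o0 : b c abc bb cc / 0 < orient (pos a) (pos b) (pos c).
  move=> W; have [|le0|o0] := ltgtP 0 (orient (pos a) (pos b) (pos c)).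
  - exact: W.
  - have acb : uniq [:: a; c; b].
      move: abc; rewrite /= !inE !negb_or !andbT => /andP[/andP[-> ->]].
      by rewrite eq_sym.
    by apply: (W c b acb cc bb); rewrite orient_swap oppr_gt0.
  move: (abc); rewrite /= !inE !negb_or !andbT => /andP[/andP[ab ac] bc].
  have ca : c != a by rewrite eq_sym.
  have := triangle_orient (adjF _ _ aa bb ab) (adjF _ _ bb cc bc) (adjF _ _ cc aa ca).
  by rewrite -o0 eqxx.
move: (abc); rewrite /= !inE !negb_or !andbT => /andP[/andP[ab ac] bc].
have Aab := adjF _ _ aa bb ab; have Abc := adjF _ _ bb cc bc.
have Aca : adj c a by rewrite adj_sym; exact: adjF.
have Zabc u : accessible F (pos u) -> u \in [set a; b; c]%SET.
  move=> uu; apply: contraT; rewrite !inE !negb_or => /andP[/andP[ua ub] uc].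
  case: (@accessible_le3 _ _ _ _ Hd HQ x0 a b c u) => //.
  by rewrite /= !inE !negb_or ab ac bc !andbT eq_sym ua eq_sym ub eq_sym uc.
exists a, b, c; split=> //.
  move=> u; split; first exact: Zabc.
  by rewrite !inE => /orP[/orP[]|] /eqP ->.
set p := pos a in o0 *; set q := pos b in o0 *; set r := pos c in o0 *.
have edgesD : tri_edges p q r `<=` D.
  by move=> z [|[|]]; apply: seg_drawn; right.
have bnd z : D z -> closure F z -> tri_edges p q r z.
  move=> Dz /(face_boundary Dz)[u [v [/Zabc + /Zabc + uv zs]]].
  have [sa sb sc] : [/\ tri_edges p q r p, tri_edges p q r q & tri_edges p q r r].
    split; [left; exact: segment_l|left; exact: segment_r|right; left; exact: segment_r].
  have deg w : segment (pos w) (pos w) z -> z = pos w.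
    by move=> [t _ <-]; apply: plane_eq; rewrite ?comb1 ?comb2; ring.
  rewrite !inE => /orP[/orP[]|] /eqP uE /orP[/orP[]|] /eqP vE; subst u v.
  - by rewrite (deg _ zs).
  - by left.
  - by right; right; rewrite segment_sym.
  - by left; rewrite segment_sym.
  - by rewrite (deg _ zs).
  - by right; left.
  - by right; right.
  - by right; left; rewrite segment_sym.
  - by rewrite (deg _ zs).
have oF : open F by apply: component_open; rewrite openC; exact: drawn_closed Hd.
have cF : connected F by exact: component_connected.
have Fx : F x0 by exact: connected_component_refl.
have FD z : F z -> ~ D z by move=> /connected_component_sub.
have [x0t|x0t] := pselect (tri p q r x0).
  left; have x0i : tri_int p q r x0.
    by case: (tri_cases o0 x0t) => // /edgesD.
  apply/seteqP; split.
    apply: (connected_sub_open cF (@tri_int_open _ p q r) Fx x0i) => z Fz iz.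
    have tz : tri p q r z.
      have := @tri_closed _ p q r; apply; move=> B nB; have [w [[w1 [w2 w3]] Bw]] := iz B nB.
      by exists w; split=> //; split; [|split]; exact: ltW.
    by case: (tri_cases o0 tz) => // /edgesD /(FD _ Fz).
  apply: (face_in_connected (x0 := x0)) => //.
    by apply: cvx_connected; exact: cvx_tri_int.
  by move=> z iz Dz /(bnd _ Dz); exact: tri_int_edges.
right; apply/seteqP; split.
  have oE : open (~` tri p q r) by rewrite openC; exact: tri_closed.
  apply: (connected_sub_open cF oE Fx x0t) => z Fz ez tz.
  case: (tri_cases o0 tz) => [iz|/edgesD]; last exact: FD.
  have [w [nw iw]] := ez _ (open_nbhs_nbhs (conj (@tri_int_open _ p q r) iz)).
  by apply: nw; case: iw => w1 [w2 w3]; split; [|split]; exact: ltW.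
apply: (face_in_connected (x0 := x0)) => //.
  by apply: (cvx_compl_connected (@cvx_tri _ p q r) _ (tri_bounded o0)); exact: tri_p.
by move=> z nz Dz /(bnd _ Dz) /(tri_edges_sub o0).
Qed.

End Straight.

(** * Attachments of the rest of a graph to a subgraph *)

Section Attachments.
Variable R : realType.
Implicit Types (p q z : plane R) (A B C F S : set (plane R)).
Variables (G : sgraph) (P : pred G).
Local Notation GP := (induced P).

Lemma induced_noncrossing (pos : G -> plane R) curve : noncrossing pos curve ->
  noncrossing (fun v : GP => pos (val v)) (fun u v : GP => curve (val u) (val v)).
Proof.
move=> [inj on meet]; split.
- by move=> u v /inj /val_inj.
- by move=> u v w uv /(on _ _ _ uv)[] /val_inj ->; [left|right].
move=> u v x y uv xy ne z zuv zxy.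
have setE (a b : GP) : val @: [set a; b]%SET = [set val a; val b]%SET.
  by rewrite imsetU1 imset_set1.
have ne' : [set val u; val v]%SET != [set val x; val y]%SET.
  apply: contra ne => /eqP; rewrite -!setE => /imset_inj E; apply/eqP; apply: E; exact: val_inj.
have [w + zw] := meet _ _ _ _ uv xy ne' z zuv zxy.
rewrite -!setE => /setIP[/imsetP[w1 w1u w1E] /imsetP[w2 w2x w2E]].
have E : w1 = w2 by apply: val_inj; rewrite -w1E -w2E.
by exists w1; rewrite ?zw ?w1E // inE w1u E w2x.
Qed.

Lemma induced_plane (pos : G -> plane R) curve : plane_drawing pos curve ->
  plane_drawing (fun v : GP => pos (val v)) (fun u v : GP => curve (val u) (val v)).
Proof.
move=> [nc ar sy]; split; first exact: induced_noncrossing.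
  by move=> u v uv; exact: ar.
by move=> u v uv; exact: sy.
Qed.

Lemma drawn_induced (pos : G -> plane R) curve :
  drawn_set (fun v : GP => pos (val v)) (fun u v : GP => curve (val u) (val v)) =
  indraw pos curve P.
Proof.
apply/seteqP; split=> z.
  move=> [[u _ <-]|[u [v [uv cz]]]]; first by left; exists (val u) => //; exact: (valP u).
  by right; exists (val u), (val v); split=> //; rewrite (valP u) (valP v).
move=> [[x Px ->]|[x [y [xy /andP[Px Py] cz]]]].
  by left; exists (Sub x Px).
by right; exists (Sub x Px), (Sub y Py).
Qed.

Lemma arcconn_component K S p q : S `<=` ~` K -> arcconn S p q ->
  connected_component (~` K) p q.
Proof.
move=> SK [Sp [<-|[A pA AS]]]; first by apply: connected_component_refl; exact: SK.
exists A; last exact: arc_r pA.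
by split; [exact: arc_l pA|move=> z /AS /SK|exact: arc_connected pA].
Qed.

Definition outrel : rel G := fun x y => [&& adj x y, ~~ P x & ~~ P y].

(** The attachments of the bridge of [P] that contains [y]. No drawing is involved, so this set
    links the given drawing with every straight one. *)
Definition att (y : G) : {set GP} :=
  [set z : GP | [exists x, connect outrel y x && adj x (val z)]]%SET.

Lemma outrel_notin y x : ~~ P y -> connect outrel y x -> ~~ P x.
Proof.
move=> Py /connectP[p + ->]; elim/last_ind: p => [//|p z _].
by rewrite rcons_path last_rcons => /andP[_ /and3P[]].
Qed.

(** Fewer than three attachments would separate [y] from some other vertex of [P], which exists
    because [P] has at least three. *)
Lemma att_card y : three_connected G -> ~~ P y -> (3 <= #|GP|)%N -> (3 <= #|att y|)%N.
Proof.
move=> [_ c3] Py G3; rewrite leqNgt; apply/negP => A3.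
pose S : {set G} := (val @: att y)%SET.
have S3 : (#|S| < 3)%N by rewrite card_imset //; exact: val_inj.
have [v vA] : exists v : GP, v \notin att y.
  have : (0 < #|~: att y|)%N.
    by rewrite cardsCs finset.setCK subn_gt0; exact: leq_trans G3.
  by rewrite card_gt0 => /finset.set0Pn[v]; rewrite inE => h; exists v.
have yS : y \notin S.
  by apply: contra Py => /imsetP[w _ ->]; exact: (valP w).
have vS : val v \notin S by rewrite mem_imset //; exact: val_inj.
have /connectP[p] := c3 S S3 y (val v) yS vS.
have H x (q : seq G) : connect outrel y x ->
    path [rel x y | [&& adj x y, x \notin S & y \notin S]] x q -> connect outrel y (last x q).
  elim: q x => [//|z q IH] x yx /= /andP[/and3P[xz xS zS] pth]; apply: IH => //.
  apply: (connect_trans yx); apply: connect1; rewrite /outrel xz (outrel_notin Py yx) /=.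
  apply: contra zS => Pz; apply/imsetP; exists (Sub z Pz) => //.
  by rewrite inE; apply/existsP; exists x; rewrite yx.
move=> /(H y p (connect0 _ _)) + E; rewrite -E => /(outrel_notin Py).
by rewrite (valP v).
Qed.

Variables (pos : G -> plane R) (curve : G -> G -> set (plane R)).
Hypothesis Hd : plane_drawing pos curve.
Let DP := indraw pos curve P.


Let on_edge u v w : adj u v -> curve u v (pos w) -> w = u \/ w = v.
Proof. by case: Hd => -[_ H _] _ _; exact: H. Qed.

Let edge_arc u v : adj u v -> arc (pos u) (pos v) (curve u v).
Proof. by case: Hd => _ H _; exact: H. Qed.

Let edges_meet u v x y z : adj u v -> adj x y -> [set u; v]%SET != [set x; y]%SET ->
  curve u v z -> curve x y z ->
  exists2 w : G, w \in ([set u; v] :&: [set x; y])%SET & z = pos w.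
Proof. by case: Hd => -[_ _ H] _ _ uv xy n; exact: H. Qed.

Lemma indraw_sub_compl (Q : pred G) : (forall x, Q x -> ~~ P x) -> indraw pos curve Q `<=` ~` DP.
Proof. by move=> QP z Qz Pz; exact: (indraw_disj Hd QP Qz Pz). Qed.

Lemma outside_component y x : ~~ P y -> connect outrel y x ->
  connected_component (~` DP) (pos y) (pos x).
Proof.
move=> Py yx; apply: (arcconn_component (@indraw_sub_compl (fun x => ~~ P x) (fun x h => h))).
by apply: (indraw_connect Hd (e := outrel)) => // a b /and3P[].
Qed.

(** The component of [y] outside [P] is drawn in one face, and its edge to [z] is an arc that stays
    in this face except at [z]. *)
Lemma att_accessible y (z : GP) : ~~ P y -> z \in att y ->
  accessible (connected_component (~` DP) (pos y)) (pos (val z)).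
Proof.
move=> Py; rewrite inE => /existsP[x /andP[yx xz]].
have Px := outrel_notin Py yx; have Pz : P (val z) := valP z.
have zx : adj (val z) x by rewrite adj_sym.
have Fx := outside_component Py yx.
exists (pos x), (curve (val z) x); split; [exact: edge_arc|exact: Fx|].
have [g cg [ig g0 g1 CE]] := arc_path (edge_arc zx).
have nD r : 0 < r -> r <= 1 -> ~ DP (g r).
  move=> r0 r1.
  have cr : curve (val z) x (g r) by rewrite CE; apply: path_image_in => //; exact: ltW.
  have nz : g r <> pos (val z).
    have rI : r \in `[(0:R), 1] by rewrite in_itv /= (ltW r0).
    have I0 : (0:R) \in `[(0:R), 1] by rewrite in_itv /= lexx ler01.
    by rewrite -g0 => /(ig _ _ rI I0) E; move: r0; rewrite E ltxx.
  have nw w : P w -> w = val z \/ w = x -> g r <> pos w.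
    by move=> Pw [->//|wx]; move: Px; rewrite -wx Pw.
  move=> [[w Pw gw]|[a [b [ab /andP[Pa Pb] cab]]]].
    by apply: (nw w Pw _ gw); apply: (on_edge zx); rewrite -gw.
  have ne : [set val z; x]%SET != [set a; b]%SET.
    apply: contraNneq Px => E; have : x \in [set a; b]%SET by rewrite -E !inE eqxx orbT.
    by rewrite !inE => /orP[] /eqP ->.
  have [w + gw] := edges_meet zx ab ne cr cab.
  rewrite !inE => /andP[w1 w2]; apply: (nw w _ _ gw).
    by case/orP: w2 => /eqP ->.
  by case/orP: w1 => /eqP ->; [left|right].
move=> w; rewrite CE => -[s + <-]; rewrite /= in_itv /= => /andP[s0 s1].
move: s0; rewrite le_eqVlt => /orP[/eqP <-|s0]; first by right; rewrite g0.
left; apply: (connected_component_trans Fx); rewrite -g1.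
exists (g @` `[s, 1]); last exact: path_image_in.
split; [exact: path_image_in| |exact: path_connected].
by move=> _ [t + <-]; rewrite /= in_itv /= => /andP[st t1]; apply: nD => //; exact: lt_le_trans st.
Qed.

End Attachments.

(** * Separating the triangulations *)

Lemma card_le3 (T : finType) (Z : {set T}) :
  (forall a b c d, uniq [:: a; b; c; d] -> a \in Z -> b \in Z -> c \in Z -> d \in Z -> False) ->
  (#|Z| <= 3)%N.
Proof.
move=> H; rewrite leqNgt; apply/negP; rewrite cardE.
have := enum_uniq (mem Z); have : {subset enum Z <= Z} by move=> x; rewrite mem_enum.
case: (enum Z) => [|a [|b [|c [|d s]]]] //= sub U _.
apply: (H a b c d); try by apply: sub; rewrite !inE eqxx ?orbT.
move: U; rewrite /= !inE !negb_or => /and5P[/and3P[ab ac /andP[ad _]] /and3P[bc bd _] /andP[cd _] _ _].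
by rewrite ab ac ad bc bd cd.
Qed.

Section Separation.
Variable R : realType.
Implicit Types (p q r z : plane R) (A B C F S : set (plane R)).

Lemma orient_bary p q r x y z : orient p q r * orient x y z =
  orient q r z * orient x y p + orient r p z * orient x y q + orient p q z * orient x y r.
Proof. rewrite /orient; ring. Qed.

Lemma tri_halfplane p q r x y z : 0 < orient p q r ->
  0 < orient x y p -> 0 < orient x y q -> 0 < orient x y r -> tri p q r z -> 0 < orient x y z.
Proof.
move=> h hp hq hr [/= a [/= b c]]; rewrite -(pmulr_rgt0 _ h) orient_bary.
have S : orient p q z + orient q r z + orient r p z = orient p q r by rewrite /orient; ring.
have h1 := mulr_ge0 b (ltW hp); have h2 := mulr_ge0 c (ltW hq); have h3 := mulr_ge0 a (ltW hr).
have [a0|a0] := ltP 0 (orient p q z).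
  have := mulr_gt0 a0 hr; lra.
have [b0|b0] := ltP 0 (orient q r z).
  have := mulr_gt0 b0 hp; lra.
have c0 : 0 < orient r p z by lra.
have := mulr_gt0 c0 hq; lra.
Qed.

Lemma tri_in_int p q r a b c z : 0 < orient p q r ->
  tri_int a b c p -> tri_int a b c q -> tri_int a b c r -> tri p q r z -> tri_int a b c z.
Proof.
move=> h [/= p1 [/= p2 p3]] [/= q1 [/= q2 q3]] [/= r1 [/= r2 r3]] tz.
by split; [|split]; rewrite /=; [exact: (tri_halfplane h p1 q1 r1)|
  exact: (tri_halfplane h p2 q2 r2)|exact: (tri_halfplane h p3 q3 r3)].
Qed.

Lemma tri_int_sub p q r : tri_int p q r `<=` tri p q r.
Proof. by move=> z [a [b c]]; split; [|split]; exact: ltW. Qed.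

Lemma tri_int_irrefl p q r : ~ tri_int p q r p.
Proof. by move=> [+ _]; rewrite /= /orient !subrr !mulr0 subrr ltxx. Qed.

(** Two counterclockwise lists of the same three vertices differ by a rotation; the other
    assignments contradict the orientation. *)
Lemma same_tri (T : finType) (f : T -> plane R) a b c a' b' c' :
  [set a; b; c]%SET = [set a'; b'; c']%SET ->
  0 < orient (f a) (f b) (f c) -> 0 < orient (f a') (f b') (f c') ->
  tri (f a) (f b) (f c) = tri (f a') (f b') (f c') /\
  tri_int (f a) (f b) (f c) = tri_int (f a') (f b') (f c').
Proof.
move=> E o o'.
have irot p q r : tri_int p q r = tri_int q r p.
  by apply/seteqP; split=> z [h1 [h2 h3]]; split=> //; split.
have deg1 p q : orient p p q = 0 by rewrite /orient; ring.
have deg2 p q : orient p q q = 0 by rewrite /orient; ring.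
have deg3 p q : orient p q p = 0 by rewrite /orient; ring.
have : a' \in [set a; b; c]%SET by rewrite E !inE eqxx.
have : b' \in [set a; b; c]%SET by rewrite E !inE eqxx ?orbT.
have : c' \in [set a; b; c]%SET by rewrite E !inE eqxx ?orbT.
have n1 : (0 < orient (f a) (f c) (f b)) = false.
  by rewrite orient_swap oppr_gt0; apply/negbTE; rewrite -leNgt ltW.
have n2 : (0 < orient (f c) (f b) (f a)) = false by rewrite -orient_rot.
have n3 : (0 < orient (f b) (f a) (f c)) = false by rewrite orient_rot.
have r1 : tri (f b) (f c) (f a) = tri (f a) (f b) (f c) by rewrite [RHS]tri_rot.
have r2 : tri (f c) (f a) (f b) = tri (f a) (f b) (f c) by rewrite tri_rot.
have s1 : tri_int (f b) (f c) (f a) = tri_int (f a) (f b) (f c) by rewrite [RHS]irot.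
have s2 : tri_int (f c) (f a) (f b) = tri_int (f a) (f b) (f c) by rewrite irot.
Opaque orient tri tri_int.
rewrite !inE => /orP[/orP[]|] /eqP cE /orP[/orP[]|] /eqP bE /orP[/orP[]|] /eqP aE;
  move: o'; rewrite aE bE cE => o'; clear E aE bE cE.
all: try (by move: o'; rewrite deg1 ltxx).
all: try (by move: o'; rewrite deg2 ltxx).
all: try (by move: o'; rewrite deg3 ltxx).
all: try (by move: o'; rewrite n1).
all: try (by move: o'; rewrite n2).
all: try (by move: o'; rewrite n3).
all: by rewrite ?r1 ?r2 ?s1 ?s2; split; reflexivity.
Qed.
Transparent orient tri tri_int.

End Separation.

(** * From the given drawing to straight drawings *)

Section ClassH.
Variables (R : realType) (k : nat) (H : sgraph) (t : H -> 'I_k).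
Variables (pos : H -> plane R) (curve : H -> H -> set (plane R)).
Hypothesis k4 : (4 <= k)%N.
Hypothesis Hd : plane_drawing pos curve.
Local Notation cl i := (fun v : H => t v == i).
Local Notation T i := (induced (cl i)).
Hypothesis cardT : forall i, #|T i| = k.
Hypothesis maxT : forall i, maximal_plane (fun v : T i => pos (val v))
  (fun u v : T i => curve (val u) (val v)).
Hypothesis outT : forall i j, i != j ->
  ~ exists2 F, inner_face (indraw pos curve (cl i)) F & indraw pos curve (cl j) `<=` F.
Hypothesis c3 : three_connected H.

Let locT i : locally_linked (T i). Proof. exact: maximal_locally_linked (maxT i). Qed.

Let arcconn_class (p : H -> plane R) cu j u v : plane_drawing p cu -> t u = j -> t v = j ->
  arcconn (indraw p cu (cl j)) (p u) (p v).
Proof.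
move=> Hp uj vj; have [Q0 _] := locT j.
have uj' : t u == j by apply/eqP.
have vj' : t v == j by apply/eqP.
have := indraw_cut (induced_plane (cl j) Hp) (x := Sub u uj') (y := Sub v vj') Q0 isT isT.
rewrite /indraw -(drawn_setE) drawn_induced; exact.
Qed.

Let class_in_face (p : H -> plane R) cu i y : plane_drawing p cu -> t y != i ->
  indraw p cu (cl (t y)) `<=` connected_component (~` indraw p cu (cl i)) (p y).
Proof.
move=> Hp yi; have sub : indraw p cu (cl (t y)) `<=` ~` indraw p cu (cl i).
  by apply: (indraw_sub_compl Hp) => x /= /eqP ->.
have P x : t x = t y -> connected_component (~` indraw p cu (cl i)) (p y) (p x).
  by move=> xy; apply: (arcconn_component sub); exact: arcconn_class.
move=> z [[x /eqP xy ->]|[a [b [ab /andP[/eqP ay bY] cz]]]]; first exact: P.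
apply: (connected_component_trans (P a ay)).
have eb : arc (p a) (p b) (cu a b) by case: Hp => _ h _; exact: h.
exists (cu a b) => //; split; [exact: arc_l eb| |exact: arc_connected eb].
by move=> w cw; apply: sub; right; exists a, b; split=> //=; rewrite ay eqxx.
Qed.

Let pos_out (p : H -> plane R) cu i y : plane_drawing p cu -> t y != i -> ~ indraw p cu (cl i) (p y).
Proof. by move=> Hp yi /(indraw_posE Hp) /=; rewrite (negbTE yi). Qed.

(** Otherwise the face would be an inner face containing the whole triangulation of [y]. *)
Let top_face_unbounded i y M : t y != i ->
  exists2 z, connected_component (~` indraw pos curve (cl i)) (pos y) z & M < `|z|.
Proof.
move=> yi; apply: contrapT => no.
apply: (outT (i := i) (j := t y)); first by rewrite eq_sym.
exists (connected_component (~` indraw pos curve (cl i)) (pos y)); last exact: class_in_face.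
split; first by exists (pos y) => //; exact: pos_out.
exists M; split; first exact: num_real.
move=> x Mx z Fz /=; rewrite leNgt; apply/negP => xz; apply: no; exists z => //.
exact: lt_trans xz.
Qed.

Let top_same_face i y y' : t y != i -> t y' != i ->
  connected_component (~` indraw pos curve (cl i)) (pos y) =
  connected_component (~` indraw pos curve (cl i)) (pos y').
Proof.
move=> yi y'i; have cD : compact (indraw pos curve (cl i)) by exact: subdrawing_compact.
have [_ [M KM]] := (compact_closedP _).1 cD.
pose M' := Num.max M 0; have M0 : 0 <= M' by rewrite le_max lexx orbT.
have [z yz Mz] := top_face_unbounded M' yi; have [z' yz' Mz'] := top_face_unbounded M' y'i.
apply: same_connected_component; apply: (connected_component_trans yz).
apply: (@connected_component_trans _ _ z'); last exact: connected_component_sym.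
exists [set w | M' < `|w|] => //; split=> //; last exact: far_connected.
by move=> w /= Mw /KM wM; move: Mw; rewrite ltNge /M' le_max wM.
Qed.

Let k3 : (3 <= k)%N. Proof. exact: leq_trans k4. Qed.

Let att3 i y : t y != i -> (3 <= #|att (cl i) y|)%N.
Proof. by move=> yi; apply: att_card => //; rewrite cardT. Qed.

(** The common face has at most three accessible vertices, and each set of attachments consists of
    at least three of them. *)
Let att_eq i y y' : t y != i -> t y' != i -> att (cl i) y = att (cl i) y'.
Proof.
move=> yi y'i.
pose F := connected_component (~` indraw pos curve (cl i)) (pos y).
pose Z : {set T i} := [set z : T i | `[< accessible F (pos (val z)) >]]%SET.
have Z3 : (#|Z| <= 3)%N.
  apply: card_le3 => a b c d U; rewrite !inE => Aa Ab Ac Ad.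
  have := accessible_le3 (induced_plane (cl i) Hd) (locT i) (x0 := pos y) U.
  rewrite drawn_induced => h.
  exact: (h Aa Ab Ac Ad).
have sub w : t w != i -> att (cl i) w \subset Z.
  move=> wi; apply/fintype.subsetP => z zw; rewrite inE; apply/asboolP.
  by rewrite /F (top_same_face yi wi); exact: (att_accessible Hd wi zw).
have E w : t w != i -> att (cl i) w = Z.
  by move=> wi; apply/eqP; rewrite eqEcard sub //= (leq_trans Z3) // att3.
by rewrite !E.
Qed.

Section StraightDrawing.
Variable sg : H -> plane R.
Hypothesis Hs : straight_drawing sg.
Local Notation seg := (fun u v => segment (sg u) (sg v)).
Let Hsd : plane_drawing sg seg := straight_plane Hs.
Local Notation Di i := (indraw sg seg (cl i)).
Local Notation face i y := (connected_component (~` Di i) (sg y)).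

Let face_data i y : t y != i -> exists a b c : T i,
  [/\ 0 < orient (sg (val a)) (sg (val b)) (sg (val c)), [/\ adj a b, adj b c & adj c a],
      att (cl i) y = [set a; b; c]%SET &
      face i y = tri_int (sg (val a)) (sg (val b)) (sg (val c)) \/
      face i y = ~` tri (sg (val a)) (sg (val b)) (sg (val c))].
Proof.
move=> yi.
have Hi : straight_drawing (fun v : T i => sg (val v)) by exact: (@induced_noncrossing R H (cl i) sg seg Hs).
have GT3 : (3 <= #|T i|)%N by rewrite cardT.
have nD : ~ drawn_set (fun v : T i => sg (val v)) (fun u v : T i => segment (sg (val u)) (sg (val v))) (sg y).
  by rewrite (drawn_induced (cl i) sg seg); exact: pos_out.
have := face_triangle Hi (locT i) GT3 nD; rewrite (drawn_induced (cl i) sg seg).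
move=> [a [b [c [[ab bc ca] o Zabc FE]]]]; exists a, b, c; split=> //.
apply/eqP; rewrite eqEcard; apply/andP; split.
  apply/fintype.subsetP => z zy; apply/Zabc.
  exact: (att_accessible Hsd yi zy).
apply: leq_trans (att3 yi); apply: (leq_trans (leq_card_setU _ _)).
by rewrite cards1 addn1 ltnS; apply: (leq_trans (leq_card_setU _ _)); rewrite !cards1.
Qed.

Let class_notin_face i y v : t v = i -> ~ face i y (sg v).
Proof.
move=> vi /connected_component_sub; apply; left; exists v => //; exact/eqP.
Qed.

(** By [att_eq] both faces are bounded by the same triangle. If they were its two sides, no further
    vertex of the class would find a place, against [4 <= k]. *)
Let same_face i y y' : t y != i -> t y' != i -> face i y = face i y'.
Proof.
move=> yi y'i.
have [a [b [c [og [ab bc ca] A F1]]]] := face_data yi; have [a' [b' [c' [og' _ A' F2]]]] := face_data y'i.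
have E : [set a; b; c]%SET = [set a'; b'; c']%SET by rewrite -A -A'; exact: att_eq.
have [TE IE] := same_tri (f := fun v : T i => sg (val v)) E og og'.
rewrite -TE -IE in F2.
have absurd12 (y1 y2 : H) : face i y1 = tri_int (sg (val a)) (sg (val b)) (sg (val c)) ->
    face i y2 = ~` tri (sg (val a)) (sg (val b)) (sg (val c)) -> False.
  move=> h1 h2.
  have all (v : T i) : v \in [set a; b; c]%SET.
    have n1 := @class_notin_face i y1 (val v) (eqP (valP v)).
    have n2 := @class_notin_face i y2 (val v) (eqP (valP v)).
    rewrite h1 in n1; rewrite h2 in n2.
    have tv : tri (sg (val a)) (sg (val b)) (sg (val c)) (sg (val v)) by exact: contrapT.
    have on (u w : T i) : adj u w -> segment (sg (val u)) (sg (val w)) (sg (val v)) ->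
        v = u \/ v = w.
      by move=> uw h; case: Hs => _ on _; case: (on _ _ _ uw h) => /val_inj; [left|right].
    rewrite !inE; case: (tri_cases og tv) => [//|[/(on _ _ ab)|[/(on _ _ bc)|/(on _ _ ca)]]];
      by case=> ->; rewrite eqxx ?orbT.
  have : (#|T i| <= 3)%N.
    apply: (@leq_trans #|[set a; b; c]%SET|); first by apply: subset_leq_card; apply/fintype.subsetP => v _.
    apply: (leq_trans (leq_card_setU _ _)).
    by rewrite cards1 addn1 ltnS; apply: (leq_trans (leq_card_setU _ _)); rewrite !cards1.
  by rewrite cardT leqNgt k4.
case: F1 F2 => [F1|F1] [F2|F2]; rewrite ?F1 ?F2 //.
  by case: (absurd12 _ _ F1 F2).
by case: (absurd12 _ _ F2 F1).
Qed.

Let other i : exists y, t y != i.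
Proof.
have [j ji] : exists j : 'I_k, j != i.
  have : (0 < #|[set~ i]%SET|)%N.
    by rewrite cardsC1 card_ord; case: (k) k4 => [|[]].
  by rewrite card_gt0 => /finset.set0Pn[j]; rewrite !inE => h; exists j.
have : (0 < #|T j|)%N by rewrite cardT; exact: leq_trans k4.
by move=> /card_gt0P[y _]; exists (val y); rewrite (eqP (valP y)).
Qed.

Definition hull_triangle i (X : set (plane R)) := exists a b c,
  [/\ [/\ t a = i, t b = i & t c = i], 0 < orient (sg a) (sg b) (sg c),
      X = tri (sg a) (sg b) (sg c), forall v, t v = i -> X (sg v) &
      forall y, t y != i -> face i y = ~` X].

Definition enclosing_triangle i a b c :=
  [/\ t a = i /\ t b = i /\ t c = i, 0 < orient (sg a) (sg b) (sg c) &
      forall y, t y != i -> face i y = tri_int (sg a) (sg b) (sg c)].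

Lemma enclosing_or_hull i :
  (exists a b c, enclosing_triangle i a b c) \/ exists X, hull_triangle i X.
Proof.
have [y yi] := other i; have [a [b [c [og _ _ F1]]]] := face_data yi.
have [ta tb tc] : [/\ t (val a) = i, t (val b) = i & t (val c) = i].
  by split; apply/eqP; [exact: (valP a)|exact: (valP b)|exact: (valP c)].
case: F1 => F1; [left|right].
  exists (val a), (val b), (val c); split=> // y' y'i; by rewrite -F1; exact: same_face.
exists (tri (sg (val a)) (sg (val b)) (sg (val c))), (val a), (val b), (val c); split=> //.
  by move=> v vi; apply: contrapT => h; apply: (class_notin_face (y := y) vi); rewrite F1.
by move=> y' y'i; rewrite -F1; exact: same_face.
Qed.

(** Triangulation [j] is drawn in the complement of [X]. So [X], being connected, stays in one face
    of triangulation [j], which is the complement of [Y]. *)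
Lemma hull_disj i j X Y : i != j -> hull_triangle i X -> hull_triangle j Y -> disj X Y.
Proof.
move=> ij [a [b [c [[ai bi ci] og XE Xi Xf]]]] [a' [b' [c' [[aj' _ _] _ _ _ Yf]]]].
have a'i : t a' != i by rewrite aj' eq_sym.
have aj : t a != j by rewrite ai.
have XD : X `<=` ~` Di j.
  by move=> z Xz; rewrite -aj' => /(class_in_face Hsd a'i); rewrite Xf.
have XF : X `<=` face j a.
  move=> z Xz; exists X => //; split=> //; first exact: Xi.
  by rewrite XE; apply: cvx_connected; exact: cvx_tri.
by move=> z /XF; rewrite Yf.
Qed.

(** Two triangulations cannot enclose each other: a vertex of a triangle would lie in the interior
    of that same triangle. *)
Lemma enclosed_hull i j a b c : enclosing_triangle i a b c -> j != i ->
  exists2 X, hull_triangle j X & X `<=` tri_int (sg a) (sg b) (sg c).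
Proof.
move=> [[ai [bi ci]] og If] ji.
have aj : t a != j by rewrite ai eq_sym.
have bj : t b != j by rewrite bi eq_sym.
have cj : t c != j by rewrite ci eq_sym.
have inI v : t v = j -> tri_int (sg a) (sg b) (sg c) (sg v).
  move=> vj; have vi : t v != i by rewrite vj.
  by rewrite -(If v vi); apply: connected_component_refl; exact: pos_out.
case: (enclosing_or_hull j) => [[a' [b' [c' [[a'j [b'j c'j]] og' If']]]]|[X HX]].
  have inJ v : t v != j -> tri_int (sg a') (sg b') (sg c') (sg v).
    by move=> vj; rewrite -(If' v vj); apply: connected_component_refl; exact: pos_out.
  case: (@tri_int_irrefl R (sg a') (sg b') (sg c')).
  apply: (tri_in_int og (inJ a aj) (inJ b bj) (inJ c cj)).
  exact/tri_int_sub/inI.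
exists X => //; case: HX => a' [b' [c' [[a'j b'j c'j] og' -> _ _]]] z.
exact: (tri_in_int og' (inI a' a'j) (inI b' b'j) (inI c' c'j)).
Qed.

(* If one triangulation encloses all the others in a triangular face, its vertices
   are distributed over the three closed half planes bounding that face from
   outside; this uses two colours more. *)
Theorem separated_colouring : exists (f : H -> 'I_k + 'I_2) (X : 'I_k + 'I_2 -> set (plane R)),
  [/\ forall v, X (f v) (sg v), forall c, cvx (X c) &
      forall u v, t u != t v -> disj (X (f u)) (X (f v))].
Proof.
have [[i [a [b [c En]]]]|no] := pselect (exists i a b c, enclosing_triangle i a b c); last first.
  have hull i : exists X, hull_triangle i X.
    by case: (enclosing_or_hull i) => // h; case: no; exists i.
  pose X (c : 'I_k + 'I_2) := if c is inl i then proj1_sig (cid (hull i)) else set0.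
  have XP i : hull_triangle i (X (inl i)) by rewrite /X; case: cid.
  exists (fun v => inl (t v)), X; split.
  - by move=> v; have [? [? [? [_ _ _ h _]]]] := XP (t v); exact: h.
  - move=> [i|j]; last by move=> x y [].
    by have [? [? [? [_ _ -> _ _]]]] := XP i; exact: cvx_tri.
  by move=> u v uv; exact: hull_disj uv (XP _) (XP _).
have hull j : exists X, j != i -> hull_triangle j X /\ X `<=` tri_int (sg a) (sg b) (sg c).
  have [->|ji] := eqVneq j i; first by exists set0.
  by have [X HX XI] := enclosed_hull En ji; exists X.
pose Xh j := proj1_sig (cid (hull j)).
have XhP j : j != i -> hull_triangle j (Xh j) /\ Xh j `<=` tri_int (sg a) (sg b) (sg c).
  by rewrite /Xh; case: cid.
pose h1 := [set z | orient (sg a) (sg b) z <= 0].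
pose h2 := [set z | orient (sg b) (sg c) z <= 0].
pose h3 := [set z | orient (sg c) (sg a) z <= 0].
(* The colour [inl i] is free, as no hull is assigned to triangulation [i], and takes the first half
   plane; [inr] provides the other two. *)
pose X (x : 'I_k + 'I_2) := match x with
  | inl j => if j == i then h1 else Xh j
  | inr e => if e == ord0 then h2 else h3 end.
pose f v : 'I_k + 'I_2 := if t v != i then inl (t v) else
  if orient (sg a) (sg b) (sg v) <= 0 then inl i else
  if orient (sg b) (sg c) (sg v) <= 0 then inr ord0 else inr ord_max.
have [_ _ If] := En.
have Xi v : t v = i -> X (f v) (sg v) /\ (X (f v) = h1 \/ X (f v) = h2 \/ X (f v) = h3).
  move=> vi; rewrite /f vi eqxx /=.
  case: ifP => e1; first by rewrite /X eqxx; split=> //; left.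
  case: ifP => e2; first by rewrite /X eqxx; split=> //; right; left.
  rewrite /X /=; split; last by right; right.
  (* A vertex of class [i] in none of the three half planes would lie in the face that holds the
     others. *)
  rewrite /h3 /= leNgt; apply/negP => e3.
  have [y yi] := other i; apply: (class_notin_face (y := y) vi); rewrite If //.
  by split; [|split] => //=; rewrite ltNge ?e1 ?e2.
have Xn v : t v != i -> X (f v) = Xh (t v) by move=> vi; rewrite /f vi /X (negbTE vi).
exists f, X; split.
- move=> v; have [vi|vi] := eqVneq (t v) i; first by have [] := Xi v vi.
  by rewrite Xn //; have [[? [? [? [_ _ _ h _]]]] _] := XhP _ vi; exact: h.
- have c1 : cvx h1 by exact: cvx_orient_le.
  have c2 : cvx h2 by exact: cvx_orient_le.
  have c3' : cvx h3 by exact: cvx_orient_le.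
  move=> [j|e]; rewrite /X; last by case: ifP.
  case: ifPn => // ji; have [[? [? [? [_ _ -> _ _]]]] _] := XhP _ ji; exact: cvx_tri.
have half u v : t u != i -> t v = i -> disj (X (f u)) (X (f v)).
  move=> ui vi; rewrite Xn // => z /(XhP _ ui).2[/= e1 [/= e2 e3]].
  by have [_ [->|[->|->]]] := Xi v vi; rewrite /h1 /h2 /h3 /= leNgt ?e1 ?e2 ?e3.
move=> u v uv; have [ui|ui] := eqVneq (t u) i.
  have vi : t v != i by rewrite -ui eq_sym.
  by move=> z Xu Xv; exact: (half v u vi ui z).
have [vi|vi] := eqVneq (t v) i; first exact: half.
by rewrite !Xn //; exact: (hull_disj uv (XhP _ ui).1 (XhP _ vi).1).
Qed.

End StraightDrawing.
End ClassH.

(** * Counting colours on a cycle *)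

(** A step of the cyclic walk that changes the residue is charged to the colour it leaves, if that
    colour never returns, and otherwise to the colour it enters. In the second case the entered
    colour is new, for an earlier occurrence would interleave with the return of the colour left. So
    each colour is charged at most once in each way. *)
Lemma interleaved_count (k : nat) (C : finType) (cf : nat -> C) (s : seq nat) :
  (0 < k)%N -> (#|C| <= k + 2)%N -> sorted ltn s -> all (fun p => (p < k * k)%N) s ->
  (forall p q, p \in s -> q \in s -> cf p = cf q -> p = q %[mod k]) ->
  (forall p q r u, p \in s -> q \in s -> r \in s -> u \in s ->
    (p < q)%N -> (q < r)%N -> (r < u)%N -> cf p = cf r -> cf q = cf u -> q = r %[mod k]) ->
  (size s < 3 * k)%N.
Proof.
move=> k0 Ck ss /allP sn H1 H2; set N := size s.
have [N0|Npos] := posnP N; first by rewrite N0 muln_gt0.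
(* Index [N] closes the cycle: [w] returns to the first point there, and [q] adds the full length
   [k * k]. *)
pose w t := nth 0%N s (if (t < N)%N then t else 0%N).
pose q t := if (t < N)%N then w t else (w t + k * k)%N.
pose col t := cf (w t).
have ws t : w t \in s by apply: mem_nth; case: ifP.
have wmono i j : (i < j < N)%N -> (w i < w j)%N.
  move=> /andP[ij jN]; rewrite /w jN (ltn_trans ij jN).
  by apply: (sorted_ltn_nth ltn_trans 0%N ss); rewrite ?inE //; exact: ltn_trans ij jN.
have qE t : q t = w t %[mod k].
  by rewrite /q; case: ifP => // _; rewrite addnC modnMDl.
have wN : w N = w 0%N by rewrite /w ltnn; case: ifP.
have qmono t : (t < N)%N -> (q t < q t.+1)%N.
  move=> tN; rewrite /q tN; case: ifP => tN'; first by apply: wmono; rewrite ltnSn.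
  by apply: ltn_addl; exact: sn.
have qsum : (\sum_(t < N) (q t.+1 - q t) = k * k)%N.
  have := @telescope_sumn_in 0 N q (leq0n N).
  rewrite big_mkord => -> //.
    by rewrite /q ltnn Npos wN addKn.
  by move=> t /andP[_ tN]; exact: ltnW (qmono _ tN).
pose same (t : 'I_N) := q t.+1 == q t %[mod k].
have gap (t : 'I_N) : (1 + (k - 1) * same t <= q t.+1 - q t)%N.
  have lt := qmono t (ltn_ord t).
  rewrite /same; case: eqP => [E|_]; last by rewrite muln0 addn0 subn_gt0.
  rewrite muln1 subnKC //; apply: dvdn_leq; first by rewrite subn_gt0.
  by rewrite -(eqn_mod_dvd _ (ltnW lt)); exact/eqP.
pose D := [set t : 'I_N | ~~ same t]%SET.
have colN (t t' : nat) : col t = col t' -> w t = w t' %[mod k] by exact: H1.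
(* The index [N] is included, so the colour of the starting point counts as returning at the end. *)
pose last_ (t : 'I_N) := [forall l : 'I_N.+1, (t < l)%N ==> (col l != col t)].
pose phi (t : 'I_N) : C + C := if last_ t then inl (col t) else inr (col t.+1).
have firstP (t : 'I_N) : t \in D -> ~~ last_ t -> forall j, (j <= t)%N -> col j <> col t.+1.
  rewrite inE => nsame /forallPn[l]; rewrite negb_imply negbK => /andP[tl /eqP clt] j jt cj.
  have tS : w t.+1 = w t %[mod k] -> False.
    by move=> E; case/negP: nsame; apply/eqP; rewrite !qE.
  have lt1 : t.+1 != l.
    by apply/eqP => E; apply: tS; apply: colN; rewrite E.
  have {}tl : (t.+1 < l)%N by rewrite ltn_neqAle lt1.
  have jt' : (j < t)%N.
    rewrite ltn_neqAle jt andbT; apply/eqP => E; apply: tS; apply: colN; by rewrite -cj E.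
  have lN : (l <= N)%N by rewrite -ltnS.
  have t1N : (t.+1 < N)%N by exact: leq_trans tl lN.
  have [lN'|] := ltnP l N.
    apply: tS; symmetry; apply: (H2 (w j) (w t) (w t.+1) (w l)) => //; apply: wmono.
    - by rewrite jt' ltn_ord.
    - by rewrite ltnSn.
    - by rewrite tl.
  move=> Nl; have lE : val l = N by apply/eqP; rewrite eqn_leq lN.
  (* The return is at the starting point, so the interleaved quadruple begins with index 0 instead
     of ending with [l]. *)
  have c0 : col 0%N = col t by rewrite -clt lE /col wN.
  have [j0|j0] := posnP j.
    by apply: tS; apply: colN; rewrite -cj j0.
  apply: tS; have := colN _ _ cj => <-.
  apply: (H2 (w 0%N) (w j) (w t) (w t.+1)) => //; apply: wmono.
  - by rewrite j0 (ltn_trans jt').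
  - by rewrite jt' ltn_ord.
  - by rewrite ltnSn.
have lastP (t : 'I_N) : last_ t -> forall l, (t < l <= N)%N -> col l <> col t.
  move=> /forallP h l /andP[tl lN]; have lN' : (l < N.+1)%N by [].
  by have /implyP/(_ tl)/eqP := h (Ordinal lN').
have phi_inj : {in D &, injective phi}.
  move=> t t' tD t'D; rewrite /phi; case: ifPn => lt; case: ifPn => lt' // [] E.
    apply: val_inj => /=; have [h|h|//] := ltngtP t t'.
      by case: (lastP t lt t'); rewrite ?h ?(ltnW (ltn_ord t')) ?E.
    by case: (lastP t' lt' t); rewrite ?h ?(ltnW (ltn_ord t)) ?E.
  apply: val_inj => /=; have [h|h|//] := ltngtP t t'.
    by case: (firstP t' t'D lt' t.+1).
  by case: (firstP t tD lt t'.+1).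
(* Two charges never occur: leaving for good the colour of index [N], and entering the colour of
   index 0 as a new one. *)
have Dcard : (#|D| + 2 <= 2 * #|C|)%N.
  have sub : (phi @: D)%SET \subset ~: [set inl (col N); inr (col 0%N)]%SET.
    apply/fintype.subsetP => _ /imsetP[t tD ->]; rewrite !inE negb_or /phi.
    case: ifPn => lt; rewrite ?andbT /=; apply/eqP => -[] E.
      by case: (lastP t lt N); rewrite ?ltn_ord ?leqnn ?E.
    by case: (firstP t tD lt 0%N); rewrite ?E.
  have := subset_leq_card sub; rewrite card_in_imset //.
  rewrite [X in (_ <= X)%N]cardsCs finset.setCK cards2 card_sum (_ : (inl (col N) != inr (col 0%N) :> C + C) = true) // => h.
  have : (0 < #|C|)%N by apply/card_gt0P; exists (col 0%N).
  by lia.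
have tot : (N + (k - 1) * (N - #|D|) <= k * k)%N.
  rewrite -qsum; apply: (@leq_trans (\sum_(t < N) (1 + (k - 1) * same t))%N); last first.
    by apply: leq_sum => t _; exact: gap.
  rewrite big_split /= sum1_card card_ord -big_distrr /=.
  have -> : (\sum_(t < N) same t = N - #|D|)%N; last by [].
  have : (\sum_(t < N) same t + #|D| = N)%N; last by move=> /(congr1 (subn^~ #|D|)); rewrite addnK.
  rewrite -sum1_card [X in (_ + X)%N]big_mkcond -big_split /= -[RHS]card_ord -sum1_card.
  by apply: eq_bigr => t _; rewrite inE; case: (same t).
have DN : (#|D| <= N)%N by have := max_card (mem D); rewrite card_ord.
(* At most [2 * k + 2] steps change the residue. With [3 * k] points the total advance would be at
   least 3k + (k - 1)(k - 2) = k^2 + 2. *)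
rewrite ltnNge; apply/negP => N3; nia.
Qed.

(** * Points in weakly convex position *)

Section HalfPlanes.
Variable R : realDomainType.
Implicit Types a b c d e f : R.

(** The half-open upper half plane: it contains exactly one of two opposite nonzero vectors. On it,
    unlike on the whole circle, having a positive cross product is transitive. *)
Definition upper a b := (0 < b) || ((b == 0) && (0 < a)).

Lemma upperP a b : upper a b -> 0 < b \/ b = 0 /\ 0 < a.
Proof. by move=> /orP[|/andP[/eqP -> h]]; [left|right]. Qed.

Lemma upper_opp a b : ~~ upper a b -> (a != 0) || (b != 0) -> upper (- a) (- b).
Proof.
rewrite /upper !oppr_gt0 oppr_eq0 negb_or negb_and -!leNgt.
move=> /andP[b0 h] nz; have [//|b0'] := ltP b 0; have bE : b = 0 by apply/eqP; rewrite eq_le b0.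
by move: h nz; rewrite bE eqxx orbF /= => a0 a1; rewrite lt_neqAle a1.
Qed.

Lemma upper_trans a b c d e f : upper a b -> upper c d -> upper e f ->
  0 < a * d - b * c -> 0 < c * f - d * e -> 0 < a * f - b * e.
Proof.
move=> /upperP ab /upperP cd /upperP ef h1 h2.
have b0 : 0 <= b by case: ab => [/ltW|[->]].
have f0 : 0 <= f by case: ef => [/ltW|[->]].
case: cd => [d0|[d0 c0]]; last first.
  move: h1; rewrite d0 mulr0 sub0r oppr_gt0 ltNge mulr_ge0 //; exact: ltW.
have E : (a * f - b * e) * d = (a * d - b * c) * f + (c * f - d * e) * b by ring.
rewrite -(pmulr_lgt0 _ d0) E; case: ab h1 h2 => [b1|[-> a1]] h1 h2.
  by apply: ltr_wpDl; [apply: mulr_ge0 => //; exact: ltW|exact: mulr_gt0].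
case: ef h2 => [f1|[-> e1]] h2.
  by rewrite mulr0 addr0; exact: mulr_gt0.
move: h2; rewrite mulr0 sub0r oppr_gt0 ltNge mulr_ge0 //; exact: ltW.
Qed.

(** Three plane vectors satisfy a linear relation whose coefficients are their cross products; its
    second coordinate keeps the last two products from being both nonpositive. *)
Lemma upper_third a b c d e f : upper a b -> upper c d -> upper (- e) (- f) ->
  0 < a * d - b * c -> 0 < c * f - d * e \/ 0 < e * b - f * a.
Proof.
move=> /upperP ab /upperP cd /upperP ef h1.
have b0 : 0 <= b by case: ab => [/ltW|[->]].
have [|h2] := ltP 0 (c * f - d * e); first by left.
have [|h3] := ltP 0 (e * b - f * a); first by right.
have d0 : 0 < d.
  case: cd h1 => // -[-> c0]; rewrite mulr0 sub0r oppr_gt0 => h1.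
  by exfalso; move: h1; rewrite ltNge mulr_ge0 // ltW.
have E : (a * d - b * c) * f + (c * f - d * e) * b + (e * b - f * a) * d = 0 by ring.
have g2 : (c * f - d * e) * b <= 0 by rewrite mulr_le0_ge0.
have g3 : (e * b - f * a) * d <= 0 by apply: mulr_le0_ge0 => //; exact: ltW.
case: ef => [f0|[f0 e0]].
  have := mulr_gt0 h1 f0; rewrite mulrN; lra.
have {f0}f0 : f = 0 by apply/eqP; rewrite -oppr_eq0 f0.
move: h2; rewrite f0 mulr0 sub0r -mulrN leNgt mulr_gt0 //.
Qed.

End HalfPlanes.

Lemma upper_parallel (R : realFieldType) (a b c d : R) : upper a b -> upper c d ->
  a * d - b * c = 0 -> exists2 s, 0 < s & c = s * a /\ d = s * b.
Proof.
move=> /upperP ab /upperP cd /eqP; rewrite subr_eq0 => /eqP E.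
case: ab E => [b0|[-> a0]] E.
  have d0 : 0 < d.
    case: cd E => // -[-> c0] /eqP; rewrite mulr0 eq_sym mulf_eq0 => /orP[] /eqP h; lra.
  exists (d / b); first exact: divr_gt0.
  have b1 := lt0r_neq0 b0; split; last by rewrite divfK.
  by apply: (mulfI b1); rewrite -E; field.
move: E; rewrite mul0r => /eqP; rewrite mulf_eq0 (gt_eqF a0) /= => /eqP dE.
case: cd => [|[_ c0]]; first by rewrite dE ltxx.
exists (c / a); first exact: divr_gt0.
by rewrite divfK ?lt0r_neq0 // mulr0.
Qed.

(** * Angular order around an interior point *)

Section Angular.
Variable R : realType.
Implicit Types (p q r x y z c : plane R) (A B X : set (plane R)).

Lemma convex_cvx B : convex_set B -> cvx B.
Proof.
move=> cB p q Bp Bq _ [t + <-]; rewrite /= in_itv /= => /andP[t0 t1].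
have t01 : Itv.spec (@Itv.num_sem R) (Itv.Real `[0%Z, 1%Z]) (1 - t).
  by rewrite /Itv.spec /= /Itv.num_sem /= in_itv /= num_real /=; lra.
have := cB p q (Itv.mk t01); rewrite !inE => /(_ Bp Bq).
by rewrite /conv /= /unstable.onem subKr.
Qed.

(** The homothety with centre [c] and ratio [g] carries a ball around [x] in [B] to a ball in
    [B]. *)
Lemma cvx_interior B x c (g : R) : cvx B -> B° x -> B c -> 0 < g -> g <= 1 ->
  B° ((1 - g) *: c + g *: x).
Proof.
move=> cB /nbhs_ballP[e /= e0 be] Bc g0 g1; set z0 := _ + _.
apply/nbhs_ballP; exists (g * e); first exact: mulr_gt0.
move=> z; rewrite -ball_normE /= => zz; pose w := x + g^-1 *: (z - z0).
have gn := lt0r_neq0 g0.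
have Bw : B w.
  apply: be; rewrite -ball_normE /= /w opprD addNKr normrN normrZ.
  by rewrite gtr0_norm ?invr_gt0 // mulrC ltr_pdivrMr // distrC [e * g]mulrC.
apply: (cB c w) => //; exists g; first by rewrite /= in_itv /= (ltW g0).
by rewrite /w scalerDr scalerA divff // scale1r addrA -/z0 addrC subrK.
Qed.

Section Star.
Variables (o : plane R) (B X : set (plane R)).
Hypothesis cB : cvx B.
Hypothesis oB : B° o.
Hypothesis XB : X `<=` B.
Hypothesis Xn : forall p, X p -> ~ B° p.
Local Notation cr := (orient o).

Let cr_swap p q : cr q p = - cr p q. Proof. exact: orient_swap. Qed.

(** Of two points of [X] on a ray from [o], the nearer one would be interior to [B]. *)
Lemma boundary_ray p q (s : R) : X p -> X q -> 0 < s ->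
  q.1 - o.1 = s * (p.1 - o.1) -> q.2 - o.2 = s * (p.2 - o.2) -> p = q.
Proof.
have H p' q' (s' : R) : X p' -> X q' -> 0 < s' -> s' < 1 ->
  q'.1 - o.1 = s' * (p'.1 - o.1) -> q'.2 - o.2 = s' * (p'.2 - o.2) -> False.
  move=> Xp Xq s0 s1 e1 e2; apply: (Xn Xq).
  have -> : q' = (1 - (1 - s')) *: p' + (1 - s') *: o.
    by apply: plane_eq; rewrite ?comb1 ?comb2; lra.
  by apply: cvx_interior => //; [exact: XB|lra|lra].
move=> Xp Xq s0 e1 e2; have [s1|s1|s1] := ltgtP s 1.
- by case: (H p q s).
- case: (H q p s^-1) => //; rewrite ?invr_gt0 ?invf_lt1 // ?e1 ?e2 mulKf //; exact: lt0r_neq0.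
- by apply: plane_eq; move: e1 e2; rewrite s1; lra.
Qed.

Definition up p := upper (p.1 - o.1) (p.2 - o.2).
(** The order by angle around [o], counted from the positive horizontal direction. *)
Definition prec p q := (up p && ~~ up q) || ((up p == up q) && (0 < cr p q)).

Let Xo p : X p -> (p.1 - o.1 != 0) || (p.2 - o.2 != 0).
Proof.
move=> Xp; rewrite -negb_and !subr_eq0; apply/negP => /andP[/eqP e1 /eqP e2].
by case: (Xn Xp); rewrite (plane_eq e1 e2).
Qed.

Let down p : X p -> ~~ up p -> upper (o.1 - p.1) (o.2 - p.2).
Proof. by move=> Xp /upper_opp/(_ (Xo Xp)); rewrite !opprB. Qed.

Lemma prec_total p q : X p -> X q -> p != q -> prec p q || prec q p.
Proof.
move=> Xp Xq pq; rewrite /prec (eq_sym (up q)).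
have [h1|h1] := ltP 0 (cr p q).
  by rewrite andbT; case: (up p); case: (up q).
have [h2|h2] := ltP 0 (cr q p).
  by rewrite andbT; case: (up p); case: (up q).
have E : cr p q = 0 by move: h2; rewrite cr_swap oppr_le0; lra.
case up1 : (up p); case up2 : (up q) => //=; exfalso; move/eqP: pq; apply.
  have [s s0 [e1 e2]] := upper_parallel up1 up2 E.
  exact: (boundary_ray Xp Xq s0).
have up1' := down Xp (negbT up1); have up2' := down Xq (negbT up2).
have E' : (o.1 - p.1) * (o.2 - q.2) - (o.2 - p.2) * (o.1 - q.1) = 0.
  by rewrite -E /orient; ring.
have [s s0 [e1 e2]] := upper_parallel up1' up2' E'.
apply: (boundary_ray Xp Xq s0); lra.
Qed.

Lemma prec_trans p q r : X p -> X q -> X r -> prec p q -> prec q r -> prec p r.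
Proof.
move=> Xp Xq Xr; rewrite /prec.
case u1: (up p); case u2: (up q); case u3: (up r) => //=; rewrite ?andbF ?orbF //.
  by move=> h1 h2; exact: (upper_trans u1 u2 u3 h1 h2).
have v1 := down Xp (negbT u1); have v2 := down Xq (negbT u2); have v3 := down Xr (negbT u3).
move=> h1 h2; have := @upper_trans _ _ _ _ _ _ _ v1 v2 v3.
rewrite (_ : _ - _ = cr p q); last by rewrite /orient; ring.
rewrite (_ : _ - _ = cr q r); last by rewrite /orient; ring.
rewrite (_ : _ - _ = cr p r); last by rewrite /orient; ring.
exact.
Qed.

Let third p q r : up p -> up q -> X r -> ~~ up r -> 0 < cr p q -> 0 < cr q r \/ 0 < cr r p.
Proof.
move=> u1 u2 Xr /(down Xr) u3; rewrite -(opprB r.1) -(opprB r.2) in u3.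
exact: upper_third.
Qed.

Let third' p q r : X p -> ~~ up p -> X q -> ~~ up q -> up r -> 0 < cr p q -> 0 < cr q r \/ 0 < cr r p.
Proof.
move=> Xp /(down Xp) u1 Xq /(down Xq) u2 u3 h.
have u3' : upper (- (o.1 - r.1)) (- (o.2 - r.2)) by rewrite !opprB.
have h' : 0 < (o.1 - p.1) * (o.2 - q.2) - (o.2 - p.2) * (o.1 - q.1).
  by apply: lt_le_trans h _; rewrite /orient; lra.
case: (upper_third u1 u2 u3' h') => h''; [left|right].
  by apply: lt_le_trans h'' _; rewrite /orient; lra.
by apply: lt_le_trans h'' _; rewrite /orient; lra.
Qed.

(** At most one of the three successive angles around [o] is pi or more. *)
Lemma prec_turn p q r : X p -> X q -> X r -> prec p q -> prec q r ->
  [\/ 0 < cr p q /\ 0 < cr q r, 0 < cr q r /\ 0 < cr r p | 0 < cr r p /\ 0 < cr p q].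
Proof.
move=> Xp Xq Xr; rewrite /prec.
case u1: (up p); case u2: (up q); case u3: (up r) => //=; rewrite ?andbF ?orbF //= => h1 h2.
- by constructor 1.
- by case: (third u1 u2 Xr (negbT u3) h1); [constructor 1|constructor 3].
- by case: (third' Xq (negbT u2) Xr (negbT u3) u1 h2); [constructor 2|constructor 1].
- by constructor 1.
Qed.

(** Otherwise [q] would lie strictly between [o] and the point [c] of the chord from [p] to [r] in
    the same direction, hence in the interior of [B]; [g] is the ratio of the two distances from
    [o]. *)
Let turn2 p q r : X p -> X q -> X r -> 0 < cr p q -> 0 < cr q r -> 0 <= orient p q r.
Proof.
move=> Xp Xq Xr h1 h2; rewrite leNgt; apply/negP => h3.
have E : orient p q r = cr p q + cr q r - cr p r by rewrite /orient; ring.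
have s0 : 0 < cr p q + cr q r by exact: addr_gt0.
have c0 : 0 < cr p r by lra.
pose g : R := (cr p q + cr q r) / cr p r.
have g1 : g < 1 by rewrite /g ltr_pdivrMr // mul1r; lra.
have g0 : 0 < g by exact: divr_gt0.
apply: (Xn Xq).
pose c := (1 - cr p q / (cr p q + cr q r)) *: p + (cr p q / (cr p q + cr q r)) *: r.
have Bc : B c.
  apply: (cB (XB Xp) (XB Xr)); exists (cr p q / (cr p q + cr q r)) => //.
  by rewrite /= in_itv /= ler_pdivrMr // mul1r divr_ge0 ?(ltW h1) ?(ltW s0) //= lerDl ltW.
have -> : q = (1 - (1 - g)) *: c + (1 - g) *: o.
  have n1 := lt0r_neq0 s0; have n2 := lt0r_neq0 c0.
  have E1 : cr p r * (q.1 - o.1) = cr q r * (p.1 - o.1) + cr p q * (r.1 - o.1).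
    rewrite /orient; ring.
  have E2 : cr p r * (q.2 - o.2) = cr q r * (p.2 - o.2) + cr p q * (r.2 - o.2).
    rewrite /orient; ring.
  have F1 : q.1 = o.1 + (cr q r * (p.1 - o.1) + cr p q * (r.1 - o.1)) / cr p r.
    by rewrite -E1 mulrAC divff // mul1r subrKC.
  have F2 : q.2 = o.2 + (cr q r * (p.2 - o.2) + cr p q * (r.2 - o.2)) / cr p r.
    by rewrite -E2 mulrAC divff // mul1r subrKC.
  move: n1 n2 F1 F2; rewrite /c /g.
  move: (cr p q) (cr q r) (cr p r) => a b d n1 n2 F1 F2.
  apply: plane_eq; rewrite ?comb1 ?comb2 ?comb1 ?comb2 ?F1 ?F2.
    by field; rewrite n2 n1.
  by field; rewrite n2 n1.
apply: cvx_interior => //; lra.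
Qed.

Lemma prec_orient p q r : X p -> X q -> X r -> prec p q -> prec q r -> 0 <= orient p q r.
Proof.
move=> Xp Xq Xr pq qr; case: (prec_turn Xp Xq Xr pq qr) => [[h1 h2]|[h1 h2]|[h1 h2]].
- exact: turn2.
- by rewrite orient_rot; exact: turn2.
- by rewrite -orient_rot; exact: turn2.
Qed.

Let lin1 (a b : R) p q : (a *: p + b *: q).1 = a * p.1 + b * q.1. Proof. by []. Qed.

Let lin2 (a b : R) p q : (a *: p + b *: q).2 = a * p.2 + b * q.2. Proof. by []. Qed.

Lemma convex_combination p q (a b : R) : 0 <= a -> 0 <= b -> 0 < a + b ->
  segment p q ((a / (a + b)) *: p + (b / (a + b)) *: q).
Proof.
move=> a0 b0 ab; exists (b / (a + b)).
  by rewrite /= in_itv /= ler_pdivrMr // mul1r divr_ge0 ?(ltW ab) //= lerDr.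
by congr (_ *: _ + _); rewrite -[X in X - _](divff (lt0r_neq0 ab)) -mulrBl addrK.
Qed.

Let between p q r : 0 < cr p q -> 0 < cr q r -> orient p q r = 0 -> segment p r q.
Proof.
move=> h1 h2 h; have E : cr p r = cr q r + cr p q.
  by apply/eqP; rewrite -subr_eq0 -oppr_eq0 -[X in _ == X]h /orient; apply/eqP; ring.
have E1 : cr p r * (q.1 - o.1) = cr q r * (p.1 - o.1) + cr p q * (r.1 - o.1).
  rewrite /orient; ring.
have E2 : cr p r * (q.2 - o.2) = cr q r * (p.2 - o.2) + cr p q * (r.2 - o.2).
  rewrite /orient; ring.
have s0 : 0 < cr q r + cr p q by exact: addr_gt0.
have := convex_combination p r (ltW h2) (ltW h1) s0.
rewrite E in E1 E2; move: s0 E1 E2; move: (cr q r) (cr p q) => b a /lt0r_neq0 n E1 E2.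
suff -> : (b / (b + a)) *: p + (a / (b + a)) *: r = q by [].
have F1 : q.1 = o.1 + (b * (p.1 - o.1) + a * (r.1 - o.1)) / (b + a).
  by rewrite -E1 mulrAC divff // mul1r subrKC.
have F2 : q.2 = o.2 + (b * (p.2 - o.2) + a * (r.2 - o.2)) / (b + a).
  by rewrite -E2 mulrAC divff // mul1r subrKC.
by apply: plane_eq; rewrite ?lin1 ?lin2 ?F1 ?F2; field.
Qed.

(** Four points in angular order form a convex quadrilateral, possibly degenerate. Its diagonals
    meet, and the areas of its corner triangles are the weights of the common point. *)
Lemma prec_cross p q r u : X p -> X q -> X r -> X u -> prec p q -> prec q r -> prec r u ->
  exists2 z, segment p r z & segment q u z.
Proof.
move=> Xp Xq Xr Xu pq qr ru.
have pr := prec_trans Xp Xq Xr pq qr; have qu := prec_trans Xq Xr Xu qr ru.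
have a0 := prec_orient Xp Xq Xr pq qr; have b0 := prec_orient Xp Xr Xu pr ru.
have c0 := prec_orient Xp Xq Xu pq qu; have d0 := prec_orient Xq Xr Xu qr ru.
have S : orient p q r + orient p r u = orient p q u + orient q r u by rewrite /orient; ring.
have [s0|s0] := ltP 0 (orient p q r + orient p r u).
  have s1 : 0 < orient q r u + orient p q u by lra.
  have s2 : 0 < orient p r u + orient p q r by lra.
  have h1 := convex_combination p r d0 c0 s1.
  have h2 := convex_combination q u b0 a0 s2.
  eexists; first exact: h1.
  rewrite (_ : _ + _ = (orient p r u / (orient p r u + orient p q r)) *: q +
    (orient p q r / (orient p r u + orient p q r)) *: u) //.
  rewrite (_ : orient q r u + orient p q u = orient p r u + orient p q r); last by lra.
  have E1 : orient q r u * p.1 + orient p q u * r.1 = orient p r u * q.1 + orient p q r * u.1.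
    rewrite /orient; ring.
  have E2 : orient q r u * p.2 + orient p q u * r.2 = orient p r u * q.2 + orient p q r * u.2.
    rewrite /orient; ring.
  by apply: plane_eq; rewrite ?lin1 ?lin2 ![_ / _ * _]mulrAC -!mulrDl ?E1 ?E2.
(* Zero area: the four points are on one line, which weak convexity allows, and [q] or [u] lies
   between [p] and [r]. *)
have az : orient p q r = 0 by lra.
have bz : orient p r u = 0 by lra.
case: (prec_turn Xp Xq Xr pq qr) => [[h1 h2]|[h1 h2]|[h1 h2]].
- by exists q; [exact: between|exact: segment_l].
- have E : orient p q r = cr p q + cr q r + cr r p by rewrite /orient; ring.
  case: (prec_turn Xp Xr Xu pr ru) => [[h3 _]|[h3 h4]|[_ h3]].
  + by move: h3; rewrite cr_swap; lra.
  + exists u; last exact: segment_r.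
    by rewrite segment_sym; apply: between; rewrite // -orient_rot.
  + by move: h3; rewrite cr_swap; lra.
- have E : orient p q r = cr p q + cr q r + cr r p by rewrite /orient; ring.
  case: (prec_turn Xp Xr Xu pr ru) => [[h3 _]|[h3 h4]|[_ h3]].
  + by move: h3; rewrite cr_swap; lra.
  + exists u; last exact: segment_r.
    by rewrite segment_sym; apply: between; rewrite // -orient_rot.
  + by move: h3; rewrite cr_swap; lra.
Qed.

End Star.
(** The points are sorted by angle around an interior point of the body, not of the hull of [X], so
    collinear sets need no separate treatment. *)
Lemma weakly_convex_order X (n : nat) : (X #= `I_n)%card -> weakly_convex X ->
  exists x : nat -> plane R, [/\ {in [pred i | i < n]%N &, injective x}, X = x @` `I_n &
    forall i j l m, (i < j)%N -> (j < l)%N -> (l < m)%N -> (m < n)%N ->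
      exists2 z, segment (x i) (x l) z & segment (x j) (x m) z].
Proof.
move=> Xn [B [cptB /convex_cvx cB [c cI]] XB].
have [clB _] := (compact_closedP _).1 cptB.
have XB' : X `<=` B by move=> p /XB[+ _]; rewrite -((closure_id B).1 clB).
have XnB p : X p -> ~ B° p by move=> /XB[].
move: Xn; rewrite card_eq_sym => /card_set_bijP[f [fX finj fsurj]].
pose leT (p q : plane R) := (p == q) || prec c p q.
pose P := [pred p : plane R | `[< X p >]].
pose s0 := map f (iota 0 n); pose s := sort leT s0.
have s0P p : p \in s0 <-> X p.
  split=> [/mapP[i]|Xp]; first by rewrite mem_iota => /andP[_ ?] ->; exact: fX.
  by have [i ? <-] := fsurj p Xp; apply: map_f; rewrite mem_iota.
have sP : all P s by apply/allP => p; rewrite mem_sort => /s0P Xp; exact/asboolP.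
have us : uniq s.
  rewrite sort_uniq map_inj_in_uniq ?iota_uniq // => i j.
  by rewrite !mem_iota => /andP[_ ?] /andP[_ ?]; apply: finj; rewrite inE.
have szs : size s = n by rewrite size_sort size_map size_iota.
have tot : {in P &, total leT}.
  move=> p q /asboolP Xp /asboolP Xq; rewrite /leT; have [//|pq] := eqVneq p q.
  by case/orP: (prec_total cB cI XB' XnB Xp Xq pq) => -> //; rewrite !orbT.
have tra : {in P & &, transitive leT}.
  move=> q p r /asboolP Xq /asboolP Xp /asboolP Xr.
  move=> /orP[/eqP ->|pq] // /orP[/eqP <-|qr]; first by rewrite /leT pq orbT.
  by rewrite /leT (prec_trans cI XnB Xp Xq Xr pq qr) orbT.
have srt : sorted leT s by apply: (sort_sorted_in tot); rewrite -(all_sort _ leT).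
pose x i := nth c s i.
have xinj : {in [pred i | i < n]%N &, injective x}.
  by move=> i j; rewrite !inE -szs => ? ? /eqP; rewrite nth_uniq // => /eqP.
have Xx i : (i < n)%N -> X (x i).
  by move=> ni; apply/s0P; rewrite -(mem_sort leT) mem_nth // szs.
have mono i j : (i < j)%N -> (j < n)%N -> prec c (x i) (x j).
  move=> ij jn; have /orP[/eqP E|//] : leT (x i) (x j).
    by apply: (sorted_ltn_nth_in tra) => //; rewrite inE szs // (ltn_trans ij).
  by move: (ij); rewrite (xinj _ _ _ _ E) ?inE ?ltnn // (ltn_trans ij).
exists x; split=> //.
  apply/seteqP; split=> [p /s0P|_ [i /= ni <-]]; last exact: Xx.
  rewrite -(mem_sort leT) => ps; exists (index p s); last exact: nth_index.
  by rewrite /= -szs index_mem.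
move=> i j l m ij jl lm mn; have ln := ltn_trans lm mn; have jn := ltn_trans jl ln.
have in_ := ltn_trans ij jn.
by apply: (prec_cross cB cI XB' XnB) => //; [exact: Xx..|exact: mono|exact: mono|exact: mono].
Qed.

End Angular.

(** * The bound *)

Lemma bigminn_le (I : eqType) (r : seq I) (P : pred I) (F : I -> nat) x i :
  i \in r -> P i -> (\big[minn/x]_(j <- r | P j) F j <= F i)%N.
Proof.
move=> ir Pi; elim: r ir => // j r IH; rewrite inE big_cons => /orP[/eqP <-|ir].
  by rewrite Pi geq_minl.
by case: ifP => _; rewrite ?geq_min IH ?orbT.
Qed.

(** Connectedness links the third vertex [w] to [u] and to [v]; these are then all the neighbours of
    [w], and so they are linked as well. *)
Lemma locally_linked_triangle (G : sgraph) (u v : G) : locally_linked G -> #|G| = 3%N ->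
  u != v -> adj u v.
Proof.
move=> [Q0 Q1] G3 uv; apply: contraT => nuv.
have : #|~: [set u; v]%SET| == 1%N by rewrite cardsCs finset.setCK cards2 uv G3.
move=> /cards1P[w wE]; have third y : y != u -> y != v -> y = w.
  by move=> yu yv; apply/set1P; rewrite -wE !inE negb_or yu.
have uw : adj u w.
  have [||x [y [_ _ /set1P -> yu xy]]] := Q0 [set u]%SET u v isT isT.
  - by rewrite inE.
  - by rewrite inE eq_sym.
  rewrite -(third y) //; first by rewrite inE in yu.
  by apply: contraNneq nuv => <-.
have wv : adj w v.
  have [||x [y [_ _ /set1P -> yu xy]]] := Q0 [set v]%SET v u isT isT.
  - by rewrite inE.
  - by rewrite inE.
  rewrite adj_sym -(third y) //; last by rewrite inE in yu.
  by apply: contraNneq nuv => <-; rewrite adj_sym.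
have irr x : adj w x -> x != w by move=> h; apply: contraTneq h => ->; rewrite adj_irrefl.
(* As [w] is not its own neighbour, excluding it removes nothing. *)
have [||||x [y [_ /andP[wy yw] /set1P -> yu xy]]] := Q1 w w [set u]%SET u v.
- by rewrite adj_sym uw irr // adj_sym.
- by rewrite wv irr.
- by rewrite inE.
- by rewrite inE eq_sym.
have [yv|yv] := eqVneq y v; first by move: xy; rewrite yv (negbTE nuv).
by move: yw; rewrite (third y) ?eqxx //; rewrite inE in yu.
Qed.

Section Numbering.
Variables (k : nat) (T : finType) (t : T -> 'I_k).
Hypothesis k0 : (0 < k)%N.
Hypothesis cardt : forall i, #|[pred v | t v == i]| = k.

Definition class_number v : nat := (t v + k * index v (enum [pred u | t u == t v]))%N.

Let index_lt v : (index v (enum [pred u | t u == t v]) < k)%N.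
Proof. by rewrite -[X in (_ < X)%N](cardt (t v)) cardE index_mem mem_enum inE. Qed.

Lemma class_number_lt v : (class_number v < k * k)%N.
Proof. by have := index_lt v; have := ltn_ord (t v); rewrite /class_number; nia. Qed.

Lemma class_number_mod v : (class_number v %% k)%N = t v.
Proof. by rewrite /class_number addnC mulnC modnMDl modn_small. Qed.

Lemma class_number_inj : injective class_number.
Proof.
move=> u v E; have tE : t u = t v by apply: val_inj; rewrite /= -!class_number_mod E.
move: E; rewrite /class_number tE => /addnI/eqP; rewrite eqn_pmul2l // => /eqP E.
have mem w : t w = t v -> w \in enum [pred x | t x == t v] by rewrite mem_enum inE => ->.
by rewrite -(nth_index u (mem u tE)) E nth_index // mem.
Qed.

Lemma class_number_surj m : (m < k * k)%N -> exists v, class_number v = m.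
Proof.
move=> mk; have mk' : (m %/ k < k)%N by rewrite ltn_divLR.
pose i : 'I_k := Ordinal (ltn_pmod m k0).
have sz : (m %/ k < size (enum [pred u | t u == i]))%N by rewrite -cardE cardt.
have [x0 _] : exists x0, x0 \in [pred u | t u == i] by apply/card_gt0P; rewrite cardt.
pose v := nth x0 (enum [pred u | t u == i]) (m %/ k).
have tv : t v = i.
  by have := mem_nth x0 sz; rewrite mem_enum inE => /eqP.
exists v; rewrite /class_number tv index_uniq ?enum_uniq //= addnC mulnC.
by rewrite -divn_eq.
Qed.

End Numbering.

Section Bound.
Variables (R : realType) (k : nat) (H : sgraph).
Hypothesis k3 : (3 <= k)%N.
Variables (t : H -> 'I_k) (pos : H -> plane R) (curve : H -> H -> set (plane R)).
Local Notation T i := (induced (fun v : H => t v == i)).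
Local Notation posT i := (fun v : T i => pos (val v)).
Local Notation curveT i := (fun u v : T i => curve (val u) (val v)).
Hypothesis Hd : plane_drawing pos curve.
Hypothesis cardT : forall i, #|T i| = k.
Hypothesis maxT : forall i, maximal_plane (posT i) (curveT i).
Hypothesis outT : forall i j, i != j ->
  ~ exists2 F, inner_face (drawn_set (posT i) (curveT i)) F &
      drawn_set (posT j) (curveT j) `<=` F.
Hypothesis c3 : three_connected H.
Variable x : nat -> plane R.
Hypothesis xinj : {in [pred i | i < k * k]%N &, injective x}.
Hypothesis xcross : forall i j l m, (i < j)%N -> (j < l)%N -> (l < m)%N -> (m < k * k)%N ->
  exists2 z, segment (x i) (x l) z & segment (x j) (x m) z.

Let k0 : (0 < k)%N. Proof. exact: leq_trans k3. Qed.

Let cardt i : #|[pred v | t v == i]| = k.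
Proof. by rewrite -[RHS](cardT i) card_sig. Qed.

Let num := class_number t.
Let num_lt v : (num v < k * k)%N. Proof. exact: class_number_lt. Qed.
Let num_mod v : (num v %% k)%N = t v. Proof. exact: class_number_mod. Qed.
Let num_inj : injective num. Proof. exact: class_number_inj. Qed.
Let num_surj m : (m < k * k)%N -> exists v, num v = m. Proof. exact: class_number_surj. Qed.

(** If the colours of fixed vertices interleave, the segments between vertices of equal colour meet
    by [xcross], and each stays in the convex region of its colour. Regions of different
    triangulations are disjoint, so both colours belong to the same one. *)
Let fixed_bound4 sg (A : {set H}) : (4 <= k)%N -> straight_drawing sg ->
  {in A, forall v, sg v = x (num v)} -> (#|A| < 3 * k)%N.
Proof.
move=> k4 Hs Ax.
have outT' i j : i != j -> ~ exists2 F, inner_face (indraw pos curve (fun v => t v == i)) F &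
    indraw pos curve (fun v => t v == j) `<=` F.
  by move=> /outT; rewrite !drawn_induced.
have [f [X [Xf cX dX]]] := separated_colouring k4 Hd cardT maxT outT' c3 Hs.
have [v0 _] : exists v : H, v \in H by apply/card_gt0P; case: c3 => /(leq_trans _) ->.
pose vert m := odflt v0 [pick v | num v == m].
have vertK v : vert (num v) = v.
  by rewrite /vert; case: pickP => [u /eqP /num_inj //|/(_ v)]; rewrite eqxx.
pose s := sort leq (map num (enum A)).
have sP m : m \in s -> exists2 v, v \in A & m = num v.
  by rewrite mem_sort => /mapP[v]; rewrite mem_enum => vA ->; exists v.
have szs : size s = #|A| by rewrite size_sort size_map -cardE.
have same u v : t u = t v -> num u = num v %[mod k] by rewrite !num_mod => ->.
have meet u v z : X (f u) z -> X (f v) z -> t u = t v.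
  by move=> uz vz; apply/eqP; apply: contraT => uv; case: (dX u v uv z uz vz).
have := @interleaved_count k _ (fun m => f (vert m)) s; rewrite szs; apply=> //.
- by rewrite card_sum !card_ord.
- rewrite ltn_sorted_uniq_leq sort_uniq map_inj_uniq // enum_uniq.
  exact: (sort_sorted leq_total).
- by apply/allP => m /sP[v _ ->].
- move=> _ _ /sP[u uA ->] /sP[v vA ->]; rewrite !vertK => E; apply: same.
  by apply: (meet _ _ (sg u)) => //; rewrite -E.
move=> _ _ _ _ /sP[a aA ->] /sP[b bA ->] /sP[c cA ->] /sP[d dA ->] ab bc cd.
rewrite !vertK => Eac Ebd.
have [z zac zbd] := xcross ab bc cd (num_lt d).
rewrite -(Ax a aA) -(Ax c cA) in zac; rewrite -(Ax b bA) -(Ax d dA) in zbd.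
have Xz : X (f c) z by apply: (cX _ _ _ _ _ _ zac) => //; rewrite -Eac.
have Xz' : X (f b) z by apply: (cX _ _ _ _ _ _ zbd) => //; rewrite Ebd.
by apply: same; exact: (meet _ _ z).
Qed.

Let fixed_bound3 sg (A : {set H}) : k = 3%N -> straight_drawing sg ->
  {in A, forall v, sg v = x (num v)} -> (#|A| < 3 * k)%N.
Proof.
move=> kE Hs Ax; have cardH : (#|H| <= k * k)%N.
  rewrite -[X in (_ <= X)%N]card_ord; apply: (@leq_card H 'I_(k * k) (fun v => Ordinal (num_lt v))).
  by move=> u v /(congr1 val)/num_inj.
have [AT|AT] := eqVneq A [set: H]%SET; last first.
  apply: leq_trans (proper_card (_ : A \proper [set: H]%SET)) _; first by rewrite properT.
  by rewrite cardsT (leq_trans cardH) // kE.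
exfalso; have {AT}sgx v : sg v = x (num v) by apply: Ax; rewrite AT inE.
(* The numbers 0 and 3 are in one class, 1 and 4 in another, and the two pairs interleave. *)
have [v0 [v1 [v3 [v4 [e0 e1 e3 e4]]]]] : exists v0 v1 v3 v4,
    [/\ num v0 = 0, num v1 = 1, num v3 = 3 & num v4 = 4]%N.
  have [|v0 e0] := @num_surj 0; first by rewrite kE.
  have [|v1 e1] := @num_surj 1; first by rewrite kE.
  have [|v3 e3] := @num_surj 3; first by rewrite kE.
  have [|v4 e4] := @num_surj 4; first by rewrite kE.
  by exists v0, v1, v3, v4.
have t03 : t v3 = t v0 by apply: val_inj; rewrite /= -!num_mod e0 e3 kE.
have t14 : t v4 = t v1 by apply: val_inj; rewrite /= -!num_mod e1 e4 kE.
have t01 : t v0 != t v1.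
  by apply/eqP => /(congr1 val); rewrite /= -!num_mod e0 e1 kE.
have edge u v : t u = t v -> u != v -> adj u v.
  move=> uv nuv; have uv' : t u == t v by apply/eqP.
  have l := maximal_locally_linked (maxT (t v)).
  have := @locally_linked_triangle (T (t v)) (Sub u uv') (Sub v (eqxx (t v))) l.
  rewrite cardT => /(_ kE); exact.
have a03 : adj v0 v3 by apply: edge => //; apply/eqP => /(congr1 num); rewrite e0 e3.
have a14 : adj v1 v4 by apply: edge => //; apply/eqP => /(congr1 num); rewrite e1 e4.
have [z z03 z14] : exists2 z, segment (sg v0) (sg v3) z & segment (sg v1) (sg v4) z.
  by rewrite !sgx e0 e1 e3 e4; apply: xcross; rewrite // kE.
have [_ _ cross] := Hs.
have [|w + _] := cross v0 v3 v1 v4 a03 a14 _ z z03 z14.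
  apply/eqP => /setP/(_ v0); rewrite !inE eqxx /= => /esym/orP[] /eqP E.
    by move: t01; rewrite E eqxx.
  by move: t01; rewrite E t14 eqxx.
rewrite !inE => /andP[wl wr].
have : t w = t v0 by case/orP: wl => /eqP ->.
have : t w = t v1 by case/orP: wr => /eqP ->.
by move=> -> E; move: t01; rewrite E eqxx.
Qed.

(** The placement [pi] by class numbers is among those over which the minimum is taken, so a bound
    for it alone is enough. *)
Lemma fix_set_bound : (fix_set H (x @` `I_(k * k)) < 3 * k)%N.
Proof.
pose pi v := x (num v).
have pi_inj : injective pi.
  by move=> u v /xinj E; apply: num_inj; apply: E; rewrite inE.
have pi_range : range pi = x @` `I_(k * k).
  apply/seteqP; split=> [_ [v _ <-]|_ [m /= mk <-]]; first by exists (num v) => //=.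
  by have [v <-] := num_surj mk; exists v.
have bound : (fix_num pi <= (3 * k).-1)%N.
  apply/bigmax_leqP => A /asboolP[sg Hs AE].
  have Ax : {in A, forall v, sg v = x (num v)} by move=> v; rewrite AE inE => /eqP.
  rewrite -ltnS prednK ?muln_gt0 //.
  have [k4|k4] := leqP 4 k; first exact: (fixed_bound4 k4 Hs Ax).
  by apply: (fixed_bound3 _ Hs Ax); apply/eqP; rewrite eqn_leq k3 -ltnS k4.
have fixH : (fix_num pi < #|H|.+1)%N.
  by rewrite ltnS; apply/bigmax_leqP => A _; exact: max_card.
rewrite -[X in (_ < X)%N](@prednK (3 * k)) ?muln_gt0 // ltnS; apply: leq_trans bound.
apply: (@bigminn_le _ _ _ (fun m : 'I__ => m : nat) _ (Ordinal fixH)); first exact: mem_index_enum.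
by apply/asboolP; exists pi.
Qed.

End Bound.

Theorem theorem5p2 (R : realType) (k n : nat) (hk : (3 <= k)%N)
  (hn : n = (k ^ 2)%N) (H : sgraph) (hH : in_classH R k H)
  (X : set (plane R)) (hXn : (X #= `I_n)%card) (hX : weakly_convex X) :
  (fix_set H X)%:R < 3 * Num.sqrt (n%:R : R).
Proof.
have [t [pos [curve [Hd cardT maxT outT c3]]]] := hH.
have [x [xinj XE xcross]] := weakly_convex_order hXn hX.
rewrite hn -mulnn in xinj XE xcross.
rewrite hn natrX sqrtr_sqr ger0_norm ?ler0n // -natrM ltr_nat XE.
exact: (fix_set_bound hk Hd cardT maxT outT c3 xinj xcross).
Qed.
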